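(* Let $\{(R_k,B_k)\}_{k=1}^\infty$ and $\{(R_k,B'_k)\}_{k=1}^\infty$ be two sequences of admissible pairs in $\mathbb{R}^d$ satisfying the uniform contractive condition $\sup_k\|R_k^{-1}\|<1$. Suppose that $\{B_k\}_{k=1}^\infty$ and $\{B'_k\}_{k=1}^\infty$ are equivalent and that $B'_k\equiv B_k\pmod{R_k\mathbb{Z}^d}$ for all $k>0$. If the infinite convolution $\mu$ of $\{(R_k,B_k)\}_{k=1}^\infty$ exists and is an equi-positive measure, then (1) the infinite convolution $\mu'$ of $\{(R_k,B'_k)\}_{k=1}^\infty$ exists and is an equi-positive measure; (2) there exists $\Lambda\subseteq\mathbb{Z}^d$ such that $(\mu,\Lambda)$ and $(\mu',\Lambda)$ are both spectral pairs.
   Context: A matrix is expansive if all its eigenvalues have modulus strictly greater than $1$. $\|\cdot\|$ is the spectral norm, $\#$ denotes cardinality. For a finite nonempty set $A\subseteq\mathbb{R}^d$, $\delta_A=\frac{1}{\#A}\sum_{a\in A}\delta_a$, where $\delta_a$ is the Dirac measure at $a$; $*$ denotes convolution. Admissible pair: for a $d\times d$ expansive matrix $R$ with integer entries and a finite set $B\subseteq\mathbb{Z}^d$ with $\#B\ge2$, $(R,B)$ is an admissible pair in $\mathbb{R}^d$ if there exists $L\subseteq\mathbb{Z}^d$ such that the matrix $\big[\frac{1}{\sqrt{\#B}}e^{-2\pi i(R^{-1}b)\cdot\ell}\big]_{b\in B,\ell\in L}$ is unitary. $B'\equiv B\pmod{R\mathbb{Z}^d}$ means that $B'$ and $B$ agree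 modulo $R\mathbb{Z}^d$, i.e. there is a bijection $b\mapsto b'$ from $B$ to $B'$ with $b'-b\in R\mathbb{Z}^d$. Two sequences of finite sets $\{A_k\}_{k=1}^\infty$ and $\{A'_k\}_{k=1}^\infty$ in $\mathbb{R}^d$ are equivalent if $$\sum_{k=1}^{\infty}\Big(\frac{\#(A'_k\setminus A_k)}{\#A'_k}+\frac{\#(A_k\setminus A'_k)}{\#A_k}\Big)<\infty.$$ The infinite convolution of $\{(R_k,B_k)\}_{k=1}^\infty$ exists if the measures $\mu_k=\delta_{R_1^{-1}B_1}*\delta_{(R_2R_1)^{-1}B_2}*\cdots*\delta_{(R_kR_{k-1}\cdots R_1)^{-1}B_k}$ converge weakly, as $k\to\infty$, to a Borel probability measure $\mu$; $\mu$ is then called the infinite convolution of $\{(R_k,B_k)\}_{k=1}^\infty$. In that case, for each $k\ge1$, put $$\nu_{>k}=\delta_{R_{k+1}^{-1}B_{k+1}}*\delta_{(R_{k+2}R_{k+1})^{-1}B_{k+2}}*\cdots,$$ the infinite convolution of the shifted sequence $\{(R_{k+j},B_{k+j})\}_{j=1}^\infty$. The Fourier transform of a Borel probability measure $\eta$ on $\mathbb{R}^d$ is $\hat\eta(\xi)=\int_{\mathbb{R}^d}e^{-2\pi i\xi\cdot x}\,d\eta(x)$. A set $\Phi$ of Borel probability measures on $\mathbb{R}^d$ is an equi-positive family if there exist $\epsilon_0>0$ and $\delta_0>0$ such that for all $x\in[-\frac12,\frac12)^d$ and $\eta\in\Phi$ there exists $k_{x,\eta}\in\mathbb{Z}^d$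 with $|\hat\eta(x+y+k_{x,\eta})|\ge\epsilon_0$ for all $y\in\mathbb{R}^d$ with $|y|<\delta_0$, where $k_{x,\eta}=0$ for $x=0$. The infinite convolution $\mu$ of $\{(R_k,B_k)\}_{k=1}^\infty$ is called an equi-positive measure if there is a subsequence $\{\nu_{>n_j}\}_{j=1}^\infty$ of $\{\nu_{>k}\}_{k=1}^\infty$ that forms an equi-positive family; likewise for $\mu'$, with $B'_k$ in place of $B_k$. For a Borel probability measure $\mu$ on $\mathbb{R}^d$ and a countable set $\Lambda\subseteq\mathbb{R}^d$, $(\mu,\Lambda)$ is a spectral pair (and $\Lambda$ is a spectrum of $\mu$) if the exponentials $e_\lambda(x)=e^{-2\pi i\lambda\cdot x}$, $\lambda\in\Lambda$, form an orthonormal basis of $L^2(\mu)$. *)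

(* Defs.v *)
From HB Require Import structures.
From mathcomp Require Import all_boot all_order all_algebra finmap.
From mathcomp Require Import all_classical all_reals all_analysis.
From mathcomp.real_closed Require Import complex.
Set Implicit Arguments.
Unset Strict Implicit.
Unset Printing Implicit Defensive.
Import Order.TTheory GRing.Theory Num.Theory.
Import numFieldNormedType.Exports.
Local Open Scope classical_set_scope.
Local Open Scope ring_scope.
Local Open Scope complex_scope.

Notation cmod := (@Normc.normc _).

(* Sequences written (x_k)_{k >= 1} on paper are indexed from 0 here: term k
   below is the paper's term k + 1. *)

(* R^d is 'cV[R]_d, with the Borel sigma-algebra of its topology. *)
HB.instance Definition _ (R : realType) (d : nat) :=
  @isMeasurable.Build (sigma_display (@open 'cV[R]_d)) 'cV[R]_d
    <<s @open 'cV[R]_d >> (@sigma_algebra0 _ setT _) (@sigma_algebraC _ _)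
    (@sigma_algebra_bigcup _ setT _).

Definition borel_prob (R : realType) (d : nat) : Type :=
  probability 'cV[R]_d R.

Section Euclidean.
Variables (R : realType) (d : nat).

(* The norm `|x| of the library on 'cV[R]_d is the max norm, hence these. *)
Definition dotr (x y : 'cV[R]_d) : R := \sum_i x i 0 * y i 0.

Definition enorm (x : 'cV[R]_d) : R := Num.sqrt (dotr x x).

Definition spectral_norm (M : 'M[R]_d) : R :=
  sup [set enorm (M *m x) | x in [set x | enorm x <= 1]].

Definition intmx {m n} (M : 'M[int]_(m, n)) : 'M[R]_(m, n) := map_mx intr M.

(* e^{- 2 pi i xi . x} *)
Definition expchar (xi x : 'cV[R]_d) : R[i] :=
  let t := - (2 * pi * dotr xi x) in cos t +i* sin t.

End Euclidean.
Arguments intmx R {m n} M.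

Section Integration.
Variables (R : realType) (d : nat).
Implicit Types (mu eta : borel_prob R d) (f g : 'cV[R]_d -> R[i]).

Definition cintegral mu f : R[i] :=
  (\int[mu]_x complex.Re (f x)) +i* (\int[mu]_x complex.Im (f x)).

Definition fourier eta (xi : 'cV[R]_d) : R[i] := cintegral eta (expchar xi).

Definition L2norm mu f : \bar R := 'N[mu]_2%:E[EFin \o (cmod \o f)].

Definition in_L2 mu f : Prop :=
  [/\ measurable_fun setT (fun x => complex.Re (f x)),
      measurable_fun setT (fun x => complex.Im (f x)) &
      (L2norm mu f < +oo)%E].

Definition L2dot mu f g : R[i] := cintegral mu (fun x => f x * (g x)^*).

(* Orthonormal basis in the Hilbert space sense: orthonormal with dense linear span. *)
Definition spectral_pair mu (Lambda : set 'cV[R]_d) : Prop :=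
  [/\ countable Lambda,
      forall l l', Lambda l -> Lambda l' ->
        L2dot mu (expchar l) (expchar l') = (l == l')%:R &
      forall f, in_L2 mu f -> forall e : R, 0 < e ->
        exists (F : {fset 'cV[R]_d}) (c : 'cV[R]_d -> R[i]),
          [set` F] `<=` Lambda /\
          (L2norm mu (fun x => f x - \sum_(l <- F) c l * expchar l x)%R
             < e%:E)%E].

Definition equi_positive_family (Phi : set (borel_prob R d)) : Prop :=
  exists eps0 delta0 : R, [/\ 0 < eps0, 0 < delta0 &
    forall (x : 'cV[R]_d) (eta : borel_prob R d),
      (forall i, - (1 / 2) <= x i 0 < 1 / 2) -> Phi eta ->
      exists k : 'cV[int]_d,
        (x = 0 -> k = 0) /\
        forall y : 'cV[R]_d, enorm y < delta0 ->
          eps0 <= cmod (fourier eta (x + y + intmx R k))].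

(* delta_A and the convolution are left as set functions on the Borel sets: the
   library's integral and product measure do not require bundled measures. *)
Definition unif (A : {fset 'cV[R]_d}) : set 'cV[R]_d -> \bar R :=
  fun U => ((#|` A|%:R^-1)%:E * \sum_(a <- A) \d_a U)%E.

Definition convol (m1 m2 : set 'cV[R]_d -> \bar R) : set 'cV[R]_d -> \bar R :=
  pushforward (m1 \x m2)%E (fun p : 'cV[R]_d * 'cV[R]_d => p.1 + p.2).

Definition weak_cvg (m : nat -> set 'cV[R]_d -> \bar R) mu : Prop :=
  forall f : 'cV[R]_d -> R, continuous f -> (exists M : R, forall x, `|f x| <= M) ->
    (fun k => \int[m k]_x (f x)%:E)%E @ \oo --> (\int[mu]_x (f x)%:E)%E.

End Integration.

Section AdmissiblePairs.
Variables (R : realType) (d : nat).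
Implicit Types (M : 'M[int]_d) (B : {fset 'cV[int]_d}).

Definition expansive M : Prop :=
  forall z : R[i], eigenvalue (map_mx intr M) z -> 1 < cmod z.

Definition hadamard_mx M B (L : {fset 'cV[int]_d}) : 'M[R[i]]_(#|` B|, #|` L|) :=
  \matrix_(j, k) (((Num.sqrt #|` B|%:R)^-1)%:C *
    expchar (invmx (intmx R M) *m intmx R (enum_fset B)`_j)
            (intmx R (enum_fset L)`_k)).

(* `unitarymx` alone only says that the rows are orthonormal. *)
Definition admissible_pair M B : Prop :=
  [/\ expansive M, (2 <= #|` B|)%N &
      exists L : {fset 'cV[int]_d},
        #|` L| = #|` B| /\ hadamard_mx M B L \is unitarymx].

Definition congruent_mod M B B' : Prop :=
  exists f : 'cV[int]_d -> 'cV[int]_d,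
    set_bij [set` B] [set` B'] f /\
    forall b, b \in B -> exists z : 'cV[int]_d, f b - b = M *m z.

Definition equivalent_seq (T : choiceType) (A A' : nat -> {fset T}) : Prop :=
  (\sum_(0 <= k <oo)
     (#|` (A' k `\` A k)%fset|%:R / #|` A' k|%:R +
      #|` (A k `\` A' k)%fset|%:R / #|` A k|%:R : R)%:E < +oo)%E.

Section InfiniteConvolution.
Variables (Rs : nat -> 'M[int]_d) (B : nat -> {fset 'cV[int]_d}).

(* R_k ... R_2 R_1 *)
Fixpoint prod_mx (k : nat) : 'M[R]_d :=
  if k is k'.+1 then intmx R (Rs k') *m prod_mx k' else 1%:M.

(* (R_{k+1} ... R_1)^{-1} B_{k+1} *)
Definition digit_set (k : nat) : {fset 'cV[R]_d} :=
  [fset invmx (prod_mx k.+1) *m intmx R b | b in B k]%fset.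

Fixpoint partial_convol (k : nat) : set 'cV[R]_d -> \bar R :=
  if k is k'.+1 then convol (partial_convol k') (unif (digit_set k))
  else unif (digit_set 0).

Definition is_infinite_convol (mu : borel_prob R d) : Prop :=
  weak_cvg partial_convol mu.

End InfiniteConvolution.

Definition shift (T : Type) (n : nat) (u : nat -> T) : nat -> T :=
  fun j => u (n + j)%N.

(* nu k is nu_{>k}; only its values at k >= 1 are constrained. *)
Definition is_tail_seq (Rs : nat -> 'M[int]_d) (B : nat -> {fset 'cV[int]_d})
    (nu : nat -> borel_prob R d) : Prop :=
  forall k, (0 < k)%N -> is_infinite_convol (shift k Rs) (shift k B) (nu k).

(* `mu is an equi-positive measure': the tails depend on the sequence of pairs
   and not only on mu, hence the arguments. *)
Definition equi_positive_convol (Rs : nat -> 'M[int]_d)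
    (B : nat -> {fset 'cV[int]_d}) : Prop :=
  exists2 nu : nat -> borel_prob R d, is_tail_seq Rs B nu &
    exists n : nat -> nat,
      [/\ (0 < n 0)%N, {homo n : i j / (i < j)%N} &
          equi_positive_family (range (nu \o n))].

End AdmissiblePairs.
Arguments admissible_pair R {d} M B.
Arguments expansive R {d} M.
Arguments equi_positive_convol R {d} Rs B.
Arguments equivalent_seq R {T} A A'.

(* Main.v *)
Require Import Defs.
From HB Require Import structures.
From mathcomp Require Import all_boot all_order all_algebra finmap.
From mathcomp Require Import all_classical all_reals all_analysis measurable_realfun.
From mathcomp.real_closed Require Import complex.
From mathcomp Require Import ring lra.
Set Implicit Arguments.
Unset Strict Implicit.
Unset Printing Implicit Defensive.
Import Order.TTheory GRing.Theory Num.Theory.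
Import numFieldNormedType.Exports.
Local Open Scope classical_set_scope.
Local Open Scope ring_scope.

(* Both infinite convolutions are compared with the tails nu_{>n} of the first
   one.  Replacing the first n factors of mu by those of mu' gives measures
   mu'_n * (nu_{>n} rescaled), and passing from n to n + 1 changes the total
   variation by the proportion of digits in which B_{n+1} and B'_{n+1} differ.
   These proportions are summable, so the measures converge setwise to a
   probability mu', which is the infinite convolution; applied to the shifted
   sequences this also gives nu'_{>n}, with a Fourier transform uniformly close
   to that of nu_{>n}, so equi-positivity is inherited with eps / 2.

   For the common spectrum, congruent digit sets have the same dual digits L_k,
   and a set S is a spectrum of mu_n as soon as
   sum_{l in S} |mu_n^(xi + l)|^2 = 1 for all xi, a property preserved by adding
   (R_n ... R_1)^T L_{n+1} (passing to mu_{n+1}) and by translating elements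
   along the periods (R_n ... R_1)^T Z^d of mu_n^.  Equi-positivity provides
   translations, common to mu and mu', keeping |nu_{>n}^| away from 0 on the
   rescaled points, and no translation is needed for the points already
   chosen, which become small after rescaling.  The union of the resulting
   increasing chain satisfies Parseval's identity for every character, and
   characters span a dense subspace of L^2: an algebra of bounded functions
   closed under bounded pointwise limits contains the sign of x_i - a as soon
   as it contains the sines of x_i. *)

(** * Means and Borel probability measures *)

(** Measures are handled through their expectation functionals: convolving with a digit measure is
    dual to an averaging operator on functions, so statements about convolutions become statements
    about finite averages evaluated at 0, and mu' is built as a limit functional rather than by
    compactness. Closeness in total variation, not merely weak closeness, is what the transfer of
    equi-positivity requires: the translations k are unbounded, so the transforms of the tails must
    be close uniformly on all of R^d. The obstacle for the spectrum is completeness. Each finite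
    stage has Parseval sum exactly 1, but in the limit mass may be lost through points running off
    to infinity. The lower bound eps on the tails acts as domination: |mu_n^(xi + l)|^2 is at most
    eps^-2 |mu^(xi + l)|^2, whose sum over l is controlled by Bessel's inequality. The ball of
    radius delta has to absorb both the rescaled xi and the rescaled old points, whence delta / 2;
    the condition k = 0 at x = 0 is what leaves old points in place, so that the chain increases. *)

Section BoundedMeasurable.
Import HBNNSimple.
Context d (T : measurableType d) (R : realType).
Implicit Types (f g : T -> R) (A : set T) (E : (T -> R) -> R).

Definition bounded_measurable f :=
  measurable_fun setT f /\ exists M : R, forall x, `|f x| <= M.

Lemma bounded_measurableD f g : bounded_measurable f -> bounded_measurable g ->
  bounded_measurable (fun x => f x + g x).
Proof.
move=> [mf [M fM]] [mg [N gN]]; split; first exact: measurable_funD.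
by exists (M + N) => x; rewrite (le_trans (ler_normD _ _))// lerD.
Qed.

Lemma bounded_measurableM f g : bounded_measurable f -> bounded_measurable g ->
  bounded_measurable (fun x => f x * g x).
Proof.
move=> [mf [M fM]] [mg [N gN]]; split; first exact: measurable_funM.
by exists (M * N) => x; rewrite normrM ler_pM.
Qed.

Lemma bounded_measurable_cst c : bounded_measurable (fun=> c).
Proof. by split; [exact: measurable_cst|exists `|c|]. Qed.

Lemma bounded_measurableZ c f : bounded_measurable f ->
  bounded_measurable (fun x => c * f x).
Proof. by move=> bf; apply: bounded_measurableM => //; exact:
  bounded_measurable_cst. Qed.

Lemma bounded_measurable_indic A : measurable A ->
  bounded_measurable (\1_A : T -> R).
Proof.
move=> mA; split; first exact: measurable_indic.
by exists 1 => x; rewrite indicE; case: (_ \in _); rewrite ?normr1 ?normr0.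
Qed.

Lemma bounded_measurable_sum (I : Type) (s : seq I) (F : I -> T -> R) :
  (forall i, bounded_measurable (F i)) ->
  bounded_measurable (fun x => \sum_(i <- s) F i x).
Proof.
move=> bF; elim: s => [|i s ih].
  by under eq_fun do rewrite big_nil; exact: bounded_measurable_cst.
by under eq_fun do rewrite big_cons; exact: bounded_measurableD.
Qed.

(** A functional monotone class principle. Adding the bound [M] makes [f] nonnegative, so that the
    simple functions increasing to [f + M] stay between 0 and 2M and the convergence is bounded. *)
Lemma bounded_measurable_ind (P : (T -> R) -> Prop) :
  (forall A, measurable A -> P \1_A) ->
  (forall f g, bounded_measurable f -> bounded_measurable g ->
    P f -> P g -> P (fun x => f x + g x)) ->
  (forall c f, bounded_measurable f -> P f -> P (fun x => c * f x)) ->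
  (forall (f_ : nat -> T -> R) f (M : R), (forall n, bounded_measurable (f_ n)) ->
     bounded_measurable f -> (forall n x, `|f_ n x| <= M) ->
     (forall x, f_ ^~ x @ \oo --> f x) ->
     (forall n, P (f_ n)) -> P f) ->
  forall f, bounded_measurable f -> P f.
Proof.
move=> P1 PD PZ Plim f bf; have [mf [M fM]] := bf.
have PT c : P (fun=> c).
  have := PZ c \1_setT (bounded_measurable_indic measurableT) (P1 _ measurableT).
  by congr P; apply/funext => x; rewrite indicT mulr1.
have bMf : bounded_measurable (fun x => f x + M).
  by apply: bounded_measurableD => //; exact: bounded_measurable_cst.
suff PMf : P (fun x => f x + M).
  have := PD _ _ bMf (bounded_measurable_cst (- M)) PMf (PT _).
  by congr P; apply/funext => x; rewrite addrK.
pose g x := (f x + M)%:E.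
have mg : measurable_fun setT g by apply/measurable_EFinP; exact: bMf.1.
have g0 x : [set: T] x -> (0 <= g x)%E.
  move=> _; rewrite lee_fin -lerBlDr sub0r.
  by have := fM x; rewrite ler_norml => /andP[].
pose phi := nnsfun_approx measurableT mg.
have phig n x : 0 <= phi n x <= f x + M.
  rewrite fun_ge0/= -lee_fin /phi nnsfun_approxE.
  by apply: le_approx => // y _; exact: g0.
have bphi n : bounded_measurable (phi n).
  split; first exact: measurable_funP.
  exists (M + M) => x; have /andP[h1 h2] := phig n x.
  rewrite ger0_norm// (le_trans h2)// lerD2r.
  by have := fM x; rewrite ler_norml => /andP[].
apply: (Plim (fun n => phi n) _ (M + M)) => //.
- move=> n x; have /andP[h1 h2] := phig n x.
  rewrite ger0_norm// (le_trans h2)// lerD2r.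
  by have := fM x; rewrite ler_norml => /andP[].
- move=> x; have := cvg_nnsfun_approx measurableT mg g0 (I : [set: T] x).
  by move=> /fine_cvgP[].
move=> n; rewrite (_ : (phi n : T -> R) = fun x => \sum_(y <- fset_set (range (phi n)))
    (y * \1_(phi n @^-1` [set y]) x)); last first.
  by apply/funext => x /=; rewrite fimfunE fsbig_finite.
have bi y : bounded_measurable (\1_(phi n @^-1` [set y]) : T -> R).
  exact: bounded_measurable_indic.
elim: (enum_fset (fset_set (range (phi n)))) => [|y s ih].
  by under eq_fun do rewrite big_nil; exact: PT.
under eq_fun do rewrite big_cons; apply: PD => //.
- exact: bounded_measurableZ.
- by apply: bounded_measurable_sum => z; exact: bounded_measurableZ.
- by apply: PZ => //; exact: P1.
Qed.

End BoundedMeasurable.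

Lemma cvg_norm_le (R : realType) (u : nat -> R) (l M : R) :
  u @ \oo --> l -> (forall n, `|u n| <= M) -> `|l| <= M.
Proof.
move=> ul uM; apply: (closed_cvg (fun y : R => y <= M) (@closed_le _ M) _ _
  (cvg_norm ul)).
exact: nearW.
Qed.

Section Means.
Context d (T : measurableType d) (R : realType).
Implicit Types (f g : T -> R) (A : set T) (E : (T -> R) -> R).

(* Expectations, in the functional form of Daniell. *)
Definition is_mean E := [/\
  forall f g, bounded_measurable f -> bounded_measurable g ->
    E (fun x => f x + g x) = E f + E g,
  forall c f, bounded_measurable f -> E (fun x => c * f x) = c * E f,
  forall f, bounded_measurable f -> (forall x, 0 <= f x) -> 0 <= E f,
  E (fun=> 1) = 1 &
  forall (f_ : nat -> T -> R) f (M : R), (forall n, bounded_measurable (f_ n)) ->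
    bounded_measurable f -> (forall n x, `|f_ n x| <= M) ->
    (forall x, f_ ^~ x @ \oo --> f x) -> (fun n => E (f_ n)) @ \oo --> E f].

Lemma mean_cst E c : is_mean E -> E (fun=> c) = c.
Proof.
move=> [ED EZ _ E1 _]; rewrite (_ : (fun=> c) = fun x => c * (fun=> 1) x).
  by rewrite EZ ?E1 ?mulr1//; exact: bounded_measurable_cst.
by apply/funext => x; rewrite mulr1.
Qed.

Lemma meanB E f g : is_mean E -> bounded_measurable f -> bounded_measurable g ->
  E (fun x => f x - g x) = E f - E g.
Proof.
move=> [ED EZ _ _ _] bf bg; rewrite -mulN1r -EZ// -ED//; last first.
  exact: bounded_measurableZ.
by congr E; apply/funext => x; rewrite mulN1r.
Qed.

Lemma mean_sum E (I : Type) (s : seq I) (F : I -> T -> R) : is_mean E ->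
  (forall i, bounded_measurable (F i)) ->
  E (fun x => \sum_(i <- s) F i x) = \sum_(i <- s) E (F i).
Proof.
move=> mE bF; elim: s => [|i s ih].
  by under eq_fun do rewrite big_nil; rewrite big_nil (mean_cst _ mE).
under eq_fun do rewrite big_cons; rewrite big_cons -ih; case: mE => ED _ _ _ _.
by rewrite ED//; exact: bounded_measurable_sum.
Qed.

Lemma le_mean E f g : is_mean E -> bounded_measurable f -> bounded_measurable g ->
  (forall x, f x <= g x) -> E f <= E g.
Proof.
move=> mE bf bg fg; rewrite -subr_ge0 -meanB//; case: mE => _ _ E0 _ _.
apply: E0 => [|x]; last by rewrite subr_ge0.
apply: bounded_measurableD => //; under eq_fun do rewrite -mulN1r.
exact: bounded_measurableZ.
Qed.

Lemma mean_norm_le E f (M : R) : is_mean E -> bounded_measurable f ->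
  (forall x, `|f x| <= M) -> `|E f| <= M.
Proof.
move=> mE bf fM; rewrite ler_norml; apply/andP; split.
  rewrite -(mean_cst (- M) mE); apply: le_mean => //.
    exact: bounded_measurable_cst.
  by move=> x; have := fM x; rewrite ler_norml => /andP[].
rewrite -[leRHS](mean_cst M mE); apply: le_mean => //.
  exact: bounded_measurable_cst.
by move=> x; have := fM x; rewrite ler_norml => /andP[].
Qed.

(** The error [e * M] is uniform over all functions bounded by [M], so the clause on bounded
    convergence survives by an argument in three thirds, and each algebraic clause holds up to an
    arbitrarily small error. *)
Lemma uniform_limit_mean (E_ : nat -> (T -> R) -> R) E :
  (forall n, is_mean (E_ n)) ->
  (forall e : R, 0 < e -> exists n, forall f (M : R), bounded_measurable f ->
     (forall x, `|f x| <= M) -> `|E_ n f - E f| <= e * M) ->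
  is_mean E.
Proof.
move=> mE_ cE.
have eq0 (a C : R) : 0 <= C -> (forall e : R, 0 < e -> `|a| <= e * C) -> a = 0.
  move=> C0 h; apply/eqP; rewrite -normr_le0; apply/ler_addgt0Pr => e e0.
  rewrite add0r; apply: (le_trans (h (e / (C + 1)) _)).
    by rewrite divr_gt0// ltr_wpDl.
  by rewrite mulrAC ler_pdivrMr ?ltr_wpDl// ler_wpM2l ?(ltW e0) ?lerDl.
(* No point of [T] is at hand to deduce [0 <= M], hence the bound [Num.max 0 M]. *)
have b0 f (M : R) : (forall x : T, `|f x| <= M) -> 0 <= Num.max 0 M.
  by rewrite le_max lexx.
have bmax f (M : R) : (forall x : T, `|f x| <= M) -> forall x, `|f x| <= Num.max 0 M.
  by move=> h x; rewrite le_max h orbT.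
split.
- move=> f g bf bg; have [mf [M fM]] := bf; have [mg [N gN]] := bg.
  move: (b0 _ _ fM) (bmax _ _ fM) => {}M0 {}fM; set M' := Num.max 0 M in M0 fM.
  move: (b0 _ _ gN) (bmax _ _ gN) => {}N0 {}gN; set N' := Num.max 0 N in N0 gN.
  apply/eqP; rewrite -subr_eq0; apply/eqP.
  apply: (@eq0 _ ((M' + N') + (M' + N'))) => [|e e0]; first by rewrite !addr_ge0.
  have [n h] := cE e e0.
  have h1 := h _ _ bf fM; have h2 := h _ _ bg gN.
  have h3 := h _ (M' + N') (bounded_measurableD bf bg)
    (fun x => le_trans (ler_normD _ _) (lerD (fM x) (gN x))).
  have [ED _ _ _ _] := mE_ n; rewrite ED// in h3.
  move: h1 h2 h3; rewrite !ler_norml => /andP[? ?] /andP[? ?] /andP[? ?].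
  by apply/andP; split; lra.
- move=> c f bf; have [mf [M fM]] := bf.
  move: (b0 _ _ fM) (bmax _ _ fM) => {}M0 {}fM; set M' := Num.max 0 M in M0 fM.
  apply/eqP; rewrite -subr_eq0; apply/eqP.
  apply: (@eq0 _ ((`|c| * M') + (`|c| * M'))) => [|e e0].
    by rewrite !addr_ge0 ?mulr_ge0.
  have [n h] := cE e e0.
  have h1 := h _ _ bf fM.
  have h2 := h _ (`|c| * M') (bounded_measurableZ c bf).
  have {}h2 : `|E_ n (fun x => c * f x) - E (fun x => c * f x)| <= e * (`|c| * M').
    by apply: h2 => x; rewrite normrM ler_wpM2l.
  have [_ EZ _ _ _] := mE_ n; rewrite EZ// in h2.
  have {}h1 : `|c * E_ n f - c * E f| <= e * (`|c| * M').
    by rewrite -mulrBr normrM mulrCA ler_wpM2l.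
  move: h1 h2; rewrite !ler_norml => /andP[? ?] /andP[? ?].
  by apply/andP; split; lra.
- move=> f bf f0; have [mf [M fM]] := bf.
  move: (b0 _ _ fM) (bmax _ _ fM) => {}M0 {}fM; set M' := Num.max 0 M in M0 fM.
  rewrite leNgt; apply/negP => Ef0.
  suff : E f = 0 by move=> h; rewrite h ltxx in Ef0.
  apply: (@eq0 _ M') => // e e0; have [n h] := cE e e0.
  have := h _ _ bf fM; have [_ _ E0 _ _] := mE_ n; have := E0 _ bf f0.
  by rewrite (ltr0_norm Ef0) ler_norml => ? /andP[? ?]; lra.
- apply/eqP; rewrite -subr_eq0; apply/eqP.
  apply: (@eq0 _ 1) => // e e0; have [n h] := cE e e0.
  rewrite distrC; have := h (fun=> 1) 1 (bounded_measurable_cst _ _).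
  have [_ _ _ -> _] := mE_ n; apply => // x.
  by rewrite normr1.
- move=> f_ f M bf_ bf fM f_f; have fM' x : `|f x| <= M.
    exact: (cvg_norm_le (f_f x)).
  move: (b0 _ _ fM') (bmax _ _ fM') => M0 {}fM'.
  have {}fM n := bmax _ _ (fM n).
  set M' := Num.max 0 M in fM fM' M0.
  apply/cvgrPdist_le => e e0.
  pose e1 := e / 3 / (M' + 1).
  have M1 : 0 < M' + 1 by rewrite ltr_wpDl.
  have e10 : 0 < e1 by rewrite !divr_gt0.
  have e1M : e1 * M' <= e / 3.
    by rewrite /e1 mulrAC ler_pdivrMr// ler_wpM2l ?lerDl ?divr_ge0 ?(ltW e0).
  have [n h] := cE _ e10.
  have [_ _ _ _ Elim] := mE_ n.
  have /cvgrPdist_le/(_ (e / 3) (divr_gt0 e0 _)) := Elim _ _ _ bf_ bf fM f_f.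
  move=> /(_ ltac:(by [])) ; apply: filterS => k hk.
  have h1 := h _ _ bf fM'; have h2 := h _ _ (bf_ k) (fM k).
  move: hk h1 h2; rewrite !ler_norml => /andP[? ?] /andP[? ?] /andP[? ?].
  by apply/andP; split; lra.
Qed.

End Means.

(** * Representation of means by probability measures *)

Section MeanMeasure.
Context d (T : measurableType d) (R : realType).
Implicit Types (f g : T -> R) (A : set T) (E : (T -> R) -> R).

Lemma bounded_measurable_integrable (p : probability T R) f :
  bounded_measurable f -> p.-integrable setT (EFin \o f).
Proof.
move=> [mf [M fM]]; apply: measurable_bounded_integrable => //.
  by apply: le_lt_trans (ltry 1); exact: probability_le1.
by exists M; split => [|x Mx y _ /=]; rewrite ?num_real// (le_trans (fM y))// ltW.
Qed.

Lemma integral_EFin_Rintegral (p : probability T R) f : bounded_measurable f ->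
  (\int[p]_x (f x)%:E)%E = (\int[p]_x f x)%:E.
Proof.
move=> bf; rewrite /Rintegral fineK//.
exact: (integrable_fin_num _ (bounded_measurable_integrable p bf)).
Qed.

Lemma Rintegral_mean (p : probability T R) : is_mean (fun f => \int[p]_x f x).
Proof.
split.
- by move=> f g bf bg; rewrite RintegralD//; exact: bounded_measurable_integrable.
- by move=> c f bf; rewrite RintegralZl//; exact: bounded_measurable_integrable.
- by move=> f bf f0; apply: Rintegral_ge0.
- rewrite Rintegral_cst// mul1r; have := probability_setT p.
  by move=> /= ->.
- move=> f_ f M bf_ bf fM f_f.
  have [|||||_ _] := @dominated_convergence _ _ _ p setT measurableT
      (fun n x => (f_ n x)%:E) (EFin \o f) (fun=> M%:E).
  + by move=> n; apply/measurable_EFinP; exact: (bf_ n).1.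
  + by apply/measurable_EFinP; exact: bf.1.
  + apply: aeW => x _; apply: cvg_EFin; last exact: f_f.
    exact: nearW.
  + exact: finite_measure_integrable_cst.
  + by apply: aeW => x n _; rewrite /= lee_fin.
  by rewrite /= (integral_EFin_Rintegral p bf) => /fine_cvg.
Qed.

(** A mean is constrained only on bounded measurable functions; the absolute value makes the set
    function nonnegative on every set, as the measure structure requires. *)
Definition mean_measure E (mE : is_mean E) : set T -> \bar R :=
  fun A => `|E \1_A|%:E.

Section MeanMeasureProbability.
Variables (E : (T -> R) -> R) (mE : is_mean E).

Lemma mean_indic_ge0 A : measurable A -> 0 <= E \1_A.
Proof.
move=> mA; have [_ _ E0 _ _] := mE; apply: E0 => //.
exact: bounded_measurable_indic.
Qed.

Lemma mean_measure0 : mean_measure mE set0 = 0%E.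
Proof.
by rewrite /mean_measure indic0 (mean_cst 0 mE) normr0.
Qed.

Lemma mean_measure_ge0 A : (0 <= mean_measure mE A)%E.
Proof. by rewrite /mean_measure lee_fin. Qed.

(** By disjointness the partial sums of indicators take only the values 0 and 1, so countable
    additivity is an instance of bounded convergence for [E]. *)
Lemma mean_measure_sigma_additive : semi_sigma_additive (mean_measure mE).
Proof.
move=> F mF tF mUF; have [_ _ _ _ Elim] := mE.
have mi n : bounded_measurable (\1_(F n) : T -> R).
  exact: bounded_measurable_indic.
pose g n (x : T) : R := \sum_(0 <= i < n) \1_(F i) x.
have gE n : (\sum_(0 <= i < n) mean_measure mE (F i))%E = (E (g n))%:E.
  rewrite /mean_measure sumEFin (mean_sum _ mE)//; congr EFin.
  by apply: eq_bigr => i _; rewrite ger0_norm// mean_indic_ge0.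
under eq_fun do rewrite gE.
apply: cvg_EFin; first exact: nearW.
rewrite /mean_measure ger0_norm ?mean_indic_ge0//.
have gU n x : x \notin \bigcup_n F n -> g n x = 0.
  move=> /negP xF; rewrite /g big1// => i _; rewrite indicE.
  rewrite memNset// => Fix; apply: xF; rewrite inE; by exists i.
have gF n k x : F k x -> g n x = (k < n)%N%:R.
  move=> Fkx; have [kn|nk] := ltnP k n.
    rewrite /g (bigD1_seq k) ?mem_index_iota ?iota_uniq//= big1 ?addr0.
      by rewrite indicE mem_set.
    move=> i ik; rewrite indicE memNset// => Fix.
    by move/eqP : ik; apply; apply: (tF i k) => //; exists x.
  rewrite /g big_nat_cond big1// => i /andP[/andP[_ ink] _].
  rewrite indicE memNset// => Fix.
  have := tF i k I I (ex_intro _ x (conj Fix Fkx)) => ik.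
  by move: ink; rewrite ik ltnNge nk.
apply: (Elim _ _ 1).
- by move=> n; exact: bounded_measurable_sum.
- exact: bounded_measurable_indic.
- move=> n x; have [|xF] := boolP (x \in \bigcup_n F n).
    by rewrite inE => -[k _ Fkx]; rewrite (gF _ k)// ger0_norm//; case: (_ < _)%N.
  by rewrite gU// normr0.
- move=> x; have [xF|xF] := boolP (x \in \bigcup_n F n).
    move: (xF); rewrite inE => -[k _ Fkx]; rewrite indicE xF.
    apply: cvg_near_cst; exists k.+1 => // n /= kn.
    by rewrite (gF _ k)// kn.
  under eq_fun do rewrite gU//; rewrite indicE (negbTE xF); exact: cvg_cst.
Qed.

HB.instance Definition _ := isMeasure.Build _ _ _ (mean_measure mE)
  mean_measure0 mean_measure_ge0 mean_measure_sigma_additive.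

Lemma mean_measure_setT : mean_measure mE setT = 1%E.
Proof. by rewrite /mean_measure indicT; case: mE => _ _ _ -> _; rewrite normr1. Qed.

HB.instance Definition _ := Measure_isProbability.Build _ _ _ (mean_measure mE)
  mean_measure_setT.

(** A representation theorem of Daniell type, the source of the measures constructed below. The
    integral and [E] agree on indicators, and both respect the operations of
    [bounded_measurable_ind]. *)
Lemma mean_probability : exists p : probability T R,
  forall f, bounded_measurable f -> \int[p]_x f x = E f.
Proof.
exists (mean_measure mE); have mI := Rintegral_mean (mean_measure mE).
have [ED EZ _ _ Elim] := mE; have [ID IZ _ _ Ilim] := mI.
apply: bounded_measurable_ind => [A mA|f g bf bg If Ig|c f bf If|f_ f M bf_ bf
  fM f_f If].
- by rewrite /Rintegral integral_indic// setIT /= ger0_norm// mean_indic_ge0.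
- by rewrite ID// ED// If Ig.
- by rewrite IZ// EZ// If.
- apply: (@cvg_unique _ (@Rhausdorff R) ((fun n => E (f_ n)) @ \oo)); last first.
    exact: Elim fM f_f.
  by have := Ilim _ _ _ bf_ bf fM f_f; under eq_fun do rewrite If.
Qed.

End MeanMeasureProbability.

End MeanMeasure.

(** * Generators of the Borel sigma-algebra of R^d *)

Section BorelVectors.
Variables (R : realType) (d : nat).
Local Notation V := 'cV[R]_d.

Lemma open_measurable_vect (U : set V) : open U -> measurable U.
Proof. by move=> oU; exact: sub_sigma_algebra. Qed.

Lemma continuous_measurable_vect (f : V -> R) : continuous f ->
  measurable_fun setT f.
Proof.
move=> cf; apply: (measurability _ (RGenOpens.measurableE R)).
move=> _ [_ [a [b ->] <-]]; rewrite setTI; apply: open_measurable_vect.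
by apply: open_comp => // x _; exact: cf.
Qed.

Lemma continuous_measurable_vect2 (f : V -> V) : continuous f ->
  measurable_fun setT f.
Proof.
move=> cf; apply: (@measurability _ _ _ _ _ _ (@open V)) => //.
move=> _ [U oU <-]; rewrite setTI; apply: open_measurable_vect.
by apply: open_comp => // x _; exact: cf.
Qed.

Definition half_spaces : set (set V) :=
  [set A | exists i (a : R), A = [set x : V | a < x i 0]].

Lemma vect_ballP (x y : V) (e : R) :
  ball x e y <-> 0 < e /\ forall i, `|x i 0 - y i 0| < e.
Proof.
split=> [[e0 h]|[e0 h]]; split => //; first by move=> i; exact: h.
by move=> i j; rewrite (ord1 j); exact: h.
Qed.

(** An open set is the union of the cubes it contains with rational centre and radius 1/(n+1), and
    there are countably many of these. Each is a finite intersection of coordinate strips, since the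
    balls of the max norm are cubes. *)
Lemma half_spaces_measurable : @measurable _ V `<=` <<s half_spaces >>.
Proof.
apply: smallest_sub; first exact: smallest_sigma_algebra.
move=> U oU.
pose T' := g_sigma_algebraType half_spaces.
suff: @measurable _ T' U by [].
have mcoord i : measurable_fun [set: T'] ((fun x : V => x i 0) : T' -> R).
  apply: (measurability _ (RGenOInfty.measurableE R)).
  move=> _ [_ [a ->] <-]; rewrite setTI; apply: sub_sigma_algebra.
  by exists i, a; apply/seteqP; split=> x /=; rewrite in_itv/= andbT.
pose B (k : 'cV[rat]_d * nat) : set V :=
  [set x | forall i, `|ratr (k.1 i 0) - x i 0| < k.2.+1%:R^-1].
have mB k : @measurable _ T' (B k).
  rewrite (_ : B k = \bigcap_(i in [set: 'I_d])
      (fun x : V => x i 0) @^-1` ball (ratr (k.1 i 0) : R) (k.2.+1%:R^-1)).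
    apply: fin_bigcap_measurable => // i _; rewrite -[X in measurable X]setTI.
    by apply: mcoord => //; exact: measurable_ball.
  by apply/seteqP; split => [x Bx i _|x Bx i]; [exact: Bx|exact: Bx].
rewrite (_ : U = \bigcup_k (if `[< B k `<=` U >] then B k else set0)).
  apply: (@countable_bigcupT_measurable _ T') => // k.
  by case: ifP => _; [exact: mB|exact: measurable0].
apply/seteqP; split => [x Ux|x [k _]]; last first.
  by case: ifPn => // /asboolP h /h.
have /nbhs_ballP[e /= e0 eU] : nbhs x U by exact: open_nbhs_nbhs.
have [n ne] : exists n : nat, n.+1%:R^-1 < e / 2.
  have e20 : 0 < e / 2 by rewrite divr_gt0.
  near \oo => n; exists n; near: n; exact: near_infty_natSinv_lt (PosNum e20).
have n0 : 0 < n.+1%:R^-1 :> R by rewrite invr_gt0.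
have hq i : exists q : rat, `|ratr q - x i 0| < n.+1%:R^-1.
  have /rat_in_itvoo[q] : x i 0 - n.+1%:R^-1 < x i 0 + n.+1%:R^-1.
    by rewrite ltrD2l gtrN.
  rewrite in_itv/= => /andP[h1 h2]; exists q.
  by rewrite ltr_norml ltrBrDl h1/= ltrBlDl.
have [q hq'] := choice hq.
exists (\col_i q i, n) => //=.
have BU : B (\col_i q i, n) `<=` U.
  move=> y By; apply: eU; apply/vect_ballP; split => // i.
  rewrite (splitr e) (le_lt_trans (ler_distD (ratr (q i)) _ _))// ltrD//.
    by rewrite distrC (lt_trans (hq' i)).
  by have := By i; rewrite /= mxE => /lt_trans; apply.
by case: ifPn => [_ i|/asboolP//]; rewrite /= mxE.
Unshelve. all: by end_near. Qed.

Lemma sigma_algebra_half_spaces (S : set (set V)) : sigma_algebra setT S ->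
  (forall i (a : R), S [set x : V | a < x i 0]) -> @measurable _ V `<=` S.
Proof.
move=> sS SH A /half_spaces_measurable; apply: smallest_sub => //.
by move=> _ [i [a ->]].
Qed.

Lemma bounded_continuous_measurable (f : V -> R) (M : R) : continuous f ->
  (forall x, `|f x| <= M) -> bounded_measurable f.
Proof. by move=> cf fM; split; [exact: continuous_measurable_vect|exists M]. Qed.

End BorelVectors.

(** * Uniqueness of weak limits *)

Section WeakUniqueness.
Variables (R : realType) (d : nat).
Local Notation V := 'cV[R]_d.

(** Open sets presented with a witness: [h] yields at once stability under intersection, by
    products, and continuous functions increasing to the indicator. *)
Definition positivity_sets : set (set V) :=
  [set A | exists h : V -> R, [/\ continuous h, forall x, 0 <= h x &
    A = [set x | 0 < h x]]].

Lemma positivity_sets_open A : positivity_sets A -> open A.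
Proof.
move=> [h [ch _ ->]]; apply: (@open_comp _ _ h [set y | 0 < y]).
  by move=> x _; exact: ch.
exact: open_gt.
Qed.

Lemma positivity_sets_setI : setI_closed positivity_sets.
Proof.
move=> _ _ [g [cg g0 ->]] [h [ch h0 ->]]; exists (fun x => g x * h x); split.
- by move=> x; apply: continuousM; [exact: cg|exact: ch].
- by move=> x; rewrite mulr_ge0.
apply/seteqP; split => x /=; first by move=> [? ?]; rewrite mulr_gt0.
move=> gh; split; rewrite lt_neqAle eq_sym ?g0 ?h0 andbT; apply/eqP => z;
  by rewrite z ?mul0r ?mulr0 ltxx in gh.
Qed.

Lemma positivity_sets_generate : @measurable _ V = <<s positivity_sets >>.
Proof.
apply/seteqP; split; last first.
  apply: smallest_sub; first exact: sigma_algebra_measurable.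
  by move=> A /positivity_sets_open; exact: open_measurable_vect.
apply: sigma_algebra_half_spaces; first exact: smallest_sigma_algebra.
move=> i a; apply: sub_sigma_algebra.
have ci : continuous (fun x : V => x i 0 - a).
  move=> x; apply: continuousB; last exact: cst_continuous.
  exact: coord_continuous.
exists (fun x => x i 0 - a + `|x i 0 - a|); split.
- by move=> x; exact: (cvgD (ci x) (cvg_norm (ci x))).
- by move=> x; rewrite -lerBlDl sub0r -normrN ler_norm.
apply/seteqP; split => x /=.
  by rewrite -subr_gt0 => h; rewrite (gtr0_norm h) addr_gt0.
rewrite -(subr_gt0 a) => h0; rewrite ltNge; apply/negP => h.
by rewrite (ler0_norm h) subrr ltxx in h0.
Qed.

(** The functions 1 - exp(- n h) are continuous, lie in [0, 1] and tend to the indicator of [h > 0];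
    bounded convergence then gives equality on a pi-system generating the Borel sets. *)
Lemma weak_limit_unique (p q : borel_prob R d) :
  (forall f : V -> R, continuous f -> (exists M : R, forall x, `|f x| <= M) ->
     \int[p]_x f x = \int[q]_x f x) ->
  forall f, bounded_measurable f -> \int[p]_x f x = \int[q]_x f x.
Proof.
move=> pq; suff pqA A : measurable A -> p A = q A.
  by move=> f _; congr fine; apply: eq_measure_integral => A mA _; exact: pqA.
apply: (measure_unique positivity_sets (fun=> setT)).
- exact: positivity_sets_generate.
- exact: positivity_sets_setI.
- move=> _; exists (fun=> 1); split => //; first by move=> x; exact: cst_continuous.
  by apply/seteqP; split => x //= _; rewrite ltr01.
- by rewrite bigcup_const//; exists 0%N.
- move=> {}A GA; have mA : measurable A.
    exact: open_measurable_vect (positivity_sets_open GA).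
  case: GA => h [ch h0 Ah].
  pose f n (x : V) : R := 1 - expR (- (n%:R * h x)).
  have f01 n x : 0 <= f n x <= 1.
    by rewrite /f subr_ge0 lerBlDr lerDl expR_ge0 andbT -expR0 ler_expR
      oppr_le0 mulr_ge0.
  have fn1 n x : `|f n x| <= 1 by have /andP[f0 f1] := f01 n x; rewrite ger0_norm.
  have cf n : continuous (f n).
    move=> x; have h1 : n%:R * h y @[y --> x] --> n%:R * h x.
      exact: (cvgM (cvg_cst (n%:R : R)) (ch x)).
    have h2 := continuous_cvg _ (@continuous_expR R _) (cvgN h1).
    exact: (cvgB (cvg_cst (1 : R)) (h2 _ _)).
  have fA x : f ^~ x @ \oo --> (\1_A x : R).
    have [hx|hx] := ltP 0 (h x); last first.
      have hx0 : h x = 0 by apply/eqP; rewrite eq_le hx h0.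
      rewrite indicE memNset ?Ah/= ?hx0 ?ltxx//.
      rewrite /f hx0; under eq_fun do rewrite mulr0 oppr0 expR0 subrr.
      exact: cvg_cst.
    rewrite indicE mem_set ?Ah// -[X in _ --> X](subr0 1).
    apply: cvgB; first exact: cvg_cst.
    under eq_fun do rewrite -mulrN expRM_natl.
    by apply: cvg_expr; rewrite gtr0_norm ?expR_gt0// expR_lt1 oppr_lt0.
  have bf n := bounded_continuous_measurable (cf n) (fn1 n).
  have bA := bounded_measurable_indic R mA.
  have pE (r : borel_prob R d) : r A = (\int[r]_x (\1_A x : R))%:E.
    rewrite -integral_EFin_Rintegral// integral_indic// setIT//.
  apply: (eq_trans (pE p)); apply: (eq_trans _ (esym (pE q))); congr EFin.
  have [_ _ _ _ plim] := Rintegral_mean p.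
  have [_ _ _ _ qlim] := Rintegral_mean q.
  apply: (@cvg_unique _ (@Rhausdorff R) ((fun n => \int[p]_x f n x) @ \oo)).
    exact: plim bf bA fn1 fA.
  rewrite (_ : (fun n => \int[p]_x f n x) = fun n => \int[q]_x f n x).
    exact: qlim bf bA fn1 fA.
  by apply/funext => n; apply: pq; [exact: cf|exists 1; exact: fn1].
- by move=> _; apply: le_lt_trans (ltry 1); exact: probability_le1.
Qed.

End WeakUniqueness.

Lemma invmxM (F : comUnitRingType) (n : nat) (A B : 'M[F]_n) :
  A \in unitmx -> B \in unitmx -> invmx (A *m B) = invmx B *m invmx A.
Proof.
move=> uA uB; have uAB : A *m B \in unitmx by rewrite unitmx_mul uA.
rewrite -[RHS]mul1mx -(mulVmx uAB) -!mulmxA (mulmxA B) mulmxV// mul1mx.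
by rewrite mulmxV// mulmx1.
Qed.

Lemma cvg_sumr (R : realType) (T I : Type) (F : set_system T) (s : seq I)
    (f : I -> T -> R) (l : I -> R) : Filter F ->
  (forall i, f i x @[x --> F] --> l i) ->
  (\sum_(i <- s) f i x) @[x --> F] --> \sum_(i <- s) l i.
Proof.
move=> FF fl; elim: s => [|i s ih].
  by rewrite big_nil; under eq_fun do rewrite big_nil; exact: cvg_cst.
rewrite big_cons; under eq_fun do rewrite big_cons.
exact: (cvgD (fl i) ih).
Qed.

(** * Averaging over digits and infinite convolutions *)

Section EqSetFunction.
Import HBNNSimple.

(* The library states this for bundled measures only. *)
Lemma eq_setfun_integral d (T : measurableType d) (R : realType)
    (m1 m2 : set T -> \bar R) (f : T -> \bar R) :
  (forall A, measurable A -> m1 A = m2 A) ->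
  (\int[m1]_x f x = \int[m2]_x f x)%E.
Proof.
move=> m12.
have sE (h : {nnsfun T >-> R}) : sintegral m1 h = sintegral m2 h.
  by apply: eq_fsbigr => r _; rewrite m12.
rewrite /integral; congr (ereal_sup _ - ereal_sup _)%E.
- by apply/seteqP; split => _ [h hf <-]; exists h => //; rewrite sE.
- by apply/seteqP; split => _ [h hf <-]; exists h => //; rewrite sE.
Qed.

End EqSetFunction.

Section Averages.
Variables (R : realType) (d : nat).
Local Notation V := 'cV[R]_d.
Implicit Types (M : 'M[int]_d) (D : {fset 'cV[int]_d}).

Definition digit_map M (b : 'cV[int]_d) (y : V) : V :=
  invmx (intmx R M) *m (intmx R b + y).

(* The adjoint of p |-> delta_{M^-1 D} * (M^-1)_# p. *)
Definition digit_avg (K : fieldType) M D (f : V -> K) (y : V) : K :=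
  #|` D|%:R^-1 * \sum_(b <- D) f (digit_map M b y).

(** The value at y is the expectation of f(X + P_n^-1 y), where X has law mu_n and P_n = R_n ...
    R_1; at y = 0 it is the integral of f against mu_n. The field is a parameter so that test
    functions and characters share the operator. *)
Fixpoint iter_avg (K : fieldType) (Rs : nat -> 'M[int]_d)
    (B : nat -> {fset 'cV[int]_d}) (n : nat) (f : V -> K) : V -> K :=
  if n is m.+1 then digit_avg (Rs m) (B m) (iter_avg Rs B m f) else f.

Lemma iter_avg_add (K : fieldType) Rs B n m (f : V -> K) :
  iter_avg Rs B (n + m) f =
  iter_avg (Defs.shift n Rs) (Defs.shift n B) m (iter_avg Rs B n f).
Proof. by elim: m => [|m ih]; rewrite ?addn0// addnS /= ih. Qed.

Lemma vect_continuous (f : V -> V) :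
  (forall i, continuous (fun x => f x i 0)) -> continuous f.
Proof.
move=> cf x A /nbhs_ballP[e /= e0 eA].
have : \forall y \near (x : V), forall i, `|f x i 0 - f y i 0| < e.
  apply: (@filter_forall _ _ (fun i y => `|f x i 0 - f y i 0| < e) _
    (nbhs_filter (x : V))) => i.
  exact: (@cvgr_dist_lt _ _ _ _ _ (fun y => f y i 0) _ (cf i x) e e0).
by apply: filterS => y h; apply: eA; apply/vect_ballP.
Qed.

Lemma add_continuous_fun (f g : V -> R) : continuous f -> continuous g ->
  continuous (fun x => f x + g x).
Proof. by move=> cf cg x; exact: (cvgD (cf x) (cg x)). Qed.

Lemma mul_continuous_fun (f g : V -> R) : continuous f -> continuous g ->
  continuous (fun x => f x * g x).
Proof. by move=> cf cg x; exact: (cvgM (cf x) (cg x)). Qed.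

Lemma sum_continuous_fun (I : Type) (s : seq I) (f : I -> V -> R) :
  (forall i, continuous (f i)) -> continuous (fun x => \sum_(i <- s) f i x).
Proof.
move=> cf; elim: s => [|i s ih].
  by under eq_fun do rewrite big_nil; exact: cst_continuous.
by under eq_fun do rewrite big_cons; exact: add_continuous_fun.
Qed.

Lemma affine_continuous (A : 'M[R]_d) (c : V) : continuous (fun x => A *m (c + x)).
Proof.
apply: vect_continuous => i; under eq_fun do rewrite mxE.
apply: sum_continuous_fun => j; apply: mul_continuous_fun.
  exact: cst_continuous.
under eq_fun do rewrite mxE; apply: add_continuous_fun; first exact: cst_continuous.
exact: coord_continuous.
Qed.

Lemma digit_map_continuous M b : continuous (digit_map M b).
Proof. exact: affine_continuous. Qed.

Lemma translation_continuous (a : V) : continuous (fun x : V => x + a).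
Proof.
have -> : (fun x : V => x + a) = fun x => 1%:M *m (a + x).
  by apply/funext => x; rewrite mul1mx addrC.
exact: affine_continuous.
Qed.

Lemma bounded_measurable_comp (f : V -> R) (g : V -> V) :
  bounded_measurable f -> continuous g -> bounded_measurable (fun x => f (g x)).
Proof.
move=> [mf [M fM]] /continuous_measurable_vect2 mg; split; last by exists M => x.
exact: (measurableT_comp mf).
Qed.

Lemma digit_avg_continuous M D (f : V -> R) :
  continuous f -> continuous (digit_avg M D f).
Proof.
move=> cf; apply: mul_continuous_fun; first exact: cst_continuous.
apply: sum_continuous_fun => b x; apply: (@continuous_comp _ _ _ (digit_map M b) f).
  exact: digit_map_continuous.
exact: cf.
Qed.

Lemma digit_avg_bounded_measurable M D (f : V -> R) :
  bounded_measurable f -> bounded_measurable (digit_avg M D f).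
Proof.
move=> bf; apply: bounded_measurableZ; apply: bounded_measurable_sum => b.
apply: bounded_measurable_comp => //; exact: digit_map_continuous.
Qed.

Lemma cardfs_gt0R D : (0 < #|` D|)%N -> (#|` D|%:R : R) != 0.
Proof. by rewrite pnatr_eq0 lt0n. Qed.

Lemma sum_cstfs (D : {fset 'cV[int]_d}) (c : R) :
  \sum_(b <- D) c = #|` D|%:R * c.
Proof. by rewrite big_const_seq count_predT iter_addr_0 mulr_natl. Qed.

Lemma digit_avg_norm_le M D (f : V -> R) (C : R) : (0 < #|` D|)%N ->
  (forall x, `|f x| <= C) -> forall x, `|digit_avg M D f x| <= C.
Proof.
move=> D0 fC x; rewrite /digit_avg normrM ger0_norm ?invr_ge0//.
rewrite ler_pdivrMl ?ltr0n//.
rewrite (le_trans (ler_norm_sum _ _ _))//.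
by rewrite (le_trans (ler_sum _ (fun b _ => fC _)))// sum_cstfs.
Qed.

(** If [E] integrates against p, this functional integrates against delta_{M^-1 D} convolved with
    the image of p under M^-1: averaging is linear, positive, fixes constants and commutes with
    bounded limits. *)
Lemma digit_avg_mean E M D : (0 < #|` D|)%N -> is_mean E ->
  is_mean (fun f : V -> R => E (digit_avg M D f)).
Proof.
move=> D0 [ED EZ E0 E1 Elim]; split.
- move=> f g bf bg; rewrite -ED; [|exact: digit_avg_bounded_measurable..].
  by congr E; apply/funext => x; rewrite /digit_avg -mulrDr -big_split.
- move=> c f bf; rewrite -EZ; last exact: digit_avg_bounded_measurable.
  by congr E; apply/funext => x; rewrite /digit_avg -big_distrr mulrCA.
- move=> f bf f0; apply: E0 => [|x]; first exact: digit_avg_bounded_measurable.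
  by rewrite mulr_ge0 ?invr_ge0// sumr_ge0.
- rewrite -[RHS]E1; congr E; apply/funext => x.
  by rewrite /digit_avg sum_cstfs mulr1 mulVf// cardfs_gt0R.
- move=> f_ f C bf_ bf fC f_f; apply: (Elim _ _ C).
  + by move=> n; exact: digit_avg_bounded_measurable.
  + exact: digit_avg_bounded_measurable.
  + by move=> n x; exact: digit_avg_norm_le.
  + move=> x; apply: cvgM; first exact: cvg_cst.
    by apply: cvg_sumr => b; exact: f_f.
Qed.

Lemma point_mean (y : V) : is_mean (fun f : V -> R => f y).
Proof. by split=> // f_ f M _ _ _; exact. Qed.

Variables (Rs : nat -> 'M[int]_d) (B : nat -> {fset 'cV[int]_d}).
Hypothesis B0 : forall k, (0 < #|` B k|)%N.

Lemma iter_avg_mean E n : is_mean E ->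
  is_mean (fun f : V -> R => E (iter_avg Rs B n f)).
Proof.
elim: n E => [//|n ih] E mE /=.
exact: (ih (fun f => E (digit_avg (Rs n) (B n) f)) (digit_avg_mean _ _ _)).
Qed.

Lemma iter_avg_continuous n (f : V -> R) :
  continuous f -> continuous (iter_avg Rs B n f).
Proof. by move=> cf; elim: n => //= n ih; exact: digit_avg_continuous. Qed.

Lemma iter_avg_norm_le n (f : V -> R) (C : R) :
  (forall x, `|f x| <= C) -> forall x, `|iter_avg Rs B n f x| <= C.
Proof. by move=> fC; elim: n => //= n ih; exact: digit_avg_norm_le. Qed.

Lemma iter_avg_bounded_measurable n (f : V -> R) :
  bounded_measurable f -> bounded_measurable (iter_avg Rs B n f).
Proof. by move=> bf; elim: n => //= n ih; exact: digit_avg_bounded_measurable. Qed.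

Hypothesis uR : forall k, intmx R (Rs k) \in unitmx.

Lemma prod_mx_unit k : prod_mx R Rs k \in unitmx.
Proof. by elim: k => [|k ih] /=; rewrite ?unitmx1// unitmx_mul uR. Qed.

(** A composition of n maps [digit_map] is affine with linear part the inverse of
    [prod_mx R Rs n]. *)
Lemma iter_avg_translate (K : fieldType) n (f : V -> K) (y z : V) :
  iter_avg Rs B n f (y + z) =
  iter_avg Rs B n (fun x => f (x + invmx (prod_mx R Rs n) *m z)) y.
Proof.
elim: n y z => [|n ih] y z; first by rewrite /= invmx1 mul1mx.
rewrite /= /digit_avg; congr (_ * _); apply: eq_bigr => b _.
rewrite /digit_map addrA mulmxDr ih invmxM ?uR ?prod_mx_unit//.
by rewrite mulmxA.
Qed.

Lemma iter_avg_succ0 (K : fieldType) n (f : V -> K) :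
  iter_avg Rs B n.+1 f 0 = #|` B n|%:R^-1 * \sum_(b <- B n)
    iter_avg Rs B n (fun x => f (x + invmx (prod_mx R Rs n.+1) *m intmx R b)) 0.
Proof.
rewrite /= /digit_avg; congr (_ * _); apply: eq_bigr => b _.
rewrite /digit_map addr0 -[X in iter_avg _ _ _ _ X]add0r iter_avg_translate.
by rewrite invmxM ?uR ?prod_mx_unit// mulmxA.
Qed.

Lemma intmx_inj (m n : nat) : injective (@intmx R m n).
Proof.
move=> x y /matrixP xy; apply/matrixP => i j; have := xy i j.
by rewrite !mxE => /intr_inj.
Qed.

Lemma unif_digit_set k (U : set V) :
  unif (digit_set R Rs B k) U = (#|` B k|%:R^-1 *
    \sum_(b <- B k) \1_U (invmx (prod_mx R Rs k.+1) *m intmx R b))%:E.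
Proof.
(* Injectivity prevents the image from having fewer elements than [B k], which would change the
   weights. *)
have inj : injective (fun b : 'cV[int]_d => invmx (prod_mx R Rs k.+1) *m intmx R b).
  move=> x y /(congr1 (mulmx (prod_mx R Rs k.+1))).
  by rewrite !mulKVmx ?prod_mx_unit// => /intmx_inj.
rewrite /unif /digit_set card_imfset// big_imfset; last by move=> x y _ _; exact: inj.
by rewrite EFinM -sumEFin.
Qed.

(** [partial_convol] is a bare set function; identifying it with a probability on Borel sets gives
    access to integration theory. Its term k has k + 1 factors, whence [k.+1]. *)
Lemma partial_convol_iter_avg k : exists p : borel_prob R d,
  (forall U, measurable U -> partial_convol Rs B k U = p U) /\
  forall f : V -> R, bounded_measurable f -> \int[p]_x f x = iter_avg Rs B k.+1 f 0.
Proof.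
have [p pE] := mean_probability (iter_avg_mean k.+1 (point_mean 0)).
exists p; split => // U mU.
have pU : p U = (iter_avg Rs B k.+1 (\1_U : V -> R) 0)%:E.
  have bU := bounded_measurable_indic R mU.
  by rewrite -pE// -integral_EFin_Rintegral// integral_indic// setIT.
rewrite pU {p pE pU}; elim: k U mU => [|k ih] U mU.
  rewrite /partial_convol unif_digit_set iter_avg_succ0; congr (_ * _)%:E.
  by apply: eq_bigr => b _; rewrite /= add0r.
pose h (x : V) : R := #|` B k.+1|%:R^-1 * \sum_(b <- B k.+1)
  \1_U (x + invmx (prod_mx R Rs k.+2) *m intmx R b).
have bh : bounded_measurable h.
  apply: bounded_measurableZ; apply: bounded_measurable_sum => b.
  apply: bounded_measurable_comp; last exact: translation_continuous.
  exact: bounded_measurable_indic.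
have [p pE] := mean_probability (iter_avg_mean k.+1 (point_mean 0)).
have pcE A : measurable A -> partial_convol Rs B k A = p A.
  move=> mA; rewrite ih//; have bA := bounded_measurable_indic R mA.
  by rewrite -pE// -integral_EFin_Rintegral// integral_indic// setIT.
(* The product integrates the second factor over sections of the event; for a uniform measure this
   is a finite average of translated indicators. *)
transitivity (\int[partial_convol Rs B k]_x (h x)%:E)%E.
  rewrite /= /convol /pushforward /product_measure1; congr integral;
    apply/funext => x /=.
  rewrite unif_digit_set; congr (_ * _)%:E; apply: eq_bigr => b _.
  by rewrite !indicE mem_xsection.
rewrite (eq_setfun_integral _ pcE) integral_EFin_Rintegral// pE//.
congr EFin; rewrite [RHS]iter_avg_succ0 /h.
have [_ mZ _ _ _] := iter_avg_mean k.+1 (point_mean 0).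
have bb b : bounded_measurable
    (fun x : V => \1_U (x + invmx (prod_mx R Rs k.+2) *m intmx R b) : R).
  apply: bounded_measurable_comp; last exact: translation_continuous.
  exact: bounded_measurable_indic.
rewrite mZ; last by apply: bounded_measurable_sum => b.
by congr (_ * _); rewrite (mean_sum _ (iter_avg_mean k.+1 (point_mean 0))).
Qed.

(** Weak convergence restated for averages at 0. The shift of index between [partial_convol] and
    [iter_avg] does not affect the limit. *)
Lemma infinite_convolP (mu : borel_prob R d) :
  is_infinite_convol Rs B mu <->
  forall f : V -> R, continuous f -> (exists M : R, forall x, `|f x| <= M) ->
    (fun k => iter_avg Rs B k f 0) @ \oo --> \int[mu]_x f x.
Proof.
have pcE k (f : V -> R) : bounded_measurable f ->
    (\int[partial_convol Rs B k]_x (f x)%:E)%E = (iter_avg Rs B k.+1 f 0)%:E.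
  move=> bf; have [p [pU pE]] := partial_convol_iter_avg k.
  by rewrite (eq_setfun_integral _ pU) integral_EFin_Rintegral// pE.
split=> h f cf [M fM]; have bf := bounded_continuous_measurable cf fM.
  have := h f cf (ex_intro _ M fM).
  under eq_fun do rewrite pcE//.
  rewrite integral_EFin_Rintegral// => /fine_cvg/= hf.
  exact: (eq_ind _ id hf _
    (@cvg_shiftS R (fun k => iter_avg Rs B k f 0) (nbhs (\int[mu]_x f x)))).
under eq_fun do rewrite pcE//.
rewrite integral_EFin_Rintegral//; apply: cvg_EFin; first exact: nearW.
exact: (eq_ind_r id (h f cf (ex_intro _ M fM))
  (@cvg_shiftS R (fun k => iter_avg Rs B k f 0) (nbhs (\int[mu]_x f x)))).
Qed.

End Averages.

Lemma cvg_real_unique (R : realType) (u : nat -> R) (a b : R) :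
  u @ \oo --> a -> u @ \oo --> b -> a = b.
Proof. exact: (@cvg_unique _ (@Rhausdorff R)). Qed.

Lemma cvg_succ (R : realType) (u : nat -> R) (l : R) :
  u @ \oo --> l -> (fun k => u k.+1) @ \oo --> l.
Proof. by move=> ul; exact: (eq_ind_r id ul (@cvg_shiftS R u (nbhs l))). Qed.

Lemma cvg_addn_shift (R : realType) (u : nat -> R) (l : R) n :
  u @ \oo --> l -> (fun k => u (n + k)%N) @ \oo --> l.
Proof.
elim: n u => [//|n ih] u ul; have := ih (fun k => u k.+1) (cvg_succ ul).
by [].
Qed.

(** * Total variation distance between digit measures *)

Section Discrepancy.
Variables (R : realType) (d : nat).
Local Notation V := 'cV[R]_d.
Implicit Types (D : {fset 'cV[int]_d}).

(** For sets of equal cardinality this is the total variation norm of delta_D - delta_D'. *)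
Definition discrepancy D D' : R :=
  #|` (D' `\` D)%fset|%:R / #|` D'|%:R + #|` (D `\` D')%fset|%:R / #|` D|%:R.

Lemma discrepancy_ge0 D D' : 0 <= discrepancy D D'.
Proof. by rewrite addr_ge0// divr_ge0. Qed.

(** The digits common to both sets cancel, and each of the others contributes at most [C] before
    division by the cardinality. *)
Lemma digit_avg_discrepancy (M : 'M[int]_d) D D' (f : V -> R) (C : R) :
  #|` D| = #|` D'| -> (forall x, `|f x| <= C) ->
  forall y, `|digit_avg M D f y - digit_avg M D' f y| <= C * discrepancy D D'.
Proof.
move=> DD' fC y; rewrite /digit_avg /discrepancy -DD' -mulrBr -mulrDl.
have C0 : 0 <= C by exact: le_trans (fC 0).
rewrite normrM ger0_norm ?invr_ge0// mulrC mulrA ler_wpM2r ?invr_ge0//.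
rewrite (big_fsetID _ (mem D')) [X in _ - X](big_fsetID _ (mem D))/=.
have -> : [fset x in D | x \in D']%fset = [fset x in D' | x \in D]%fset.
  by apply/fsetP => x; rewrite !inE andbC.
have SE (X : {fset 'cV[int]_d}) :
    `|\sum_(b <- X) f (digit_map M b y)| <= C * #|` X|%:R.
  rewrite (le_trans (ler_norm_sum _ _ _))//.
  by rewrite (le_trans (ler_sum _ (fun b _ => fC _)))// sum_cstfs mulrC.
rewrite opprD addrACA subrr add0r mulrDr addrC.
rewrite (le_trans (ler_normD _ _))// lerD//.
  rewrite normrN (le_trans (SE _))// (_ : [fset x in _ | _]%fset = (D' `\` D)%fset)//.
  by apply/fsetP => x; rewrite !inE andbC.
rewrite (le_trans (SE _))// (_ : [fset x in _ | _]%fset = (D `\` D')%fset)//.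
by apply/fsetP => x; rewrite !inE andbC.
Qed.

Variables (Rs : nat -> 'M[int]_d) (B B' : nat -> {fset 'cV[int]_d}).
Hypothesis B0 : forall k, (0 < #|` B k|)%N.
Hypothesis BB' : forall k, #|` B k| = #|` B' k|.

(** The factors are exchanged one at a time; the averages that remain contract the sup norm, so the
    errors only add up. *)
Lemma iter_avg_discrepancy n (f : V -> R) (C : R) : (forall x, `|f x| <= C) ->
  forall y, `|iter_avg Rs B n f y - iter_avg Rs B' n f y| <=
    C * \sum_(i < n) discrepancy (B i) (B' i).
Proof.
have B'0 k : (0 < #|` B' k|)%N by rewrite -BB'.
move=> fC; elim: n => [|n ih] y /=.
  by rewrite big_ord0 mulr0 subrr normr0.
rewrite big_ord_recr/= mulrDr -(subrKA (digit_avg (Rs n) (B n) (iter_avg Rs B' n f) y)).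
rewrite (le_trans (ler_normD _ _))// lerD//.
  rewrite (_ : _ - _ = digit_avg (Rs n) (B n)
      (fun x => iter_avg Rs B n f x - iter_avg Rs B' n f x) y).
    exact: digit_avg_norm_le.
  by rewrite /digit_avg -mulrBr -sumrB.
by apply: digit_avg_discrepancy => // x; exact: iter_avg_norm_le.
Qed.

End Discrepancy.

(** * Existence of the perturbed convolution and of its tails *)

Section PerturbedConvolution.
Variables (R : realType) (d : nat).
Local Notation V := 'cV[R]_d.

(** Convergence of the series in Cauchy form: a bound on every block beyond N is stable under shifts
    and applies directly to finite convolutions. *)
Definition summable_discrepancy (B B' : nat -> {fset 'cV[int]_d}) :=
  forall e : R, 0 < e -> exists N, forall n m, (N <= n)%N ->
    \sum_(i < m) discrepancy R (B (n + i)) (B' (n + i)) <= e.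

Lemma equivalent_seq_summable B B' :
  equivalent_seq R B B' -> summable_discrepancy B B'.
Proof.
rewrite /equivalent_seq => Soo.
pose t k := discrepancy R (B k) (B' k).
have t0 k : 0 <= t k by exact: discrepancy_ge0.
pose S := (\sum_(0 <= k <oo) (t k)%:E)%E.
have S0 : (0 <= S)%E by apply: nneseries_ge0 => k _ _; rewrite lee_fin.
have Sfin : S \is a fin_num by rewrite ge0_fin_numE.
pose s n := \sum_(0 <= k < n) t k.
have s_le n : s n <= fine S.
  rewrite -lee_fin fineK// /s -sumEFin.
  by apply: nneseries_lim_ge => k _; rewrite lee_fin.
have nd_s : nondecreasing_seq s.
  apply/nondecreasing_seqP => n; rewrite /s big_nat_recr//= lerDl//.
have cs : cvgn s.
  apply: nondecreasing_is_cvgn => //; exists (fine S) => _ [n _ <-]; exact: s_le.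
move=> e e0; have /cvgrPdist_lt/(_ e e0)[N _ sN] := cs.
exists N => n m Nn.
have sl k : s k <= limn s by exact: nondecreasing_cvgn_le.
rewrite (_ : \sum_(i < m) _ = s (n + m)%N - s n); last first.
  by rewrite /s !big_mkord big_split_ord/= [X in X - _]addrC addrK.
have := sN n Nn; rewrite /= ger0_norm ?subr_ge0// => /ltW h.
by rewrite (le_trans _ h)// lerD2r.
Qed.

Lemma summable_discrepancy_shift n B B' : summable_discrepancy B B' ->
  summable_discrepancy (Defs.shift n B) (Defs.shift n B').
Proof.
move=> sB e /sB[N h]; exists N => k m Nk.
rewrite /Defs.shift; under eq_bigr do rewrite !addnA.
by apply: h; rewrite (leq_trans Nk)// leq_addl.
Qed.

Lemma shift_shift (T : Type) n m (u : nat -> T) :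
  Defs.shift m (Defs.shift n u) = Defs.shift (n + m) u.
Proof. by apply/funext => k; rewrite /Defs.shift addnA. Qed.

Lemma tail_seq_shift n Rs B (nu : nat -> borel_prob R d) :
  is_tail_seq Rs B nu ->
  is_tail_seq (Defs.shift n Rs) (Defs.shift n B) (Defs.shift n nu).
Proof.
by move=> t k k0; rewrite !shift_shift; apply: t; rewrite addn_gt0 k0 orbT.
Qed.

(** The identity nu_{>n} = delta_{R^-1 B} * (nu_{>n+1} rescaled by R^-1), where R and B are the
    terms [Rs n] and [B n]. Both sides are weak limits of the same averages, so they agree on
    continuous functions, hence on bounded measurable ones. The index 0 is excluded because [nu 0]
    is unconstrained. *)
Lemma tail_seq_invariant Rs B (nu : nat -> borel_prob R d) :
  (forall k, (0 < #|` B k|)%N) -> (forall k, intmx R (Rs k) \in unitmx) ->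
  is_tail_seq Rs B nu ->
  forall n (f : V -> R), (0 < n)%N -> bounded_measurable f ->
  \int[nu n]_x f x = \int[nu n.+1]_x digit_avg (Rs n) (B n) f x.
Proof.
move=> B0 uR tnu n f n0 bf.
have [q qE] := mean_probability (digit_avg_mean (Rs n) (B0 n) (Rintegral_mean
  (nu n.+1))).
rewrite -qE//; apply: weak_limit_unique => // {bf}f cf [C fC].
rewrite qE; last exact: bounded_continuous_measurable cf fC.
have h1 := (infinite_convolP (fun k => B0 (n + k)%N) (fun k => uR (n + k)%N) (nu n)).1
  (tnu n n0) f cf (ex_intro _ C fC).
have h2 := (infinite_convolP (fun k => B0 (n.+1 + k)%N) (fun k => uR (n.+1 + k)%N)
  (nu n.+1)).1 (tnu n.+1 isT) _ (@digit_avg_continuous _ _ (Rs n) (B n) _ cf)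
  (ex_intro _ C (digit_avg_norm_le (Rs n) (B0 n) fC)).
apply: (cvg_real_unique (cvg_succ h1)).
rewrite (_ : (fun k => _) = (fun k => iter_avg (Defs.shift n.+1 Rs)
  (Defs.shift n.+1 B) k (digit_avg (Rs n) (B n) f) 0))//; apply/funext => k.
rewrite -(addn1 n) -!shift_shift.
have := iter_avg_add (Defs.shift n Rs) (Defs.shift n B) 1 k f.
by rewrite add1n => ->; rewrite /= /Defs.shift !addn0.
Qed.

Lemma cauchy_cvg_real (u : nat -> R) :
  (forall e : R, 0 < e -> exists N, forall n m, (N <= n)%N -> `|u (n + m)%N - u
    n| <= e) ->
  cvgn u.
Proof.
move=> h; apply/cauchy_cvgP/cauchy_exP => e e0.
have e20 : 0 < e / 2 by rewrite divr_gt0.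
have [N hN] := h _ e20.
exists (u N); exists N => // k /= Nk.
rewrite /ball/= distrC -(subnKC Nk) (le_lt_trans (hN _ _ (leqnn N)))//.
by rewrite ltr_pdivrMr// ltr_pMr// ltr1n.
Qed.

Variables (Rs : nat -> 'M[int]_d) (B B' : nat -> {fset 'cV[int]_d}).
Hypothesis B0 : forall k, (0 < #|` B k|)%N.
Hypothesis BB' : forall k, #|` B k| = #|` B' k|.
Hypothesis uR : forall k, intmx R (Rs k) \in unitmx.
Hypothesis sB : summable_discrepancy B B'.
Variable nu : nat -> borel_prob R d.
Hypothesis tnu : is_tail_seq Rs B nu.

(* mu'_n * (nu_{>n} rescaled): these approximate mu' in total variation. *)
Let hybrid n (f : V -> R) : R := \int[nu n.+1]_x iter_avg Rs B' n.+1 f x.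

Let B'0 k : (0 < #|` B' k|)%N.
Proof. by rewrite -BB'. Qed.

Let hybrid_mean n : is_mean (hybrid n).
Proof. exact: (iter_avg_mean _ B'0 _ (Rintegral_mean _)). Qed.

(** Unfolding one factor of the tail [nu n.+1] leaves two integrals against [nu n.+2] that differ in
    a single digit set. *)
Let hybrid_step n f (C : R) : bounded_measurable f -> (forall x, `|f x| <= C) ->
  `|hybrid n.+1 f - hybrid n f| <= C * discrepancy R (B n.+1) (B' n.+1).
Proof.
move=> bf fC; have bS := iter_avg_bounded_measurable Rs B' n.+1 bf.
rewrite /hybrid (tail_seq_invariant B0 uR tnu _ bS)//.
rewrite -[X in `|X|](meanB (Rintegral_mean (nu n.+2)));
  [|exact: digit_avg_bounded_measurable..].
apply: mean_norm_le; first exact: Rintegral_mean.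
  apply: bounded_measurableD; first exact: digit_avg_bounded_measurable.
  under eq_fun do rewrite -mulN1r.
  by apply: bounded_measurableZ; exact: digit_avg_bounded_measurable.
move=> x; rewrite distrC; apply: digit_avg_discrepancy => // y.
exact: iter_avg_norm_le.
Qed.

Let hybrid_cauchy n m f (C : R) : bounded_measurable f -> (forall x, `|f x| <= C) ->
  `|hybrid (n + m) f - hybrid n f| <=
  C * \sum_(i < m) discrepancy R (B (n.+1 + i)) (B' (n.+1 + i)).
Proof.
move=> bf fC; elim: m => [|m ih]; first by rewrite addn0 subrr normr0 big_ord0 mulr0.
rewrite big_ord_recr/= mulrDr addnS -(subrKA (hybrid (n + m) f)) addrC.
rewrite (le_trans (ler_normD _ _))// lerD//.
by have := hybrid_step (n + m) bf fC; rewrite addSn.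
Qed.

(** [N] depends on [e] alone and not on [f], which is the uniformity that [uniform_limit_mean]
    consumes. *)
Let hybrid_lim (e : R) : 0 < e -> exists N, forall n, (N <= n)%N ->
  forall f (C : R), bounded_measurable f -> (forall x, `|f x| <= C) ->
    `|hybrid n f - limn (hybrid ^~ f)| <= e * C.
Proof.
have bound (e0 : R) : 0 < e0 -> exists N, forall n m, (N <= n)%N ->
    forall f (C : R), bounded_measurable f -> (forall x, `|f x| <= C) ->
    `|hybrid (n + m) f - hybrid n f| <= e0 * C.
  move=> /sB[N hN]; exists N => n m Nn f C bf fC.
  rewrite (le_trans (hybrid_cauchy n m bf fC))// mulrC ler_wpM2r//.
    exact: le_trans (fC 0).
  exact: (hN n.+1 m (leqW Nn)).
move=> /bound[N hN]; exists N => n Nn f C bf fC.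
have C0 : 0 <= C by exact: le_trans (fC 0).
have cf : cvgn (hybrid ^~ f).
  apply: cauchy_cvg_real => e1 e10.
  have C1 : 0 < C + 1 by rewrite ltr_wpDl.
  have [N1 hN1] := bound (e1 / (C + 1)) (divr_gt0 e10 C1).
  exists N1 => k m N1k; rewrite (le_trans (hN1 _ _ N1k _ _ bf fC))//.
  by rewrite mulrAC ler_pdivrMr// ler_wpM2l ?(ltW e10)// lerDl.
rewrite distrC; apply: (@cvg_norm_le _ (fun m => hybrid (n + m) f - hybrid n f)).
  apply: cvgB; last exact: cvg_cst.
  exact: (@cvg_addn_shift _ (hybrid ^~ f)).
by move=> m; exact: hN.
Qed.

(** The limit of the hybrids is a mean, hence a probability. For weak convergence, a hybrid of large
    index is compared with its limit, its tail with a finite convolution of digits from [B], and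
    these digits with those of [B']; each comparison costs a third of e. *)
Lemma perturbed_infinite_convol : exists mu' : borel_prob R d,
  is_infinite_convol Rs B' mu'.
Proof.
pose E (f : V -> R) := limn (hybrid ^~ f).
have mE : is_mean E.
  apply: (uniform_limit_mean hybrid_mean) => e /hybrid_lim[N hN].
  by exists N => f C bf fC; exact: hN.
have [mu' muE] := mean_probability mE; exists mu'.
apply/(infinite_convolP B'0 uR) => f cf [C fC].
have bf := bounded_continuous_measurable cf fC.
have C0 : 0 <= C by exact: le_trans (fC 0).
rewrite muE//; apply/cvgrPdist_le => e e0.
(* The term 1 allows for C = 0; the product of [e1] and [C] is at most e / 3. *)
pose e1 := e / 3 / (C + 1).
have C1 : 0 < C + 1 by rewrite ltr_wpDl.
have e10 : 0 < e1 by rewrite !divr_gt0.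
have e1C : e1 * C <= e / 3.
  by rewrite /e1 mulrAC ler_pdivrMr// ler_wpM2l ?lerDl ?divr_ge0 ?(ltW e0).
have [N1 hN1] := hybrid_lim e10; have [N2 hN2] := sB e10.
pose n := maxn N1 N2.
have h1 := hN1 n (leq_maxl _ _) f C bf fC.
pose g := iter_avg Rs B' n.+1 f.
have cg : continuous g by exact: iter_avg_continuous.
have gC : forall x, `|g x| <= C by exact: iter_avg_norm_le.
have h2 := (infinite_convolP (fun k => B0 (n.+1 + k)%N) (fun k => uR (n.+1 + k)%N)
  (nu n.+1)).1 (tnu (isT : (0 < n.+1)%N)) g cg (ex_intro _ C gC).
have /cvgrPdist_le/(_ (e / 3)) h3 := h2.
have e30 : 0 < e / 3 by rewrite divr_gt0.
have [N3 _ hN3] := h3 e30.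
exists (n.+1 + N3)%N => // k /= kN.
(* The first n + 1 factors already use [B'] and are absorbed in the test function [g]; only the
   remaining ones are exchanged. *)
have -> : k = (n.+1 + (k - n.+1))%N.
  by rewrite subnKC// (leq_trans _ kN)// leq_addr.
set m := (k - n.+1)%N; rewrite iter_avg_add -/g.
have h4 := hN3 m; rewrite /= in h4.
have {}h4 := h4 (_ : (N3 <= m)%N).
have {}h4 : `|hybrid n f - iter_avg (Defs.shift n.+1 Rs) (Defs.shift n.+1 B) m
  g 0| <= e / 3.
  by apply: h4; rewrite /m leq_subRL// (leq_trans _ kN)// leq_addr.
have h5 := @iter_avg_discrepancy _ _ (Defs.shift n.+1 Rs) (Defs.shift n.+1 B)
  (Defs.shift n.+1 B') (fun k => B0 _) (fun k => BB' _) m g C gC 0.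
have h6 : C * (\sum_(i < m) discrepancy R (Defs.shift n.+1 B i) (Defs.shift
  n.+1 B' i)) <= e / 3.
  apply: le_trans e1C; rewrite mulrC ler_wpM2r//.
  exact: (hN2 n.+1 m (leqW (leq_maxr _ _))).
rewrite -/(E f) in h1.
have {}h1 := le_trans h1 e1C; have {}h5 := le_trans h5 h6.
move: h1 h4 h5; rewrite !ler_norml => /andP[? ?] /andP[? ?] /andP[? ?].
by apply/andP; split; lra.
Qed.

(** The estimate for finite convolutions is uniform in their length, so it passes to the weak
    limits, with one [N] for all test functions. *)
Lemma tail_integral_close (nu' : nat -> borel_prob R d) : is_tail_seq Rs B' nu' ->
  forall e : R, 0 < e -> exists N, forall n, (N <= n)%N -> (0 < n)%N ->
  forall (f : V -> R) (C : R), continuous f -> (forall x, `|f x| <= C) ->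
    `|\int[nu n]_x f x - \int[nu' n]_x f x| <= e * C.
Proof.
move=> tnu' e /sB[N hN]; exists N => n Nn n0 f C cf fC.
have C0 : 0 <= C by exact: le_trans (fC 0).
have h1 := (infinite_convolP (fun k => B0 (n + k)%N) (fun k => uR (n + k)%N) (nu n)).1
  (tnu n0) f cf (ex_intro _ C fC).
have h2 := (infinite_convolP (fun k => B'0 (n + k)%N) (fun k => uR (n + k)%N) (nu' n)).1
  (tnu' n n0) f cf (ex_intro _ C fC).
apply: (cvg_norm_le (cvgB h1 h2)) => k.
apply: (le_trans (@iter_avg_discrepancy _ _ (Defs.shift n Rs) (Defs.shift n B)
  (Defs.shift n B') (fun k => B0 _) (fun k => BB' _) k f C fC 0)).
by rewrite mulrC ler_wpM2r//; exact: (hN n k Nn).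
Qed.

End PerturbedConvolution.

Local Open Scope complex_scope.

(** * Fourier transforms of convolutions *)

Section Characters.
Variables (R : realType) (d : nat).
Local Notation V := 'cV[R]_d.
Implicit Types (x y xi eta : V) (z w : R[i]).

(** The squared modulus is polynomial in the real and imaginary parts, so that multiplicativity,
    limits and measurability involve no square root. *)
Definition cmod2 z : R := complex.Re z ^+ 2 + complex.Im z ^+ 2.

Lemma cmod2_ge0 z : 0 <= cmod2 z.
Proof. by rewrite addr_ge0 ?sqr_ge0. Qed.

Lemma cmodE z : cmod z = Num.sqrt (cmod2 z).
Proof. by case: z. Qed.

Lemma cmod2E z : cmod2 z = cmod z ^+ 2.
Proof. by rewrite cmodE sqr_sqrtr// cmod2_ge0. Qed.

Lemma cmod2_conj z : (cmod2 z)%:C = z * conjc z.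
Proof. by case: z => a b; rewrite /cmod2 /=; simpc; congr (_ +i* _); ring. Qed.

Lemma conjcM z w : conjc (z * w) = conjc z * conjc w.
Proof. exact: (rmorphM conjc). Qed.

Lemma conjCE z : Num.conj z = conjc z.
Proof. by []. Qed.

Lemma cmod2M z w : cmod2 (z * w) = cmod2 z * cmod2 w.
Proof. by case: z => a b; case: w => u v; rewrite /cmod2 /=; ring. Qed.

Lemma cmod2_conjc z : cmod2 (conjc z) = cmod2 z.
Proof. by case: z => a b; rewrite /cmod2 /=; ring. Qed.

Lemma cmod2_eq0 z : (cmod2 z == 0) = (z == 0).
Proof.
case: z => a b; rewrite /cmod2 eq_complex/= paddr_eq0 ?sqr_ge0//.
by rewrite !sqrf_eq0.
Qed.

Lemma cmod2_0 : cmod2 0 = 0.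
Proof. by rewrite /cmod2 /= expr0n addr0. Qed.

Lemma dotrC x y : dotr x y = dotr y x.
Proof. by apply: eq_bigr => i _; rewrite mulrC. Qed.

Lemma dotrDr x y xi : dotr xi (x + y) = dotr xi x + dotr xi y.
Proof. by rewrite -big_split/=; apply: eq_bigr => i _; rewrite mxE mulrDr. Qed.

Lemma dotrZr (a : R) x xi : dotr xi (a *: x) = a * dotr xi x.
Proof. by rewrite big_distrr/=; apply: eq_bigr => i _; rewrite mxE mulrCA. Qed.

Lemma dotrNr x xi : dotr xi (- x) = - dotr xi x.
Proof. by rewrite -sumrN; apply: eq_bigr => i _; rewrite mxE mulrN. Qed.

Lemma dotrE x y : dotr x y = (x^T *m y) 0 0.
Proof. by rewrite mxE; apply: eq_bigr => i _; rewrite mxE. Qed.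

Lemma dotr_mulmx (A : 'M[R]_d) xi x : dotr xi (A *m x) = dotr (A^T *m xi) x.
Proof. by rewrite !dotrE trmx_mul trmxK mulmxA. Qed.

Lemma expcharC x y : expchar x y = expchar y x.
Proof. by rewrite /expchar dotrC. Qed.

Lemma expcharDr xi x y : expchar xi (x + y) = expchar xi x * expchar xi y.
Proof.
rewrite /expchar dotrDr mulrDr opprD cosD sinD.
by apply/eqP; rewrite eq_complex /=; apply/andP; split; apply/eqP; ring.
Qed.

Lemma expcharDl xi eta x : expchar (xi + eta) x = expchar xi x * expchar eta x.
Proof. by rewrite expcharC expcharDr !(expcharC x). Qed.

Lemma expcharNr xi x : expchar xi (- x) = conjc (expchar xi x).
Proof.
by rewrite /expchar dotrNr mulrN cosN sinN /= cosN sinN.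
Qed.

Lemma expcharNl xi x : expchar (- xi) x = conjc (expchar xi x).
Proof. by rewrite expcharC expcharNr expcharC. Qed.

Lemma expchar0r xi : expchar xi 0 = 1.
Proof.
have := dotrZr 0 0 xi; rewrite scale0r mul0r /expchar => ->.
by rewrite mulr0 oppr0 cos0 sin0.
Qed.

Lemma expchar0l x : expchar 0 x = 1.
Proof. by rewrite expcharC expchar0r. Qed.

Lemma cmod2_expchar xi x : cmod2 (expchar xi x) = 1.
Proof. by rewrite /cmod2 /= cos2Dsin2. Qed.

Lemma expchar_mulmx (A : 'M[R]_d) xi x :
  expchar xi (A *m x) = expchar (A^T *m xi) x.
Proof. by rewrite /expchar dotr_mulmx. Qed.

Lemma cos2pi_int (m : int) : cos (2 * pi * m%:~R : R) = 1.
Proof.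
have nat_case (n : nat) : cos (2 * pi * n%:R : R) = 1.
  have E := periodicn (@cosD2pi R) n 0; rewrite add0r cos0 in E; rewrite -[RHS]E.
  by congr cos; rewrite -mulr_natr -(mulr_natr pi); ring.
case: m => n; first exact: nat_case.
by rewrite NegzE mulrNz mulrN cosN nat_case.
Qed.

Lemma sin2pi_int (m : int) : sin (2 * pi * m%:~R : R) = 0.
Proof.
have nat_case (n : nat) : sin (2 * pi * n%:R : R) = 0.
  have E := periodicn (@sinD2pi R) n 0; rewrite add0r sin0 in E; rewrite -[RHS]E.
  by congr sin; rewrite -mulr_natr -(mulr_natr pi); ring.
case: m => n; first exact: nat_case.
by rewrite NegzE mulrNz mulrN sinN nat_case oppr0.
Qed.

Lemma expchar_int (k l : 'cV[int]_d) : expchar (intmx R k) (intmx R l) = 1.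
Proof.
rewrite /expchar (_ : dotr _ _ = (\sum_i k i 0 * l i 0)%:~R).
  by rewrite cosN sinN cos2pi_int sin2pi_int oppr0.
by rewrite rmorph_sum; apply: eq_bigr => i _; rewrite !mxE rmorphM.
Qed.

Lemma intmxD (m n : nat) (k l : 'M[int]_(m, n)) :
  intmx R (k + l) = intmx R k + intmx R l.
Proof. exact: map_mxD. Qed.

Lemma intmxB (m n : nat) (k l : 'M[int]_(m, n)) :
  intmx R (k - l) = intmx R k - intmx R l.
Proof. exact: map_mxB. Qed.

Lemma intmxM (m n p : nat) (k : 'M[int]_(m, n)) (l : 'M[int]_(n, p)) :
  intmx R (k *m l) = intmx R k *m intmx R l.
Proof. exact: map_mxM. Qed.

Lemma intmx_tr (m n : nat) (k : 'M[int]_(m, n)) : (intmx R k)^T = intmx R k^T.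
Proof. by rewrite /intmx map_trmx. Qed.

Lemma expchar_continuous xi :
  continuous (fun x => complex.Re (expchar xi x)) /\
  continuous (fun x => complex.Im (expchar xi x)).
Proof.
have ct : continuous (fun x : V => - (2 * pi * dotr xi x)).
  have -> : (fun x : V => - (2 * pi * dotr xi x)) =
      fun x => (- (2 * pi)) * \sum_i xi i 0 * x i 0.
    by apply/funext => x; rewrite mulNr.
  apply: mul_continuous_fun; first exact: cst_continuous.
  apply: sum_continuous_fun => i; apply: mul_continuous_fun.
    exact: cst_continuous.
  exact: coord_continuous.
split => x.
  exact: (continuous_comp (ct x) (@continuous_cos R _)).
exact: (continuous_comp (ct x) (@continuous_sin R _)).
Qed.

Lemma Re_expchar_le1 xi x : `|complex.Re (expchar xi x)| <= 1.
Proof. exact: cos_max. Qed.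

Lemma Im_expchar_le1 xi x : `|complex.Im (expchar xi x)| <= 1.
Proof. exact: sin_max. Qed.

End Characters.

#[local] Arguments expchar : simpl never.
#[local] Arguments conjc : simpl never.

(** * Masks of digit sets and their dual digits *)

Section Masks.
Variables (R : realType) (d : nat).
Local Notation V := 'cV[R]_d.
Implicit Types (M : 'M[int]_d) (D : {fset 'cV[int]_d}) (L : seq 'cV[int]_d).
Implicit Types (xi : V).

(* The Fourier transform of delta_{M^-1 D}. *)
Definition mask M D xi : R[i] :=
  #|` D|%:R^-1 * \sum_(b <- D) expchar xi (invmx (intmx R M) *m intmx R b).

(* L is a spectrum of delta_{M^-1 D}. *)
Definition dual_digits M D L := forall b b', b \in D -> b' \in D ->
  \sum_(l <- L) expchar (invmx (intmx R M) *m intmx R b) (intmx R l) *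
    conjc (expchar (invmx (intmx R M) *m intmx R b') (intmx R l)) =
  #|` D|%:R * (b == b')%:R.

(** Expanding the squared moduli gives a double sum over digits. Summing over [L] first annihilates
    the pairs with b != b', and each of the #D diagonal pairs contributes #D, which the factor #D^-2
    compensates. *)
Lemma dual_digits_mask M D L : (0 < #|` D|)%N -> dual_digits M D L ->
  forall xi, \sum_(l <- L) cmod2 (mask M D (xi + intmx R l)) = 1.
Proof.
move=> D0 dL xi.
have n0 : #|` D|%:R != 0 :> R[i] by rewrite pnatr_eq0 -lt0n.
apply: (@complexI R); rewrite rmorph_sum /=.
pose e b := expchar xi (invmx (intmx R M) *m intmx R b).
pose u b l := expchar (invmx (intmx R M) *m intmx R b) (intmx R l).
transitivity (\sum_(l <- L) #|` D|%:R^-1 ^+ 2 *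
    \sum_(b <- D) \sum_(b' <- D) e b * conjc (e b') * (u b l * conjc (u b' l))).
  apply: eq_bigr => l _; rewrite cmod2_conj /mask conjcM (fmorphV conjc)/= conjc_nat.
  rewrite mulrACA -expr2; congr (_ * _); rewrite rmorph_sum big_distrlr/=.
  apply: eq_bigr => b _; apply: eq_bigr => b' _.
  rewrite !expcharDl conjcM /e /u mulrACA; congr (_ * (_ * _)).
    by rewrite expcharC.
  by rewrite expcharC.
rewrite -big_distrr/= exchange_big/=.
under eq_bigr do rewrite exchange_big/=.
have -> : \sum_(b <- D) \sum_(b' <- D) \sum_(l <- L)
    e b * conjc (e b') * (u b l * conjc (u b' l)) = #|` D|%:R * #|` D|%:R.
  transitivity (\sum_(b <- D) (#|` D|%:R : R[i])).
    rewrite big_seq [RHS]big_seq; apply: eq_bigr => b bD.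
    rewrite (big_fsetD1 b)//= [X in _ + X]big_seq [X in _ + X]big1 ?addr0; last first.
      move=> b'; rewrite !inE => /andP[b'b b'D]; rewrite -big_distrr/= dL//.
      by rewrite eq_sym (negbTE b'b) !mulr0.
    rewrite -big_distrr/= dL// eqxx mulr1 /e -cmod2_conj cmod2_expchar.
    by rewrite mul1r.
  by rewrite big_const_seq count_predT iter_addr_0 mulr_natl.
by rewrite -expr2 -exprMn mulVf// expr1n.
Qed.

(** The shift multiplies every summand by a phase depending only on b and b', and equal to 1 when b
    = b'. *)
Lemma dual_digits_translate M D L l0 : dual_digits M D L ->
  dual_digits M D [seq l - l0 | l <- L].
Proof.
move=> dL b b' bD b'D; rewrite big_map.
set u := expchar (invmx _ *m intmx R b); set u' := expchar (invmx _ *m intmx R b').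
transitivity (\sum_(l <- L) u (intmx R l) * conjc (u' (intmx R l)) *
    (conjc (u (intmx R l0)) * u' (intmx R l0))).
  apply: eq_bigr => l _; rewrite intmxB /u /u' !expcharDr !expcharNr conjcM conjcK.
  by ring.
rewrite -big_distrl/= dL//; case: eqP => [bb'|_]; last by rewrite mulr0 mul0r.
by rewrite /u /u' -bb' [X in _ * X]mulrC -cmod2_conj cmod2_expchar mulr1.
Qed.

Lemma congruent_mod_card M D D' : congruent_mod M D D' -> #|` D'| = #|` D|.
Proof.
move=> [f [[fD inj sur] _]].
have -> : D' = [fset f b | b in D]%fset.
  apply/fsetP => c; apply/idP/imfsetP => [cD'|[b bD ->]]; last exact: fD.
  by have [b bD <-] := sur c cD'; exists b.
rewrite card_in_imfset// => b b' bD b'D; apply: inj; rewrite inE//.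
Qed.

(** Replacing b by b + M z multiplies the character at an integer point l by e^{-2 pi i z.l} = 1. *)
Lemma dual_digits_congruent M D D' L : intmx R M \in unitmx ->
  congruent_mod M D D' -> dual_digits M D L -> dual_digits M D' L.
Proof.
move=> uM cDD' dL; have cD := congruent_mod_card cDD'.
case: cDD' => f [[fD inj sur] fM].
have ef b l : b \in D -> expchar (invmx (intmx R M) *m intmx R (f b)) (intmx R l)
    = expchar (invmx (intmx R M) *m intmx R b) (intmx R l).
  move=> bD; have [z /eqP] := fM b bD; rewrite subr_eq addrC => /eqP ->.
  by rewrite intmxD mulmxDr intmxM mulKmx// expcharDl expchar_int mulr1.
move=> c c' cD' c'D'; have [b bD <-] := sur c cD'; have [b' b'D <-] := sur c' c'D'.
under eq_bigr do rewrite !ef//.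
rewrite dL// cD; congr (_ * _%:R); congr nat_of_bool.
apply/eqP/eqP => [->//|]; apply: inj; rewrite inE//.
Qed.

Lemma admissible_unitmx M D : admissible_pair R M D -> intmx R M \in unitmx.
Proof.
move=> [eM _ _]; rewrite unitmxE unitfE; apply/negP => /eqP dM0.
have dC : \det (map_mx intr M : 'M[R[i]]_d) = 0.
  move/eqP: dM0; rewrite /intmx !det_map_mx intr_eq0 => /eqP ->.
  by rewrite rmorph0.
have : eigenvalue (map_mx intr M : 'M[R[i]]_d) 0.
  rewrite /eigenvalue /eigenspace; apply/negP => /eqP.
  rewrite (_ : _ - _ = map_mx intr M); last by rewrite raddf0 subr0.
  move/eqP; rewrite kermx_eq0 row_free_unit unitmxE dC unitr0//.
move/eM; rewrite Normc.normc0; by rewrite ltr10.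
Qed.

Lemma admissible_dual_digits M D : admissible_pair R M D ->
  exists L : seq 'cV[int]_d, 0 \in L /\ dual_digits M D L.
Proof.
move=> [_ D2 [L [LD uH]]].
have D0 : (0 < #|` D|)%N by exact: leq_trans D2.
have dL : dual_digits M D L.
  move=> b b' bD b'D; move/unitarymxP: uH => /matrixP H.
  have ib : (index b (enum_fset D) < #|` D|)%N by rewrite index_mem.
  have ib' : (index b' (enum_fset D) < #|` D|)%N by rewrite index_mem.
  have := H (Ordinal ib) (Ordinal ib'); rewrite !mxE.
  have -> : (Ordinal ib == Ordinal ib') = (b == b').
    apply/eqP/eqP => [[]|bb']; last by apply/val_inj; rewrite /= bb'.
    by move/(congr1 (nth 0 (enum_fset D))); rewrite !nth_index.
  move=> E; pose s : R[i] := ((Num.sqrt #|` D|%:R)^-1)%:C.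
  have ss : s * s * #|` D|%:R = 1.
    rewrite /s -rmorphM -invfM -expr2 sqr_sqrtr ?ler0n//.
    rewrite fmorphV rmorph_nat mulVf// pnatr_eq0 -lt0n//.
  transitivity (#|` D|%:R * (\sum_(j < #|` L|) hadamard_mx R M D L (Ordinal ib) j *
       conjc (hadamard_mx R M D L (Ordinal ib') j))).
    rewrite (big_nth 0) big_mkord big_distrr/=; apply: eq_bigr => j _.
    rewrite !mxE /= !nth_index// conjcM.
    set u := expchar _ _; set v := expchar _ _.
    rewrite -/s (_ : conjc s = s); last by rewrite /s conjc_real.
    transitivity (s * s * #|` D|%:R * (u * conjc v)); last by ring.
    by rewrite ss mul1r.
  congr (_ * _); rewrite -E; apply: eq_bigr => j _.
  by rewrite !mxE.
(* [L] is nonempty because the diagonal relation has a nonzero right-hand side. Moving one of its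
   elements to 0 will preserve the points already chosen whenever dual digits are added. *)
case: (L : seq _) dL => [|l0 L'] dL.
  have [b bD] : exists b, b \in D.
    by apply/fset0Pn; rewrite -cardfs_gt0.
  have := dL b b bD bD; rewrite big_nil eqxx mulr1 => /esym/eqP.
  by rewrite pnatr_eq0 -leqn0 leqNgt D0.
exists [seq l - l0 | l <- l0 :: L']; split; last exact: dual_digits_translate.
by rewrite /= subrr mem_head.
Qed.

End Masks.

(** * Transforms of finite convolutions and of tails *)

Section PartialTransforms.
Variables (R : realType) (d : nat).
Local Notation V := 'cV[R]_d.
Implicit Types (xi : V) (Rs : nat -> 'M[int]_d) (B : nat -> {fset 'cV[int]_d}).

(* The Fourier transform of mu_n, with mu_0 = delta_0. *)
Definition partial_fourier Rs B n xi : R[i] := iter_avg Rs B n (expchar xi) 0.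

Lemma digit_avg_mulr (K : fieldType) M D (f : V -> K) (c : K) y :
  digit_avg M D (fun x => f x * c) y = digit_avg M D f y * c.
Proof. by rewrite /digit_avg -mulrA big_distrl. Qed.

Lemma iter_avg_mulr (K : fieldType) Rs B n (f : V -> K) (c : K) y :
  iter_avg Rs B n (fun x => f x * c) y = iter_avg Rs B n f y * c.
Proof.
elim: n y => [//|n ih] y /=; rewrite -digit_avg_mulr.
by congr (_ * _); apply: eq_bigr => b _; rewrite ih.
Qed.

Lemma Re_sum (I : Type) (s : seq I) (f : I -> R[i]) :
  complex.Re (\sum_(i <- s) f i) = \sum_(i <- s) complex.Re (f i).
Proof.
elim: s => [|i s ih]; first by rewrite !big_nil.
by rewrite !big_cons -ih; case: (f i) => a b; case: (\sum_(_ <- _) _).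
Qed.

Lemma Im_sum (I : Type) (s : seq I) (f : I -> R[i]) :
  complex.Im (\sum_(i <- s) f i) = \sum_(i <- s) complex.Im (f i).
Proof.
elim: s => [|i s ih]; first by rewrite !big_nil.
by rewrite !big_cons -ih; case: (f i) => a b; case: (\sum_(_ <- _) _).
Qed.

Lemma ReM_real (a : R) (z : R[i]) : complex.Re (a%:C * z) = a * complex.Re z.
Proof. by case: z => u v /=; rewrite mul0r subr0. Qed.

Lemma ImM_real (a : R) (z : R[i]) : complex.Im (a%:C * z) = a * complex.Im z.
Proof. by case: z => u v /=; rewrite mul0r addr0. Qed.

Lemma natV_complex (n : nat) : (n%:R : R[i])^-1 = ((n%:R : R)^-1)%:C.
Proof. by rewrite fmorphV rmorph_nat. Qed.

Lemma Re_iter_avg Rs B n (f : V -> R[i]) y :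
  complex.Re (iter_avg Rs B n f y) = iter_avg Rs B n (fun x => complex.Re (f x)) y.
Proof.
elim: n y => [//|n ih] y; rewrite /= /digit_avg natV_complex ReM_real Re_sum.
by congr (_ * _); apply: eq_bigr => b _; rewrite ih.
Qed.

Lemma Im_iter_avg Rs B n (f : V -> R[i]) y :
  complex.Im (iter_avg Rs B n f y) = iter_avg Rs B n (fun x => complex.Im (f x)) y.
Proof.
elim: n y => [//|n ih] y; rewrite /= /digit_avg natV_complex ImM_real Im_sum.
by congr (_ * _); apply: eq_bigr => b _; rewrite ih.
Qed.

Section Fixed.
Variables (Rs : nat -> 'M[int]_d) (B : nat -> {fset 'cV[int]_d}).
Hypothesis uR : forall k, intmx R (Rs k) \in unitmx.
Local Notation P := (prod_mx R Rs).

(** Averaging sends a character to a multiple of another one, with frequency transported by the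
    inverse transpose of [P n]; the product formulas for transforms follow. *)
Lemma iter_avg_expchar n xi y : iter_avg Rs B n (expchar xi) y =
  partial_fourier Rs B n xi * expchar ((invmx (P n))^T *m xi) y.
Proof.
rewrite -[y in LHS]add0r (iter_avg_translate B uR) -iter_avg_mulr.
by congr iter_avg; apply/funext => x; rewrite expcharDr expchar_mulmx.
Qed.

Lemma partial_fourierD n m xi : partial_fourier Rs B (n + m) xi =
  partial_fourier Rs B n xi *
  partial_fourier (Defs.shift n Rs) (Defs.shift n B) m ((invmx (P n))^T *m xi).
Proof.
rewrite /partial_fourier iter_avg_add mulrC -iter_avg_mulr.
congr (iter_avg _ _ _ _ 0); apply/funext => y.
by rewrite iter_avg_expchar mulrC.
Qed.

Lemma partial_fourierS n xi : partial_fourier Rs B n.+1 xi =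
  partial_fourier Rs B n xi * mask (Rs n) (B n) ((invmx (P n))^T *m xi).
Proof.
rewrite /partial_fourier [LHS]/= /digit_avg /mask mulrCA; congr (_ * _).
rewrite big_distrr/=; apply: eq_bigr => b _.
by rewrite iter_avg_expchar /digit_map addr0.
Qed.

(** The product is kept over the integers so that the frequencies built from it stay in Z^d by
    construction. *)
Fixpoint int_prod_mx Rs' n : 'M[int]_d :=
  if n is m.+1 then Rs' m *m int_prod_mx Rs' m else 1%:M.

Lemma intmx_prod n : intmx R (int_prod_mx Rs n) = P n.
Proof.
elim: n => [|n ih] /=; first by rewrite /intmx map_scalar_mx rmorph1.
by rewrite intmxM ih.
Qed.

Lemma mask_periodic M D xi (k : 'cV[int]_d) : intmx R M \in unitmx ->
  mask M D (xi + (intmx R M)^T *m intmx R k) = mask M D xi.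
Proof.
move=> uM; congr (_ * _); apply: eq_bigr => b _.
by rewrite expcharDl -[X in _ * X]expchar_mulmx mulmxA mulmxV// mul1mx
  expchar_int mulr1.
Qed.

(** A period of index n + 1 is also one of index n, and the inverse transpose of [P n] carries it
    into the image of Z^d under the transpose of [Rs n], a lattice of periods of the new mask. *)
Lemma partial_fourier_periodic n xi (k : 'cV[int]_d) :
  partial_fourier Rs B n (xi + (P n)^T *m intmx R k) = partial_fourier Rs B n xi.
Proof.
elim: n xi k => [|n ih] xi k; first by rewrite /partial_fourier /= !expchar0r.
rewrite !partial_fourierS [P n.+1]/= trmx_mul -mulmxA; congr (_ * _).
  by rewrite intmx_tr -intmxM ih.
rewrite mulmxDr [X in _ + X]mulmxA -trmx_mul mulmxV ?prod_mx_unit// trmx1 mul1mx.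
exact: mask_periodic.
Qed.

Hypothesis B0 : forall k, (0 < #|` B k|)%N.

Lemma partial_fourier_cvg (mu : borel_prob R d) xi : is_infinite_convol Rs B mu ->
  (fun n => complex.Re (partial_fourier Rs B n xi)) @ \oo --> complex.Re
    (fourier mu xi) /\
  (fun n => complex.Im (partial_fourier Rs B n xi)) @ \oo --> complex.Im
    (fourier mu xi).
Proof.
move=> /(infinite_convolP B0 uR) h; have [cRe cIm] := expchar_continuous xi; split.
  under eq_fun do rewrite Re_iter_avg.
  by apply: h => //; exists 1 => x; exact: Re_expchar_le1.
under eq_fun do rewrite Im_iter_avg.
by apply: h => //; exists 1 => x; exact: Im_expchar_le1.
Qed.

Lemma cmod2_partial_fourier_cvg (mu : borel_prob R d) xi : is_infinite_convol Rs B mu ->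
  (fun n => cmod2 (partial_fourier Rs B n xi)) @ \oo --> cmod2 (fourier mu xi).
Proof.
move=> /(partial_fourier_cvg xi)[cRe cIm].
exact: (cvgD (cvgM cRe cRe) (cvgM cIm cIm)).
Qed.

End Fixed.

(** The limit in m of [partial_fourierD], taken on squared moduli, so that a single real limit is
    involved. *)
Lemma cmod2_fourier_tail Rs B (mu eta : borel_prob R d) n xi :
  (forall k, intmx R (Rs k) \in unitmx) -> (forall k, (0 < #|` B k|)%N) ->
  is_infinite_convol Rs B mu ->
  is_infinite_convol (Defs.shift n Rs) (Defs.shift n B) eta ->
  cmod2 (fourier mu xi) = cmod2 (partial_fourier Rs B n xi) *
    cmod2 (fourier eta ((invmx (prod_mx R Rs n))^T *m xi)).
Proof.
move=> uR B0 cmu ceta.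
have h1 := cvg_addn_shift n (cmod2_partial_fourier_cvg (xi := xi) uR B0 cmu).
have h2 := cmod2_partial_fourier_cvg (xi := (invmx (prod_mx R Rs n))^T *m xi)
  (fun k => uR (n + k)%N) (fun k => B0 (n + k)%N) ceta.
apply: (cvg_real_unique h1).
under eq_fun do rewrite partial_fourierD// cmod2M.
exact: (cvgM (cvg_cst _) h2).
Qed.

Lemma cmod_le_ReIm (z : R[i]) : cmod z <= `|complex.Re z| + `|complex.Im z|.
Proof.
rewrite cmodE -[leRHS]ger0_norm ?addr_ge0// -sqrtr_sqr ler_wsqrtr//.
rewrite /cmod2 sqrrD !real_normK ?num_real// -addrA lerD2l lerDr.
by rewrite mulrn_wge0 ?mulr_ge0.
Qed.

(** Total variation controls all frequencies at once, hence [N] is chosen before [xi]. The real and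
    imaginary parts take e / 2 each. *)
Lemma fourier_tail_close Rs B B' (nu nu' : nat -> borel_prob R d) :
  (forall k, intmx R (Rs k) \in unitmx) -> (forall k, (0 < #|` B k|)%N) ->
  (forall k, #|` B k| = #|` B' k|) -> summable_discrepancy R B B' ->
  is_tail_seq Rs B nu -> is_tail_seq Rs B' nu' ->
  forall e : R, 0 < e -> exists N, forall n, (N <= n)%N -> (0 < n)%N ->
  forall xi, cmod (fourier (nu n) xi) <= cmod (fourier (nu' n) xi) + e.
Proof.
move=> uR B0 BB' sB tnu tnu' e e0; have e20 : 0 < e / 2 by rewrite divr_gt0.
have [N hN] := tail_integral_close B0 BB' uR sB tnu tnu' e20.
exists N => n Nn n0 xi; have [cRe cIm] := expchar_continuous xi.
have h1 := hN n Nn n0 _ 1 cRe (Re_expchar_le1 xi).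
have h2 := hN n Nn n0 _ 1 cIm (Im_expchar_le1 xi).
rewrite mulr1 in h1 h2.
rewrite -[X in cmod X](subrK (fourier (nu' n) xi)) addrC.
rewrite (le_trans (le_normcD _ _))// lerD2l (le_trans (cmod_le_ReIm _))//.
by rewrite (splitr e) lerD.
Qed.

End PartialTransforms.

Lemma lte_two_quarters (R : realType) (a b : \bar R) (e : R) :
  (a < (e / 4)%:E)%E -> (b < (e / 4)%:E)%E -> (2%:E * a + 2%:E * b < e%:E)%E.
Proof.
move=> ae be; have -> : (e%:E = 2%:E * (e / 4)%:E + 2%:E * (e / 4)%:E)%E.
  by rewrite -!EFinM -EFinD; congr EFin; field.
by rewrite lteD// lte_pmul2l.
Qed.

(** * Mean square approximation by trigonometric polynomials *)

Section SquareDistance.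
Variables (R : realType) (d : nat) (mu : borel_prob R d).
Local Notation V := 'cV[R]_d.
Implicit Types (f g : V -> R[i]) (xi : V) (S : set V) (s : seq (R[i] * V)).

Definition complex_measurable f :=
  measurable_fun setT (fun x => complex.Re (f x)) /\
  measurable_fun setT (fun x => complex.Im (f x)).

Definition square_norm f : \bar R := (\int[mu]_x (cmod2 (f x))%:E)%E.

(** A list of coefficients and frequencies, in which a frequency may recur, so that adding
    polynomials is concatenation. *)
Definition trig_poly s (x : V) : R[i] := \sum_(p <- s) p.1 * expchar p.2 x.

Definition trig_approximable S f := forall e : R, 0 < e -> exists s,
  (forall p, p \in s -> S p.2) /\
  (square_norm (fun x => (f x - trig_poly s x)%R) < e%:E)%E.

Lemma complex_measurableD f g : complex_measurable f -> complex_measurable g ->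
  complex_measurable (fun x => f x + g x).
Proof.
move=> [rf imf] [rg img]; split.
  rewrite (_ : (fun x => _) = fun x => complex.Re (f x) + complex.Re (g x)).
    exact: measurable_funD.
  by apply/funext => x; case: (f x) => ? ?; case: (g x).
rewrite (_ : (fun x => _) = fun x => complex.Im (f x) + complex.Im (g x)).
  exact: measurable_funD.
by apply/funext => x; case: (f x) => ? ?; case: (g x).
Qed.

Lemma complex_measurableM f g : complex_measurable f -> complex_measurable g ->
  complex_measurable (fun x => f x * g x).
Proof.
move=> [rf imf] [rg img]; split.
  rewrite (_ : (fun x => _) = fun x => complex.Re (f x) * complex.Re (g x) -
      complex.Im (f x) * complex.Im (g x)).
    by apply: measurable_funB; exact: measurable_funM.
  by apply/funext => x; case: (f x) => ? ?; case: (g x).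
rewrite (_ : (fun x => _) = fun x => complex.Re (f x) * complex.Im (g x) +
    complex.Im (f x) * complex.Re (g x)).
  by apply: measurable_funD; exact: measurable_funM.
by apply/funext => x; case: (f x) => ? ?; case: (g x).
Qed.

Lemma complex_measurable_cst (c : R[i]) : complex_measurable (fun=> c).
Proof. by split; exact: measurable_cst. Qed.

Lemma complex_measurableB f g : complex_measurable f -> complex_measurable g ->
  complex_measurable (fun x => f x - g x).
Proof.
move=> mf mg; under eq_fun do rewrite -mulN1r; apply: complex_measurableD => //.
by apply: complex_measurableM => //; exact: complex_measurable_cst.
Qed.

Lemma complex_measurable_expchar xi : complex_measurable (expchar xi).
Proof.
by have [cRe cIm] := expchar_continuous xi; split; exact: continuous_measurable_vect.
Qed.

Lemma complex_measurable_trig s : complex_measurable (trig_poly s).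
Proof.
elim: s => [|p s ih].
  rewrite (_ : trig_poly [::] = fun=> 0); first exact: complex_measurable_cst.
  by apply/funext => x; rewrite /trig_poly big_nil.
rewrite (_ : trig_poly _ = fun x => p.1 * expchar p.2 x + trig_poly s x); last first.
  by apply/funext => x; rewrite /trig_poly big_cons.
apply: complex_measurableD => //; apply: complex_measurableM.
  exact: complex_measurable_cst.
exact: complex_measurable_expchar.
Qed.

Lemma measurable_cmod2 f : complex_measurable f ->
  measurable_fun setT (fun x => cmod2 (f x)).
Proof. by move=> [mr mi]; apply: measurable_funD; exact: measurable_funX. Qed.

Lemma cmod2D_le (z w : R[i]) : cmod2 (z + w) <= 2 * cmod2 z + 2 * cmod2 w.
Proof.
case: z w => a b [u v]; rewrite /cmod2 /= -subr_ge0.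
rewrite (_ : _ - _ = (a - u) ^+ 2 + (b - v) ^+ 2); last by ring.
by rewrite addr_ge0 ?sqr_ge0.
Qed.

Lemma square_norm_ge0 f : (0 <= square_norm f)%E.
Proof. by apply: integral_ge0 => x _; rewrite lee_fin cmod2_ge0. Qed.

Lemma le_square_norm f g (C : R) : complex_measurable f -> complex_measurable g ->
  0 <= C -> (forall x, cmod2 (f x) <= C * cmod2 (g x)) ->
  (square_norm f <= C%:E * square_norm g)%E.
Proof.
move=> mf mg C0 fg; rewrite /square_norm -ge0_integralZl_EFin//.
- apply: ge0_le_integral => //.
  + by move=> x _; rewrite lee_fin cmod2_ge0.
  + by apply/measurable_EFinP; exact: measurable_cmod2.
  + by apply: measurable_funeM; apply/measurable_EFinP; exact: measurable_cmod2.
  + by move=> x _; rewrite -EFinM lee_fin.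
- by move=> x _; rewrite lee_fin cmod2_ge0.
- by apply/measurable_EFinP; exact: measurable_cmod2.
Qed.

(** The inequality |z + w|^2 <= 2 |z|^2 + 2 |w|^2 stands in for the triangle inequality; it is the
    origin of the tolerances e / 4 below. *)
Lemma square_normD_le f g : complex_measurable f -> complex_measurable g ->
  (square_norm (fun x => (f x + g x)%R) <=
   2%:E * square_norm f + 2%:E * square_norm g)%E.
Proof.
move=> mf mg; have mf2 := measurable_cmod2 mf; have mg2 := measurable_cmod2 mg.
rewrite /square_norm -ge0_integralZl_EFin//; last 2 first.
- by move=> x _; rewrite lee_fin cmod2_ge0.
- exact/measurable_EFinP.
rewrite -ge0_integralZl_EFin//; last 2 first.
- by move=> x _; rewrite lee_fin cmod2_ge0.
- exact/measurable_EFinP.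
rewrite -ge0_integralD//; last 4 first.
- by move=> x _; rewrite mule_ge0// lee_fin// cmod2_ge0.
- by apply: measurable_funeM; exact/measurable_EFinP.
- by move=> x _; rewrite mule_ge0// lee_fin// cmod2_ge0.
- by apply: measurable_funeM; exact/measurable_EFinP.
apply: ge0_le_integral => //.
- by move=> x _; rewrite lee_fin cmod2_ge0.
- by apply/measurable_EFinP; apply: measurable_cmod2; exact: complex_measurableD.
- by apply: emeasurable_funD; apply: measurable_funeM; exact/measurable_EFinP.
- by move=> x _; rewrite -!EFinM -EFinD lee_fin cmod2D_le.
Qed.

Lemma trig_poly_cat s t x : trig_poly (s ++ t) x = trig_poly s x + trig_poly t x.
Proof. by rewrite /trig_poly big_cat. Qed.

Lemma trig_approximable_lim S f : complex_measurable f ->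
  (forall e : R, 0 < e -> exists g, [/\ complex_measurable g,
     trig_approximable S g & (square_norm (fun x => (f x - g x)%R) < e%:E)%E]) ->
  trig_approximable S f.
Proof.
move=> mf h e e0; have e40 : 0 < e / 4 by rewrite divr_gt0.
have [g [mg ag fg]] := h _ e40; have [s [sS gs]] := ag _ e40.
exists s; split => //.
rewrite (_ : (fun x => _) = fun x => (f x - g x) + (g x - trig_poly s x)); last first.
  by apply/funext => x; rewrite subrKA.
have ms := complex_measurable_trig s.
apply: (le_lt_trans (square_normD_le _ _)); [exact: complex_measurableB..|].
exact: lte_two_quarters.
Qed.

Lemma trig_approximable_expchar S xi : S xi -> trig_approximable S (expchar xi).
Proof.
move=> Sxi e e0; exists [:: (1, xi)]; split.
  by move=> p; rewrite inE => /eqP ->.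
rewrite /square_norm (eq_integral (fun=> 0%E)) ?integral0 ?lte_fin// => x _.
by rewrite /trig_poly big_seq1 mul1r subrr cmod2_0.
Qed.

Lemma trig_approximableD S f g : complex_measurable f -> complex_measurable g ->
  trig_approximable S f -> trig_approximable S g ->
  trig_approximable S (fun x => f x + g x).
Proof.
move=> mf mg af ag e e0; have e40 : 0 < e / 4 by rewrite divr_gt0.
have [s [sS fs]] := af _ e40; have [t [tS gt]] := ag _ e40.
exists (s ++ t); split.
  by move=> p; rewrite mem_cat => /orP[/sS|/tS].
rewrite (_ : (fun x => _) = fun x => (f x - trig_poly s x) + (g x - trig_poly t
  x)); last first.
  by apply/funext => x; rewrite trig_poly_cat opprD addrACA.
have ms := complex_measurable_trig s; have mt := complex_measurable_trig t.
apply: (le_lt_trans (square_normD_le _ _)); [exact: complex_measurableB..|].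
exact: lte_two_quarters.
Qed.

Lemma trig_approximableZ S (c : R[i]) f : complex_measurable f ->
  trig_approximable S f -> trig_approximable S (fun x => c * f x).
Proof.
move=> mf af e e0; have c0 := cmod2_ge0 c.
have c10 : 0 < cmod2 c + 1 by rewrite ltr_wpDl.
have [s [sS fs]] := af _ (divr_gt0 e0 c10).
exists [seq (c * p.1, p.2) | p <- s]; split.
  by move=> _ /mapP[p ps ->] /=; exact: sS.
have ms := complex_measurable_trig s.
apply: (@le_lt_trans _ _ ((cmod2 c + 1)%:E *
    square_norm (fun x => (f x - trig_poly s x)%R))%E).
  apply: le_square_norm.
  - apply: complex_measurableB; last exact: complex_measurable_trig.
    by apply: complex_measurableM => //; exact: complex_measurable_cst.
  - exact: complex_measurableB.
  - exact: ltW.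
  move=> x; rewrite (_ : _ - _ = c * (f x - trig_poly s x)).
    by rewrite cmod2M ler_wpM2r ?cmod2_ge0// lerDl.
  rewrite mulrBr; congr (_ - _); rewrite /trig_poly big_map big_distrr/=.
  by apply: eq_bigr => p _; rewrite mulrA.
by rewrite -[e](mulfVK (lt0r_neq0 c10)) mulrC EFinM lte_pmul2l.
Qed.

Lemma trig_approximable0 S : trig_approximable S (fun=> 0).
Proof.
move=> e e0; exists [::]; split => //.
rewrite /square_norm (eq_integral (fun=> 0%E)) ?integral0 ?lte_fin// => x _.
by rewrite /trig_poly big_nil subrr cmod2_0.
Qed.

Lemma trig_approximable_sum S (I : eqType) (t : seq I) (F : I -> V -> R[i]) :
  (forall i, complex_measurable (F i)) ->
  (forall i, i \in t -> trig_approximable S (F i)) ->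
  trig_approximable S (fun x => \sum_(i <- t) F i x).
Proof.
move=> mF; elim: t => [|i t ih] aF.
  by under eq_fun do rewrite big_nil; exact: trig_approximable0.
under eq_fun do rewrite big_cons; apply: trig_approximableD => //.
- elim: (t) => [|j u [ihR ihI]].
    by under eq_fun do rewrite big_nil; exact: complex_measurable_cst.
  by under eq_fun do rewrite big_cons; apply: complex_measurableD => //; split.
- by apply: aF; rewrite mem_head.
- by apply: ih => j jt; apply: aF; rewrite inE jt orbT.
Qed.

Lemma trig_approximable_trans S f : complex_measurable f ->
  (forall xi, trig_approximable S (expchar xi)) ->
  trig_approximable setT f -> trig_approximable S f.
Proof.
move=> mf aS af; apply: trig_approximable_lim => // e /af[s [_ fs]].
exists (trig_poly s); split => //; first exact: complex_measurable_trig.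
apply: trig_approximable_sum => [p|p _].
  apply: complex_measurableM; first exact: complex_measurable_cst.
  exact: complex_measurable_expchar.
by apply: trig_approximableZ; [exact: complex_measurable_expchar|exact: aS].
Qed.

(** Multiplication by a character preserves distances and translates the frequencies. *)
Lemma trig_approximableM_expchar f xi : complex_measurable f ->
  trig_approximable setT f -> trig_approximable setT (fun x => f x * expchar xi x).
Proof.
move=> mf af e e0; have [s [_ fs]] := af e e0.
exists [seq (p.1, p.2 + xi) | p <- s]; split => //.
rewrite /square_norm; under eq_integral => x _.
  rewrite (_ : _ - _ = (f x - trig_poly s x) * expchar xi x); last first.
    rewrite mulrBl; congr (_ - _); rewrite /trig_poly big_map big_distrl/=.
    by apply: eq_bigr => p _; rewrite expcharDl mulrA.
  rewrite cmod2M cmod2_expchar mulr1; over.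
exact: fs.
Qed.

(** Only [g] is replaced by a polynomial at first: as [f] is bounded, f g is then close to a
    combination of products of [f] with characters. *)
Lemma trig_approximableM f g (C : R) : complex_measurable f -> complex_measurable g ->
  (forall x, cmod2 (f x) <= C) ->
  trig_approximable setT f -> trig_approximable setT g ->
  trig_approximable setT (fun x => f x * g x).
Proof.
move=> mf mg fC af ag; apply: trig_approximable_lim.
  exact: complex_measurableM.
have C0 : 0 <= C by apply: le_trans (fC 0); exact: cmod2_ge0.
have C1 : 0 < C + 1 by rewrite ltr_wpDl.
move=> e e0; have [s [_ gs]] := ag _ (divr_gt0 e0 C1).
have ms := complex_measurable_trig s.
exists (fun x => f x * trig_poly s x); split.
- exact: complex_measurableM.
- rewrite (_ : (fun x => _) = fun x => \sum_(p <- s) p.1 * (f x * expchar p.2 x)).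
    apply: trig_approximable_sum => [p|p _].
      apply: complex_measurableM; first exact: complex_measurable_cst.
      by apply: complex_measurableM => //; exact: complex_measurable_expchar.
    apply: trig_approximableZ.
      by apply: complex_measurableM => //; exact: complex_measurable_expchar.
    exact: trig_approximableM_expchar.
  apply/funext => x; rewrite /trig_poly big_distrr/=.
  by apply: eq_bigr => p _; rewrite mulrCA.
apply: (@le_lt_trans _ _ ((C + 1)%:E *
    square_norm (fun x => (g x - trig_poly s x)%R))%E).
  apply: le_square_norm.
  - by apply: complex_measurableB; exact: complex_measurableM.
  - exact: complex_measurableB.
  - exact: ltW.
  move=> x; rewrite -mulrBr cmod2M ler_wpM2r ?cmod2_ge0//.
  by rewrite (le_trans (fC x))// lerDl.
by rewrite -[e](mulfVK (lt0r_neq0 C1)) mulrC EFinM lte_pmul2l.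
Qed.

End SquareDistance.

(** * Density of trigonometric polynomials *)

Section NewtonSign.
Variable R : realType.

(* Newton-Schulz iteration: polynomials in v converging to its sign on [-1, 1]. *)
Fixpoint newton_sign (n : nat) (v : R) : R :=
  if n is m.+1 then newton_sign m v * (3 - newton_sign m v * newton_sign m v) / 2
  else v.

Lemma newton_signN n v : newton_sign n (- v) = - newton_sign n v.
Proof. by elim: n => //= n ->; rewrite mulrNN !mulNr. Qed.

(** One step multiplies the distance 1 - p to the fixed point 1 by (1 - p)(2 + p) / 2, which is at
    most 1 - v / 2 because p >= v; for v > 0 the convergence is geometric. *)
Lemma newton_sign_pos n (v : R) : 0 <= v <= 1 ->
  v <= newton_sign n v <= 1 /\ 1 - newton_sign n v <= (1 - v / 2) ^+ n.
Proof.
move=> /andP[v0 v1]; elim: n => [|n [/andP[h1 h2] h3]].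
  by rewrite /= lexx v1 expr0 lerBlDr lerDl.
set p := newton_sign n v in h1 h2 h3; rewrite [newton_sign _ _]/= -/p.
have p0 : 0 <= p by exact: le_trans h1.
have E : 1 - p * (3 - p * p) / 2 = (1 - p) * ((1 - p) * (2 + p) / 2) by field.
have q1 : (1 - p) * (2 + p) / 2 <= 1 - v / 2.
  by rewrite -subr_ge0; nra.
have q0 : 0 <= (1 - p) * (2 + p) / 2.
  by rewrite divr_ge0// mulr_ge0 ?subr_ge0 ?addr_ge0.
split; last by rewrite E exprSr ler_pM// subr_ge0.
apply/andP; split; last by rewrite -subr_ge0 E mulr_ge0// subr_ge0.
apply: (le_trans h1); rewrite -subr_ge0.
rewrite (_ : _ - p = p * ((1 - p) * (1 + p)) / 2); last by field.
by rewrite divr_ge0// !mulr_ge0 ?subr_ge0 ?addr_ge0.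
Qed.

Lemma newton_sign_norm_le n (v : R) : `|v| <= 1 -> `|newton_sign n v| <= 1.
Proof.
wlog v0 : v / 0 <= v => [h|].
  have [/h//|v0] := leP 0 v; rewrite -normrN => v1.
  rewrite -normrN -newton_signN; apply: h => //.
  by rewrite oppr_ge0 ltW.
rewrite (ger0_norm v0) => v1; have [|/andP[h1 h2] _] := @newton_sign_pos n v.
  by rewrite v0.
by rewrite ger0_norm// (le_trans v0).
Qed.

Lemma newton_sign_cvg (v : R) : `|v| <= 1 -> newton_sign ^~ v @ \oo --> Num.sg v.
Proof.
have pos (u : R) : 0 < u -> u <= 1 -> newton_sign ^~ u @ \oo --> (1 : R).
  move=> u0 u1; have u01 : 0 <= u <= 1 by rewrite (ltW u0).
  have g : (fun n => (1 - u / 2) ^+ n) @ \oo --> (0 : R).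
    apply: cvg_expr; rewrite ger0_norm ?subr_ge0; last first.
      by rewrite ler_pdivrMr// mul1r (le_trans u1)// ler1n.
    by rewrite ltrBlDr ltrDl divr_gt0.
  have h : (fun n => 1 - (1 - u / 2) ^+ n) @ \oo --> (1 : R).
    by rewrite -[X in _ --> X](subr0 1); apply: cvgB => //; exact: cvg_cst.
  have h1 : (fun=> 1) @ \oo --> (1 : R) by exact: cvg_cst.
  apply: (squeeze_cvgr _ h h1); apply: nearW => n; have [/andP[_ ->]] :=
    newton_sign_pos n u01.
  by rewrite andbT lerBlDr addrC -lerBlDr.
move=> v1; case: (ltrgt0P v) => v0.
- by rewrite gtr0_sg//; apply: pos => //; rewrite gtr0_norm// in v1.
- rewrite ltr0_sg// (_ : newton_sign ^~ v = fun n => - newton_sign n (- v)); last first.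
    by apply/funext => n; rewrite newton_signN opprK.
  by apply: cvgN; apply: pos; rewrite ?oppr_gt0//; rewrite ltr0_norm// in v1.
- rewrite v0 sgr0 (_ : newton_sign ^~ 0 = fun=> 0); first exact: cvg_cst.
  by apply/funext; elim=> //= n ->; rewrite mul0r mul0r.
Qed.

End NewtonSign.

Section TrigonometricDensity.
Variables (R : realType) (d : nat) (mu : borel_prob R d).
Local Notation V := 'cV[R]_d.
Implicit Types (f g : V -> R) (xi : V).
Local Notation approx f := (trig_approximable mu setT f).

(** Real bounded functions in the closure of the trigonometric polynomials; boundedness is what
    makes the class stable under products. *)
Definition trig_class f := bounded_measurable f /\ approx (fun x => (f x)%:C).

Lemma complex_measurable_real f : bounded_measurable f ->
  complex_measurable (fun x => (f x)%:C).
Proof. by move=> [mf _]; split => //=; exact: measurable_cst. Qed.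

Lemma trig_classD f g : trig_class f -> trig_class g ->
  trig_class (fun x => f x + g x).
Proof.
move=> [bf af] [bg ag]; split; first exact: bounded_measurableD.
under eq_fun do rewrite rmorphD.
by apply: trig_approximableD => //; exact: complex_measurable_real.
Qed.

Lemma trig_classZ (c : R) f : trig_class f -> trig_class (fun x => c * f x).
Proof.
move=> [bf af]; split; first exact: bounded_measurableZ.
under eq_fun do rewrite rmorphM.
by apply: trig_approximableZ => //; exact: complex_measurable_real.
Qed.

Lemma trig_classM f g : trig_class f -> trig_class g ->
  trig_class (fun x => f x * g x).
Proof.
move=> [bf af] [bg ag]; split; first exact: bounded_measurableM.
under eq_fun do rewrite rmorphM; have [_ [M fM]] := bf.
apply: (@trig_approximableM _ _ _ _ _ (M ^+ 2)) => //.
- exact: complex_measurable_real.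
- exact: complex_measurable_real.
- move=> x; rewrite /cmod2 /= expr0n addr0 -real_normK ?num_real//.
  by rewrite lerXn2r ?nnegrE ?normr_ge0// (le_trans _ (fM x)).
Qed.

Lemma trig_class_expchar xi :
  trig_class (fun x => complex.Re (expchar xi x)) /\
  trig_class (fun x => complex.Im (expchar xi x)).
Proof.
have [cRe cIm] := expchar_continuous xi.
have a (eta : V) : approx (expchar eta) by exact: trig_approximable_expchar.
have me := complex_measurable_expchar.
split; split.
- exact: bounded_continuous_measurable cRe (Re_expchar_le1 xi).
- rewrite (_ : (fun x => _) = fun x => 2^-1 * (expchar xi x + expchar (- xi) x)).
    apply: trig_approximableZ; first exact: complex_measurableD.
    exact: trig_approximableD.
  apply/funext => x; by rewrite expcharNl addcJ mulrA mulVf ?mul1r// pnatr_eq0.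
- exact: bounded_continuous_measurable cIm (Im_expchar_le1 xi).
- rewrite (_ : (fun x => _) = fun x => (2 * 'i%C)^-1 * (expchar xi x + (-1) *
    expchar (- xi) x)).
    have mN : complex_measurable (fun x => -1 * expchar (- xi) x).
      by apply: complex_measurableM => //; exact: complex_measurable_cst.
    apply: trig_approximableZ; first exact: complex_measurableD.
    by apply: trig_approximableD => //; exact: trig_approximableZ.
  apply/funext => x; rewrite expcharNl mulN1r subcJ mulrAC mulrA.
  rewrite mulVf ?mul1r// mulf_neq0 ?pnatr_eq0//.
  by rewrite eq_complex /= oner_eq0 andbF.
Qed.

Lemma trig_class_cst (c : R) : trig_class (fun=> c).
Proof.
have := trig_classZ c (trig_class_expchar 0).1.
by congr trig_class; apply/funext => x; rewrite expchar0l mulr1.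
Qed.

(** Bounded pointwise convergence implies convergence in mean square, under which the closure is
    stable. *)
Lemma trig_class_lim (f_ : nat -> V -> R) f (M : R) : (forall n, trig_class (f_ n)) ->
  (forall n x, `|f_ n x| <= M) -> (forall x, f_ ^~ x @ \oo --> f x) ->
  trig_class f.
Proof.
move=> af_ fM f_f.
have mf : measurable_fun setT f.
  by apply: (@measurable_fun_cvg _ _ _ _ f_) => // n; exact: (af_ n).1.1.
have fM' x : `|f x| <= M by exact: (cvg_norm_le (f_f x)).
have bf : bounded_measurable f by split => //; exists M.
split => //; apply: trig_approximable_lim; first exact: complex_measurable_real.
have bg n : bounded_measurable (fun x => (f x - f_ n x) * (f x - f_ n x)).
  have bB : bounded_measurable (fun x => f x - f_ n x).
    apply: bounded_measurableD => //; under eq_fun do rewrite -mulN1r.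
    by apply: bounded_measurableZ; exact: (af_ n).1.
  exact: bounded_measurableM.
have [_ _ _ _ mlim] := Rintegral_mean mu.
have := mlim (fun n x => (f x - f_ n x) * (f x - f_ n x)) (fun=> 0) ((M + M) *
  (M + M)) bg (bounded_measurable_cst _ 0).
have h1 n x : `|(f x - f_ n x) * (f x - f_ n x)| <= (M + M) * (M + M).
  have h : `|f x - f_ n x| <= M + M by rewrite (le_trans (ler_normB _ _))// lerD.
  by rewrite normrM ler_pM.
have h2 x : (fun n => (f x - f_ n x) * (f x - f_ n x)) @ \oo --> (0 : R).
  have h : (fun n => f x - f_ n x) @ \oo --> (0 : R).
    by rewrite -(subrr (f x)); apply: cvgB => //; exact: cvg_cst.
  by rewrite -[X in _ --> X](mul0r 0); exact: (cvgM h h).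
move=> /(_ h1 h2); rewrite (mean_cst 0 (Rintegral_mean mu)) => hlim e e0.
have /cvgrPdist_lt/(_ e e0)[N _ hN] := hlim.
exists (fun x => (f_ N x)%:C); split.
- by apply: complex_measurable_real; exact: (af_ N).1.
- exact: (af_ N).2.
have := hN N (leqnn N); rewrite /= sub0r normrN => hNe.
rewrite /square_norm; under eq_integral => x _.
  rewrite (_ : cmod2 _ = (f x - f_ N x) * (f x - f_ N x)); last first.
    by rewrite -rmorphB /cmod2 /= expr0n addr0 expr2.
  over.
rewrite integral_EFin_Rintegral// lte_fin.
by rewrite (le_lt_trans (ler_norm _)).
Qed.

Lemma trig_class_newton f n : trig_class f -> trig_class (fun x => newton_sign n (f x)).
Proof.
move=> af; elim: n => //= n ih.
rewrite (_ : (fun x => _) = fun x => newton_sign n (f x) * (3 / 2 +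
    (- (1 / 2)) * (newton_sign n (f x) * newton_sign n (f x)))).
  apply: trig_classM => //; apply: trig_classD; first exact: trig_class_cst.
  by apply: trig_classZ; exact: trig_classM.
by apply/funext => x; field.
Qed.

Lemma trig_class_sg f : trig_class f -> (forall x, `|f x| <= 1) ->
  trig_class (fun x => Num.sg (f x)).
Proof.
move=> af f1; apply: (@trig_class_lim (fun n x => newton_sign n (f x)) _ 1).
- by move=> n; exact: trig_class_newton.
- by move=> n x; exact: newton_sign_norm_le.
- by move=> x; exact: newton_sign_cvg.
Qed.

Lemma trig_class_sin (i : 'I_d) (a b : R) : trig_class (fun x => sin (a * x i 0 + b)).
Proof.
(* This frequency cancels the factor -2 pi of the character. *)
pose xi : V := \col_j (if j == i then - a / (2 * pi) else 0).
have E (x : V) : - (2 * pi * dotr xi x) = a * x i 0.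
  rewrite /dotr (bigD1 i)//= big1 ?addr0; last first.
    by move=> j ji; rewrite mxE (negbTE ji) mul0r.
  have pi0 : pi != 0 :> R by rewrite gt_eqF// pi_gt0.
  rewrite /xi mxE eqxx; move: (pi : R) pi0 => p p0; field; exact: p0.
have [aRe aIm] := trig_class_expchar xi.
rewrite (_ : (fun x => _) = fun x => cos b * complex.Im (expchar xi x) +
    sin b * complex.Re (expchar xi x)).
  by apply: trig_classD; exact: trig_classZ.
by apply/funext => x; rewrite sinD /expchar E /= mulrC addrC mulrC addrC [sin _
  * cos b]mulrC [cos _ * sin b]mulrC.
Qed.

Lemma sg_sin_small (t : R) : `|t| < pi -> Num.sg (sin t) = Num.sg t.
Proof.
move=> tpi; case: (ltrgt0P t) tpi => t0 tpi.
- by rewrite !gtr0_sg// sin_gt0_pi// t0.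
- rewrite !ltr0_sg// -oppr_gt0 -sinN sin_gt0_pi// oppr_gt0 t0.
  by [].
- by rewrite t0 sin0.
Qed.

(** For n large, (x_i - a) / (n + 1) lies between -pi and pi, where the sine has the sign of its
    argument, so the periodicity disappears in the limit. *)
Lemma trig_class_sg_coord (i : 'I_d) (a : R) :
  trig_class (fun x => Num.sg (x i 0 - a)).
Proof.
apply: (@trig_class_lim (fun n x => Num.sg (sin (n.+1%:R^-1 * x i 0 + (-
  (n.+1%:R^-1 * a))))) _ 1).
- move=> n; apply: trig_class_sg; first exact: trig_class_sin.
  by move=> x; exact: sin_max.
- by move=> n x; rewrite normr_sg; case: (_ != 0).
move=> x; set t := x i 0 - a; apply: cvg_near_cst.
exists (Num.trunc (`|t| / pi)) => // n /= tn.
rewrite -mulrBr sg_sin_small; first by rewrite sgrM gtr0_sg ?mul1r// invr_gt0 ltr0n.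
rewrite normrM ger0_norm ?invr_ge0// mulrC ltr_pdivrMr ?ltr0n// -ltr_pdivrMl
  ?pi_gt0// mulrC.
rewrite (lt_le_trans (truncnS_gt _))// ler_nat ltnS//.
Qed.

Lemma bounded_measurable_trig_class f : bounded_measurable f -> trig_class f.
Proof.
pose S : set (set V) := [set A | trig_class (\1_A : V -> R)].
have sS : sigma_algebra setT S.
  have TC A : S A -> S (~` A).
    move=> SA; rewrite /S /= (_ : \1_(~` A) = fun x => 1 + (-1) * \1_A x :> R).
      by apply: trig_classD; [exact: trig_class_cst|exact: trig_classZ].
    apply/funext => x; rewrite mulN1r !indicE in_setC; case: (_ \in _) => /=.
      by rewrite subrr.
    by rewrite subr0.
  split.
  - by rewrite /S /= indic0; exact: trig_class_cst.
  - by move=> A; rewrite setTD; exact: TC.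
  - move=> A SA; rewrite /S /=.
    (* The indicator of the union of the first n sets, as a polynomial in their indicators. *)
    pose g n (x : V) : R := 1 + (-1) * \prod_(i < n) (1 + (-1) * \1_(A i) x).
    have gE n x : g n x = \1_(\bigcup_(i < n) A i) x.
      rewrite /g indicE; case: (boolP (x \in _)) => [|xA].
        rewrite inE => -[i /= ni Aix].
        rewrite (bigD1 (Ordinal ni))//= indicE mem_set// mulr1 subrr mul0r mulr0.
        by rewrite addr0.
      rewrite big1 ?mulr1 ?subrr// => i _.
      rewrite indicE memNset ?mulr0 ?addr0// => Aix.
      by move/negP: xA; apply; rewrite inE; exists i => /=.
    have ag n : trig_class (g n).
      apply: trig_classD; first exact: trig_class_cst.
      apply: trig_classZ; rewrite /g; elim: n => [|n ih].
        by under eq_fun do rewrite big_ord0; exact: trig_class_cst.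
      under eq_fun do rewrite big_ord_recr/=; apply: trig_classM => //.
      by apply: trig_classD; [exact: trig_class_cst|apply: trig_classZ; exact: SA].
    apply: (@trig_class_lim g _ 1) => //.
      move=> n x; rewrite gE indicE; case: (_ \in _); by rewrite ?normr1 ?normr0.
    move=> x; case: (boolP (x \in \bigcup_n A n)) => [|xA]; last first.
      rewrite indicE (negbTE xA); apply: cvg_near_cst; apply: nearW => n.
      rewrite gE indicE memNset// => -[i _ Aix].
      by move/negP: xA; apply; rewrite inE; exists i.
    move=> /[dup] xA; rewrite inE => -[k _ Akx]; rewrite indicE xA.
    apply: cvg_near_cst; exists k.+1 => // n /= kn.
    by rewrite gE indicE mem_set//; exists k.
have mS : @measurable _ V `<=` S.
  apply: sigma_algebra_half_spaces => // i a; rewrite /S /=.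
  have h := trig_class_sg_coord i a.
  (* With s the sign, (s + s^2) / 2 is 1 for s = 1 and 0 for s = 0 and s = -1. *)
  rewrite (_ : \1__ = fun x : V => 1 / 2 * (Num.sg (x i 0 - a) +
      Num.sg (x i 0 - a) * Num.sg (x i 0 - a))).
    by apply: trig_classZ; apply: trig_classD => //; exact: trig_classM.
  apply/funext => x; rewrite indicE; case: (ltrgt0P (x i 0 - a)) => h0.
  - rewrite gtr0_sg// mem_set/= -?(subr_gt0 a)// mulr1.
    by field.
  - rewrite ltr0_sg// memNset/=; first by field.
    by rewrite -(subr_gt0 a) => /lt_trans/(_ h0); rewrite ltxx.
  - rewrite h0 sgr0 memNset/=; first by rewrite mulr0 addr0 mulr0.
    by rewrite -(subr_gt0 a) h0 ltxx.
move: f; apply: bounded_measurable_ind => [A /mS//|f g _ _|c f _|f_ f M _ bf fM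
  f_f af_].
- exact: trig_classD.
- exact: trig_classZ.
- exact: (trig_class_lim af_ fM f_f).
Qed.

End TrigonometricDensity.

(** * A criterion for spectral pairs *)

Section SpectralPairs.
Variables (R : realType) (d : nat) (mu : borel_prob R d).
Local Notation V := 'cV[R]_d.
Implicit Types (f : V -> R[i]) (xi : V) (s : seq (R[i] * V)) (F : seq V).

Lemma L2normE f : L2norm mu f = sqrte (square_norm mu f).
Proof.
rewrite /L2norm unlock -poweR12_sqrt ?square_norm_ge0//; congr (_ `^ _)%E.
apply: eq_integral => x _; rewrite /= ger0_norm ?cmodE ?sqrtr_ge0//.
by rewrite powR_mulrn ?sqrtr_ge0// sqr_sqrtr// cmod2_ge0.
Qed.

Lemma L2norm_lt f (e : R) : 0 < e -> (square_norm mu f < (e ^+ 2)%:E)%E ->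
  (L2norm mu f < e%:E)%E.
Proof.
move=> e0; rewrite L2normE; have := square_norm_ge0 mu f.
case: (square_norm mu f) => [r| |]//=; rewrite !lee_fin !lte_fin => r0 re.
by rewrite -(ger0_norm (ltW e0)) -sqrtr_sqr ltr_sqrt// exprn_gt0.
Qed.

Lemma in_L2_square_norm f : in_L2 mu f ->
  complex_measurable f /\ (square_norm mu f < +oo)%E.
Proof.
move=> [mr mi]; rewrite L2normE => h; split => //.
by move: h; have := square_norm_ge0 mu f; case: (square_norm mu f) => [r| |]//=
  _ _; rewrite ltry.
Qed.

Lemma trig_approximable_bounded f : bounded_measurable (fun x => complex.Re (f x)) ->
  bounded_measurable (fun x => complex.Im (f x)) -> trig_approximable mu setT f.
Proof.
move=> bRe bIm; have [_ aRe] := bounded_measurable_trig_class mu bRe.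
have [_ aIm] := bounded_measurable_trig_class mu bIm.
rewrite (_ : f = fun x => (complex.Re (f x))%:C + 'i%C * (complex.Im (f x))%:C).
  have mIm := complex_measurable_real bIm.
  apply: trig_approximableD => //; [exact: complex_measurable_real| |exact:
    trig_approximableZ].
  by apply: complex_measurableM => //; exact: complex_measurable_cst.
by apply/funext => x; rewrite -complexE.
Qed.

(** Truncation to the set where |f| <= n reduces to bounded functions; the squared error is
    dominated by |f|^2. *)
Lemma trig_approximable_L2 f : in_L2 mu f -> trig_approximable mu setT f.
Proof.
move=> /in_L2_square_norm[mf fin]; apply: trig_approximable_lim => // e e0.
pose A n : set V := [set x | cmod2 (f x) <= n%:R ^+ 2].
have mA n : measurable (A n).
  rewrite -[A n]setTI; apply: (measurable_fun_le (f := fun x => cmod2 (f x)) (g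
    := fun=> n%:R ^+ 2)) => //.
  exact: measurable_cmod2.
pose g n (x : V) : R[i] := f x * (\1_(A n) x)%:C.
have m1 n : complex_measurable (fun x : V => (\1_(A n) x)%:C).
  exact: complex_measurable_real (bounded_measurable_indic R (mA n)).
have mg n : complex_measurable (g n) by exact: complex_measurableM.
have gA n x : g n x = if x \in A n then f x else 0.
  by rewrite /g indicE; case: (_ \in _); rewrite ?mulr1 ?mulr0.
have sqle n (a : R) : a ^+ 2 <= n%:R ^+ 2 -> `|a| <= n%:R.
  by move=> h; rewrite -(@ler_pXn2r _ 2) ?nnegrE// real_normK ?num_real.
have bRe n : bounded_measurable (fun x => complex.Re (g n x)).
  split; first exact: (mg n).1.
  exists n%:R => x; rewrite gA; case: (boolP (x \in A n)); last by rewrite normr0.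
  rewrite inE => Ax; apply: sqle; apply: le_trans Ax.
  by rewrite /cmod2 lerDl sqr_ge0.
have bIm n : bounded_measurable (fun x => complex.Im (g n x)).
  split; first exact: (mg n).2.
  exists n%:R => x; rewrite gA; case: (boolP (x \in A n)); last by rewrite normr0.
  rewrite inE => Ax; apply: sqle; apply: le_trans Ax.
  by rewrite /cmod2 lerDr sqr_ge0.
have hE n x : cmod2 (f x - g n x) = if x \in A n then 0 else cmod2 (f x).
  by rewrite gA; case: ifP; rewrite ?subrr ?cmod2_0 ?subr0.
have [|||||_ _ lim] := @dominated_convergence _ _ _ mu setT measurableT
    (fun n x => (cmod2 (f x - g n x))%:E) (fun=> 0%E) (fun x => (cmod2 (f x))%:E).
- move=> n; apply/measurable_EFinP; apply: measurable_cmod2.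
  exact: complex_measurableB.
- exact: measurable_cst.
- apply: aeW => x _; apply: cvg_near_cst.
  exists (Num.trunc (cmod2 (f x))).+1 => // n /= fn.
  rewrite hE mem_set// /A /=.
  have h1 : cmod2 (f x) <= n%:R.
    by apply: ltW; rewrite (lt_le_trans (truncnS_gt _))// ler_nat.
  rewrite (le_trans h1)// expr2 ler_peMr// ler1n.
  exact: leq_trans fn.
- apply/integrableP; split; first by apply/measurable_EFinP; exact: measurable_cmod2.
  under eq_integral => x _ do rewrite /= ger0_norm ?cmod2_ge0//.
  exact: fin.
- apply: aeW => x n _; rewrite /= ger0_norm ?cmod2_ge0// lee_fin hE.
  by case: ifP => _ //; exact: cmod2_ge0.
rewrite integral0 in lim.
have [[N1 _ hN1] /cvgrPdist_lt/(_ e e0)[N2 _ hN2]] := (fine_cvgP _ _).1 lim.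
pose n := maxn N1 N2; exists (g n); split => //.
  exact: trig_approximable_bounded.
have h1 := hN1 n (leq_maxl _ _); have h2 := hN2 n (leq_maxr _ _).
rewrite /= in h1 h2; rewrite /square_norm -(fineK h1) lte_fin.
by rewrite (le_lt_trans (ler_norm _))// -normrN -sub0r.
Qed.

Lemma fourier0 : fourier mu 0 = 1.
Proof.
rewrite /fourier /cintegral; have m := Rintegral_mean mu.
have -> : (fun x : V => complex.Re (expchar 0 x)) = fun=> 1.
  by apply/funext => x; rewrite expchar0l.
have -> : (fun x : V => complex.Im (expchar 0 x)) = fun=> 0.
  by apply/funext => x; rewrite expchar0l.
by rewrite (mean_cst 1 m) (mean_cst 0 m).
Qed.

Lemma bounded_Re_expchar xi : bounded_measurable (fun x => complex.Re (expchar xi x)).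
Proof.
have [cRe _] := expchar_continuous xi.
exact: bounded_continuous_measurable cRe (Re_expchar_le1 xi).
Qed.

Lemma bounded_Im_expchar xi : bounded_measurable (fun x => complex.Im (expchar xi x)).
Proof.
have [_ cIm] := expchar_continuous xi.
exact: bounded_continuous_measurable cIm (Im_expchar_le1 xi).
Qed.

Lemma fourierN xi : fourier mu (- xi) = conjc (fourier mu xi).
Proof.
rewrite /fourier /cintegral /conjc; congr (_ +i* _).
  by apply: eq_Rintegral => x _; rewrite expcharNl; case: (expchar xi x).
have [_ mZ _ _ _] := Rintegral_mean mu; rewrite -mulN1r -mZ; last exact:
  bounded_Im_expchar.
by apply: eq_Rintegral => x _; rewrite expcharNl mulN1r; case: (expchar xi x).
Qed.

Lemma Re_mul_expcharE (c : R[i]) xi x : complex.Re (c * expchar xi x) =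
  complex.Re c * complex.Re (expchar xi x) + (- complex.Im c) * complex.Im
    (expchar xi x).
Proof. by case: c => a b; case: (expchar xi x) => u v /=; rewrite mulNr. Qed.

Lemma bounded_Re_mul_expchar (c : R[i]) xi :
  bounded_measurable (fun x => complex.Re (c * expchar xi x)).
Proof.
under eq_fun do rewrite Re_mul_expcharE.
apply: bounded_measurableD; apply: bounded_measurableZ.
  exact: bounded_Re_expchar.
exact: bounded_Im_expchar.
Qed.

Lemma Rintegral_Re_expchar (c : R[i]) xi :
  \int[mu]_x complex.Re (c * expchar xi x) = complex.Re (c * fourier mu xi).
Proof.
have [mD mZ _ _ _] := Rintegral_mean mu.
have bR := bounded_Re_expchar xi; have bI := bounded_Im_expchar xi.
under eq_Rintegral do rewrite Re_mul_expcharE.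
rewrite mD; [|exact: bounded_measurableZ..].
by rewrite !mZ// /fourier /cintegral; case: c => a b /=; rewrite mulNr.
Qed.

Lemma square_norm_trig s : square_norm mu (trig_poly s) =
  (\sum_(p <- s) \sum_(q <- s)
     complex.Re (p.1 * conjc q.1 * fourier mu (p.2 - q.2)))%:E.
Proof.
have E x : cmod2 (trig_poly s x) = \sum_(p <- s) \sum_(q <- s)
    complex.Re (p.1 * conjc q.1 * expchar (p.2 - q.2) x).
  transitivity (complex.Re (cmod2 (trig_poly s x))%:C) => //.
  rewrite cmod2_conj /trig_poly (rmorph_sum conjc) big_distrlr/= Re_sum.
  apply: eq_bigr => p _; rewrite Re_sum; apply: eq_bigr => q _.
  by rewrite conjcM -expcharNl mulrACA -expcharDl.
have b p q : bounded_measurable (fun x =>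
    complex.Re ((p : R[i] * V).1 * conjc (q : R[i] * V).1 * expchar (p.2 - q.2) x)).
  exact: bounded_Re_mul_expchar.
have m := Rintegral_mean mu.
rewrite /square_norm; under eq_integral do rewrite E.
rewrite integral_EFin_Rintegral; last first.
  by apply: bounded_measurable_sum => p; exact: bounded_measurable_sum.
rewrite (mean_sum _ m); last by move=> p; exact: bounded_measurable_sum.
congr EFin; apply: eq_bigr => p _; rewrite (mean_sum _ m)//.
by apply: eq_bigr => q _; rewrite Rintegral_Re_expchar.
Qed.

(** Bessel's identity for a finite orthonormal family: the transform at xi - l is the coefficient of
    the character of frequency xi along that of frequency l. *)
Lemma square_norm_projection F xi : uniq F ->
  (forall l l', l \in F -> l' \in F -> fourier mu (l - l') = (l == l')%:R) ->
  square_norm mu (fun x => expchar xi x -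
    trig_poly [seq (fourier mu (xi - l), l) | l <- F] x) =
  (1 - \sum_(l <- F) cmod2 (fourier mu (xi - l)))%:E.
Proof.
move=> uF oF; pose c l := fourier mu (xi - l).
rewrite (_ : (fun x => _) = trig_poly ((1, xi) :: [seq (- c l, l) | l <- F]));
  last first.
  apply/funext => x; rewrite /trig_poly big_cons mul1r !big_map -sumrN.
  by congr (_ + _); apply: eq_bigr => l _; rewrite mulNr.
have ReD (a b : R[i]) : complex.Re (a + b) = complex.Re a + complex.Re b.
  by case: a; case: b.
have cc l : complex.Re (c l * conjc (c l)) = cmod2 (c l) by rewrite -cmod2_conj.
have conjN (z : R[i]) : conjc (- z) = - conjc z by exact: (rmorphN conjc).
have ReN (a : R[i]) : complex.Re (- a) = - complex.Re a by case: a.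
(* The entries of the quadratic form. In the row of each l, the entry -|c_l|^2 cancels the diagonal
   entry |c_l|^2; only the row of xi remains. *)
pose G (p q : R[i] * V) := complex.Re (p.1 * conjc q.1 * fourier mu (p.2 - q.2)).
have G1 : G (1, xi) (1, xi) = 1.
  by rewrite /G [_.2]/= subrr fourier0 (rmorph1 conjc) !mulr1.
have G2 l : G (1, xi) (- c l, l) = - cmod2 (c l).
  by rewrite /G [_.1]/= [_.1 in X in conjc X]/= conjN mul1r mulNr mulrC ReN cc.
have G3 l : G (- c l, l) (1, xi) = - cmod2 (c l).
  by rewrite /G [_.1 in X in conjc X]/= (rmorph1 conjc) mulr1 [_.2]/= -opprB fourierN
    mulNr ReN cc.
have G4 l l' : l \in F -> l' \in F ->
    G (- c l, l) (- c l', l') = (l == l')%:R * cmod2 (c l).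
  move=> lF l'F; rewrite /G [_.2 - _]/= oF// conjN mulrNN.
  by case: eqP => [<-|_]; rewrite ?mulr1 ?mul1r ?cc// mulr0 mul0r.
rewrite square_norm_trig; congr EFin; rewrite big_cons big_cons big_map.
rewrite -/(G _ _) G1 big_map.
under eq_bigr do rewrite -/(G _ _) G2.
under [X in _ + X]eq_bigr do rewrite big_cons -/(G _ _) G3.
rewrite sumrN [X in _ + X]big_seq [X in _ + X]big1 ?addr0// => l lF.
rewrite big_map (_ : \sum_(_ <- _) _ = \sum_(l' <- F) (l == l')%:R * cmod2 (c l)).
  rewrite -big_distrl/= (bigD1_seq l)//= eqxx big1 ?addr0 ?mul1r ?addNr// => l' l'l.
  by rewrite eq_sym (negbTE l'l).
by apply: eq_big_seq => l' l'F; rewrite -/(G _ _) G4.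
Qed.

(** The criterion of Jorgensen and Pedersen: Parseval's identity at every character places all
    characters in the closed span of [Lambda], and the characters are total in L^2. *)
Lemma spectral_pairP (Lambda : set V) : countable Lambda ->
  (forall l l', Lambda l -> Lambda l' -> fourier mu (l - l') = (l == l')%:R) ->
  (forall xi (e : R), 0 < e -> exists F, [/\ uniq F, forall l, l \in F -> Lambda l &
     1 - e < \sum_(l <- F) cmod2 (fourier mu (xi - l))]) ->
  spectral_pair mu Lambda.
Proof.
move=> cL oL complete; split => //.
  move=> l l' Ll Ll'; rewrite -oL// /L2dot /fourier; congr cintegral.
  by apply/funext => x; rewrite expcharDl expcharNl conjCE.
have aL xi : trig_approximable mu Lambda (expchar xi).
  move=> e e0; have [F [uF FL hF]] := complete xi e e0.
  exists [seq (fourier mu (xi - l), l) | l <- F]; split.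
    by move=> _ /mapP[l lF ->]; exact: FL.
  rewrite square_norm_projection// ?lte_fin ?ltrBlDl -?ltrBlDr//.
  by move=> l l' /FL Ll /FL Ll'; exact: oL.
move=> f Lf e e0; have [mf _] := in_L2_square_norm Lf.
have af := trig_approximable_trans mf aL (trig_approximable_L2 Lf).
have [s [sL fs]] := af (e ^+ 2) (exprn_gt0 2 e0).
(* Recurring frequencies of [s] are merged by adding their coefficients. *)
pose F := [fset p.2 | p in s]%fset.
exists F, (fun l => \sum_(p <- s | p.2 == l) p.1); split.
  by move=> l /= /imfsetP[p /= ps ->]; exact: sL.
apply: L2norm_lt => //; apply: le_lt_trans fs.
rewrite le_eqVlt; apply/orP; left; apply/eqP; congr square_norm.
apply/funext => x; congr (_ - _).
under eq_bigr do rewrite big_distrl/=.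
rewrite (exchange_big_dep xpredT)//= /trig_poly big_seq [RHS]big_seq.
apply: eq_bigr => p ps; have pF : p.2 \in F by apply/imfsetP; exists p.
rewrite big_mkcond (bigD1_seq p.2) ?fset_uniq//= eqxx big1 ?addr0// => l lp.
by rewrite eq_sym (negbTE lp).
Qed.

End SpectralPairs.

(** * Construction of the common spectrum *)

Section EuclideanNorm.
Variables (R : realType) (d : nat).
Local Notation V := 'cV[R]_d.
Implicit Types (x y : V) (M : 'M[R]_d).

Lemma dotr_ge0 x : 0 <= dotr x x.
Proof. by apply: sumr_ge0 => i _; rewrite -expr2 sqr_ge0. Qed.

Lemma enorm_ge0 x : 0 <= enorm x.
Proof. exact: sqrtr_ge0. Qed.

Lemma enorm_sqr x : enorm x ^+ 2 = dotr x x.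
Proof. by rewrite sqr_sqrtr// dotr_ge0. Qed.

Lemma dotrDl x y z : dotr (x + y) z = dotr x z + dotr y z.
Proof. by rewrite dotrC dotrDr !(dotrC z). Qed.

Lemma dotrZl (a : R) x y : dotr (a *: x) y = a * dotr x y.
Proof. by rewrite dotrC dotrZr dotrC. Qed.

Lemma enorm_le_l1 x : enorm x <= \sum_i `|x i 0|.
Proof.
have S0 : 0 <= \sum_i `|x i 0| by apply: sumr_ge0.
rewrite -(ger0_norm S0) -sqrtr_sqr ler_wsqrtr// expr2 big_distrl/=.
apply: ler_sum => i _; rewrite (le_trans (ler_norm _))// normrM ler_wpM2l//.
by rewrite (bigD1 i)//= lerDl sumr_ge0.
Qed.

Lemma coord_le_enorm x i : `|x i 0| <= enorm x.
Proof.
rewrite -sqrtr_sqr ler_wsqrtr// /dotr (bigD1 i)//= expr2 lerDl.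
by apply: sumr_ge0 => j _; rewrite -expr2 sqr_ge0.
Qed.

Lemma enorm0_eq0 x : enorm x = 0 -> x = 0.
Proof.
move=> x0; apply/matrixP => i j; rewrite (ord1 j) mxE; apply/eqP.
by rewrite -normr_le0 -x0 coord_le_enorm.
Qed.

Lemma enormZ (a : R) x : enorm (a *: x) = `|a| * enorm x.
Proof.
by rewrite /enorm dotrZl dotrZr mulrA -expr2 sqrtrM ?sqr_ge0// sqrtr_sqr.
Qed.

Lemma enorm0 : enorm (0 : V) = 0.
Proof. by rewrite -(scale0r 0) enormZ normr0 mul0r. Qed.

Lemma cauchy_schwarz x y : dotr x y <= enorm x * enorm y.
Proof.
have [y0|y0] := eqVneq (enorm y) 0.
  rewrite y0 mulr0 (enorm0_eq0 y0).
  by have := dotrZr 0 0 x; rewrite scale0r mul0r => ->.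
have yy : 0 < dotr y y by rewrite -enorm_sqr exprn_even_gt0.
have h : dotr x y ^+ 2 <= (enorm x * enorm y) ^+ 2.
  rewrite exprMn !enorm_sqr -subr_ge0 -(pmulr_rge0 _ yy).
  have := dotr_ge0 (dotr y y *: x + (- dotr x y) *: y).
  rewrite !(dotrDl, dotrDr, dotrZl, dotrZr) (dotrC y x).
  by congr (_ <= _); ring.
rewrite (le_trans (ler_norm _))// -(@ler_pXn2r _ 2) ?nnegrE ?mulr_ge0 ?enorm_ge0//.
by rewrite real_normK ?num_real.
Qed.

Lemma enormD_le x y : enorm (x + y) <= enorm x + enorm y.
Proof.
rewrite -(@ler_pXn2r _ 2) ?nnegrE ?addr_ge0 ?enorm_ge0// enorm_sqr.
rewrite sqrrD !enorm_sqr dotrDl !dotrDr (dotrC y x).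
have h := cauchy_schwarz x y; rewrite mulr2n.
by rewrite !addrA lerD2r -!addrA lerD2l lerD.
Qed.

Lemma spectral_normP M x : enorm (M *m x) <= spectral_norm M * enorm x.
Proof.
(* The sum of the moduli of the entries is an upper bound; without one the supremum would be a
   default value. *)
pose C := \sum_i \sum_j `|M i j|.
have ub (y : V) : enorm y <= 1 -> enorm (M *m y) <= C.
  move=> y1; rewrite (le_trans (enorm_le_l1 _))//; apply: ler_sum => i _.
  rewrite mxE (le_trans (ler_norm_sum _ _ _))//; apply: ler_sum => j _.
  by rewrite normrM ler_piMr// (le_trans (coord_le_enorm _ _)).
have hs (y : V) : enorm y <= 1 -> enorm (M *m y) <= spectral_norm M.
  move=> y1; apply: ub_le_sup; last by exists y.
  by exists C => _ [z /= z1 <-]; exact: ub.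
have [x0|x0] := eqVneq (enorm x) 0.
  by rewrite (enorm0_eq0 x0) mulmx0 enorm0 mulr0.
have x_gt0 : 0 < enorm x by rewrite lt_neqAle eq_sym x0 enorm_ge0.
rewrite -ler_pdivrMr// mulrC -[(enorm x)^-1]ger0_norm ?invr_ge0 ?enorm_ge0//.
rewrite -enormZ scalemxAr; apply: hs.
by rewrite enormZ ger0_norm ?invr_ge0 ?enorm_ge0// mulVf.
Qed.

(** By Cauchy-Schwarz, |M^T x|^2 = <x, M M^T x> <= |x| r |M^T x|, and one factor |M^T x| is divided
    out. *)
Lemma enorm_trmx_le M (r : R) : 0 <= r -> (forall x, enorm (M *m x) <= r * enorm x) ->
  forall x, enorm (M^T *m x) <= r * enorm x.
Proof.
move=> r0 Mr x; have [Mx0|Mx0] := eqVneq (enorm (M^T *m x)) 0.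
  by rewrite Mx0 mulr_ge0// enorm_ge0.
have Mx_gt0 : 0 < enorm (M^T *m x) by rewrite lt_neqAle eq_sym Mx0 enorm_ge0.
rewrite -(ler_pM2r Mx_gt0) -expr2 enorm_sqr -dotr_mulmx.
rewrite (le_trans (cauchy_schwarz _ _))//.
by rewrite [leRHS]mulrAC mulrC ler_wpM2r ?enorm_ge0.
Qed.

Lemma contraction_ratio (Rs : nat -> 'M[int]_d) :
  (ereal_sup (range (fun k =>
     (spectral_norm (invmx (intmx R (Rs k))))%:E)) < 1)%E ->
  exists r : R, [/\ 0 <= r, r < 1 &
    forall k x, enorm (invmx (intmx R (Rs k)) *m x) <= r * enorm x].
Proof.
set S := ereal_sup _ => S1.
have ubS k : ((spectral_norm (invmx (intmx R (Rs k))))%:E <= S)%E.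
  by apply: ereal_sup_ubound; exists k.
have Sfin : S \is a fin_num.
  rewrite fin_numE -ltey (lt_trans S1 (ltry _)) andbT.
  by rewrite gt_eqF// (lt_le_trans (ltNyr _) (ubS 0%N)).
exists (Num.max 0 (fine S)); split.
- by rewrite le_max lexx.
- by rewrite gt_max ltr01 -lte_fin fineK.
- move=> k x; rewrite (le_trans (spectral_normP _ _))// ler_wpM2r ?enorm_ge0//.
  by rewrite le_max; apply/orP; right; rewrite -lee_fin fineK.
Qed.

Lemma prod_mx_contraction (Rs : nat -> 'M[int]_d) (r : R) :
  (forall k, intmx R (Rs k) \in unitmx) -> 0 <= r ->
  (forall k x, enorm (invmx (intmx R (Rs k)) *m x) <= r * enorm x) ->
  forall n x, enorm ((invmx (prod_mx R Rs n))^T *m x) <= r ^+ n * enorm x.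
Proof.
move=> uR r0 hr n x; elim: n => [|n ih].
  by rewrite /= invmx1 trmx1 mul1mx mul1r.
rewrite /= invmxM ?uR ?prod_mx_unit// trmx_mul -mulmxA exprS -mulrA.
rewrite (le_trans (enorm_trmx_le r0 (hr n) _))//.
by rewrite ler_wpM2l.
Qed.

End EuclideanNorm.

(** * Spectra of finite convolutions, common to both sequences *)

Section SpectraOfPartialConvolutions.
Variables (R : realType) (d : nat).
Local Notation V := 'cV[R]_d.
Variables (Rs : nat -> 'M[int]_d).
Hypothesis uR : forall k, intmx R (Rs k) \in unitmx.
Local Notation P := (prod_mx R Rs).
Local Notation PZ := (int_prod_mx Rs).
Implicit Types (B : nat -> {fset 'cV[int]_d}) (s : seq 'cV[int]_d).

Lemma inv_prod_mx_tr n (x y : V) :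
  (invmx (P n))^T *m (x + (P n)^T *m y) = (invmx (P n))^T *m x + y.
Proof.
by rewrite mulmxDr [X in _ + X]mulmxA -trmx_mul mulmxV ?prod_mx_unit// trmx1 mul1mx.
Qed.

(* s is a spectrum of mu_n: taking xi = - l for l in s shows that s is
   duplicate free and orthogonal. *)
Definition partial_spectrum B n s := forall xi : V,
  \sum_(l <- s) cmod2 (partial_fourier Rs B n (xi + intmx R l)) = 1.

Lemma partial_spectrum0 B : partial_spectrum B 0 [:: 0].
Proof.
by move=> xi; rewrite big_seq1 /partial_fourier /= expchar0r /cmod2 /= expr1n
  expr0n addr0.
Qed.

(** The added vectors are periods of the transform of mu_n, and in the new mask they become
    translations by the dual digits, so the inner sum of squared masks is 1. *)
Lemma partial_spectrum_extend B n s L : (0 < #|` B n|)%N ->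
  dual_digits R (Rs n) (B n) L -> partial_spectrum B n s ->
  partial_spectrum B n.+1 [seq l + (PZ n)^T *m m | l <- s, m <- L].
Proof.
move=> Bn dL sp xi; rewrite big_allpairs_dep/= -[RHS](sp xi).
apply: eq_bigr => l _.
transitivity (\sum_(m <- L) cmod2 (partial_fourier Rs B n (xi + intmx R l)) *
    cmod2 (mask (Rs n) (B n) ((invmx (P n))^T *m (xi + intmx R l) + intmx R m))).
  apply: eq_bigr => m _; rewrite (partial_fourierS B uR) cmod2M.
  rewrite intmxD intmxM -intmx_tr (intmx_prod _ Rs) addrA partial_fourier_periodic//.
  by rewrite inv_prod_mx_tr.
by rewrite -big_distrr/= dual_digits_mask// mulr1.
Qed.

Lemma partial_spectrum_translate B n s (k : 'cV[int]_d -> 'cV[int]_d) :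
  partial_spectrum B n s ->
  partial_spectrum B n [seq l + (PZ n)^T *m k l | l <- s].
Proof.
move=> sp xi; rewrite big_map -[RHS](sp xi); apply: eq_bigr => l _.
by rewrite intmxD intmxM -intmx_tr (intmx_prod _ Rs) addrA partial_fourier_periodic.
Qed.

Lemma partial_fourier0 B n : (forall k, (0 < #|` B k|)%N) ->
  partial_fourier Rs B n (0 : V) = 1.
Proof.
move=> B0; rewrite /partial_fourier.
rewrite (_ : expchar 0 = fun=> 1); last by apply/funext => x; exact: expchar0l.
elim: n (0 : V) => [//|n ih] y; rewrite /= /digit_avg.
under eq_bigr do rewrite ih.
by rewrite big_const_seq count_predT iter_addr_0 mulVf// pnatr_eq0 -lt0n.
Qed.

Lemma partial_spectrum_orthogonal B n s : (forall k, (0 < #|` B k|)%N) ->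
  partial_spectrum B n s -> uniq s /\ forall l l', l \in s -> l' \in s -> l != l' ->
    cmod2 (partial_fourier Rs B n (intmx R l - intmx R l')) = 0.
Proof.
move=> B0 sp.
(* [rem] deletes a single occurrence, so the same identity also excludes repeated elements. *)
have rem0 l l' : l' \in s -> l \in rem l' s ->
    cmod2 (partial_fourier Rs B n (intmx R l - intmx R l')) = 0.
  move=> l's; have := sp (- intmx R l'); rewrite (perm_big _ (perm_to_rem l's))/=.
  rewrite big_cons addNr partial_fourier0// [X in X + _](_ : _ = 1); last first.
    by rewrite /cmod2 /= expr1n expr0n addr0.
  move/eqP; rewrite -subr_eq0 addrAC subrr add0r psumr_eq0.
    by move=> /allP h /h/=/eqP; rewrite addrC.
  by move=> m _; exact: cmod2_ge0.
have nrem l : l \in s -> l \notin rem l s.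
  move=> ls; apply/negP => /(rem0 _ _ ls); rewrite subrr partial_fourier0//.
  by rewrite /cmod2 /= expr1n expr0n addr0 => /eqP; rewrite oner_eq0.
split; last first.
  move=> l l' ls l's ll'; apply: rem0 => //.
  by move: ls; rewrite (perm_mem (perm_to_rem l's)) inE (negbTE ll').
apply: count_mem_uniq => l; case: (boolP (l \in s)) => ls; last exact/count_memPn.
by rewrite (permP (perm_to_rem ls))/= eqxx (count_memPn (nrem _ ls)).
Qed.

Variables (B B' : nat -> {fset 'cV[int]_d}).
Hypothesis B0 : forall k, (0 < #|` B k|)%N.
Hypothesis B'0 : forall k, (0 < #|` B' k|)%N.
Variable L : nat -> seq 'cV[int]_d.
Hypothesis L0 : forall k, 0 \in L k.
Hypothesis dL : forall k, dual_digits R (Rs k) (B k) (L k).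
Hypothesis dL' : forall k, dual_digits R (Rs k) (B' k) (L k).

Lemma common_spectrum_extend n m s : partial_spectrum B n s -> partial_spectrum
  B' n s ->
  exists t : seq _, [/\ {subset s <= t}, partial_spectrum B (n + m) t &
    partial_spectrum B' (n + m) t].
Proof.
move=> sp sp'; elim: m => [|m [t [st tp tp']]]; first by exists s; rewrite addn0; split.
exists [seq l + (PZ (n + m))^T *m k | l <- t, k <- L (n + m)]; rewrite addnS; split.
- move=> l /st lt; apply/allpairsP; exists (l, 0) => /=; split => //.
  by rewrite mulmx0 addr0.
- exact: partial_spectrum_extend.
- exact: partial_spectrum_extend.
Qed.

Variable r : R.
Hypothesis r0 : 0 <= r.
Hypothesis r1 : r < 1.
Hypothesis Rr : forall k (x : V), enorm (invmx (intmx R (Rs k)) *m x) <= r * enorm x.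
Variables (nu nu' : nat -> borel_prob R d) (eps delta : R).
Hypothesis delta0 : 0 < delta.

(** One [k] serves both tails, so that the translated points are good for both measures at once. *)
Definition equi_positive_at n := forall x : V,
  (forall i, - (1 / 2) <= x i 0 < 1 / 2) ->
  exists k : 'cV[int]_d, (x = 0 -> k = 0) /\
    forall y : V, enorm y < delta ->
      eps <= cmod (fourier (nu n) (x + y + intmx R k)) /\
      eps <= cmod (fourier (nu' n) (x + y + intmx R k)).

(** The room left for [y] will receive the rescaled argument xi of the transform. *)
Definition bounded_below_at n s := forall l, l \in s ->
  forall y : V, enorm y < delta / 2 ->
    eps <= cmod (fourier (nu n) ((invmx (P n))^T *m intmx R l + y)) /\
    eps <= cmod (fourier (nu' n) ((invmx (P n))^T *m intmx R l + y)).

Hypothesis good : forall n, exists m, (n <= m)%N /\ equi_positive_at m.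

Lemma vanishing_seq (C e : R) : 0 < e -> exists N, forall n, (N <= n)%N -> r ^+
  n * C < e.
Proof.
move=> e0; have h : (fun n => r ^+ n * C) @ \oo --> (0 * C : R).
  apply: cvgM; last exact: cvg_cst.
  by apply: cvg_expr; rewrite ger0_norm.
rewrite mul0r in h; have /cvgrPdist_lt/(_ e e0)[N _ hN] := h.
exists N => n /hN /=; rewrite sub0r normrN; exact: le_lt_trans (ler_norm _).
Qed.

Lemma vanishing_seqs s (e : R) : 0 < e -> exists N, forall n, (N <= n)%N ->
  forall l, l \in s -> enorm ((invmx (P n))^T *m intmx R l) < e.
Proof.
move=> e0; elim: s => [|a s [N hN]]; first by exists 0%N.
have [N' hN'] := vanishing_seq (enorm (intmx R a)) e0.
exists (maxn N N') => n; rewrite geq_max => /andP[Nn N'n] l.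
rewrite inE => /predU1P[->|]; last exact: hN.
by rewrite (le_lt_trans (prod_mx_contraction uR r0 Rr _ _))// hN'.
Qed.

Lemma round_vector (w : V) : exists z : 'cV[int]_d,
  forall i, - (1 / 2) <= (w - intmx R z) i 0 < 1 / 2.
Proof.
exists (\col_i Num.floor (w i 0 + 1 / 2)) => i; rewrite !mxE.
have /andP[h1 h2] := floor_itv (w i 0 + 1 / 2).
rewrite intrD in h2; apply/andP; split; lra.
Qed.

Lemma common_spectrum_step n s : partial_spectrum B n s -> partial_spectrum B' n s ->
  exists m t, [/\ (n < m)%N, {subset s <= t}, partial_spectrum B m t,
    partial_spectrum B' m t & bounded_below_at m t].
Proof.
move=> sp sp'; have d20 : 0 < delta / 2 by rewrite divr_gt0.
have [N hN] := vanishing_seqs s d20.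
have [m [mN gm]] := good (maxn N n.+1); move: mN; rewrite geq_max => /andP[Nm nm].
have [t [st tp tp']] := common_spectrum_extend (m - n) sp sp'.
rewrite subnKC ?(ltnW nm)// in tp tp'.
have hk (l : 'cV[int]_d) : exists k : 'cV[int]_d, (l \in s -> k = 0) /\
    forall y : V, enorm y < delta / 2 ->
    eps <= cmod (fourier (nu m) ((invmx (P m))^T *m intmx R l + intmx R k + y)) /\
    eps <= cmod (fourier (nu' m) ((invmx (P m))^T *m intmx R l + intmx R k + y)).
  set w := (invmx (P m))^T *m intmx R l.
  have [ls|ls] := boolP (l \in s).
    (* For an old point the rescaled [w] is itself small: it is absorbed, at the cost of half of
       delta, in the perturbation around x = 0, where k = 0. *)
    have [|k [kz hk]] := gm 0.
      by move=> i; rewrite mxE; apply/andP; split; lra.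
    exists 0; split => // y yd; rewrite (_ : intmx R 0 = 0); last first.
      by apply/matrixP => i j; rewrite !mxE.
    have wd : enorm (w + y) < delta.
      by rewrite (le_lt_trans (enormD_le _ _))// (splitr delta) ltrD// hN.
    have := hk _ wd; rewrite (kz erefl) (_ : intmx R 0 = 0).
      by rewrite !addr0 add0r.
    by apply/matrixP => i j; rewrite !mxE.
  have [z hz] := round_vector w; have [k [_ hk]] := gm _ hz.
  (* Translation by -z brings [w] into the unit cube, where equi-positivity provides [k]. *)
  exists (k - z); split => // y yd.
  rewrite (_ : w + _ + y = w - intmx R z + y + intmx R k); last first.
    by rewrite intmxB addrA (addrAC w) -!addrA; congr (_ + (_ + _)); rewrite addrC.
  apply: hk; rewrite (lt_le_trans yd)// ler_pdivrMr// ler_peMr ?(ltW delta0)//.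
  by rewrite ler1n.
have [k kP] := choice hk.
exists m, [seq l + (PZ m)^T *m k l | l <- t]; split => //.
- move=> l ls; apply/mapP; exists l; first exact: st.
  by rewrite (kP l).1// mulmx0 addr0.
- exact: partial_spectrum_translate.
- exact: partial_spectrum_translate.
- move=> _ /mapP[l _ ->] y yd; have := (kP l).2 y yd.
  rewrite intmxD intmxM -intmx_tr (intmx_prod _ Rs).
  by rewrite inv_prod_mx_tr.
Qed.

(** The lower bound is stated from j + 1 on, since the initial spectrum {0} of mu_0 = delta_0 comes
    without one. *)
Lemma common_spectrum_chain : exists (n : nat -> nat) (s : nat -> seq 'cV[int]_d),
  forall j, [/\ (n j < n j.+1)%N, {subset s j <= s j.+1}, partial_spectrum B (n
    j) (s j),
    partial_spectrum B' (n j) (s j) & bounded_below_at (n j.+1) (s j.+1)].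
Proof.
pose T := {p : nat * seq 'cV[int]_d |
  partial_spectrum B p.1 p.2 /\ partial_spectrum B' p.1 p.2}.
have step (p : T) : exists q : T, [/\ ((sval p).1 < (sval q).1)%N,
    {subset (sval p).2 <= (sval q).2} & bounded_below_at (sval q).1 (sval q).2].
  case: p => -[n s] /= [sp sp'].
  have [m [t [nm st tp tp' bt]]] := common_spectrum_step sp sp'.
  by exists (exist _ (m, t) (conj tp tp')).
have [f fP] := choice step.
pose p0 : T := exist _ (0%N, [:: 0]) (conj (partial_spectrum0 B)
  (partial_spectrum0 B')).
exists (fun j => (sval (iter j f p0)).1), (fun j => (sval (iter j f p0)).2) => j.
have [h1 h2 h3] := fP (iter j f p0).
by have [h4 h5] := proj2_sig (iter j f p0); split.
Qed.

End SpectraOfPartialConvolutions.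

Lemma sum_uniq_sub (R : realType) (T : eqType) (s t : seq T) (g : T -> R) :
  uniq s -> uniq t -> {subset s <= t} ->
  \sum_(x <- t) g x = \sum_(x <- s) g x + \sum_(x <- t | x \notin s) g x.
Proof.
move=> us ut st; rewrite (bigID (mem s))/=; congr (_ + _).
rewrite -big_filter; apply: perm_big; apply: uniq_perm => //.
  exact: filter_uniq.
by move=> x; rewrite mem_filter; case: (boolP (x \in s)) => // /st ->.
Qed.

(** * Orthogonality and completeness of the limit of the chain *)

Section SpectrumFromChain.
Variables (R : realType) (d : nat).
Local Notation V := 'cV[R]_d.
Variables (Rs : nat -> 'M[int]_d) (B : nat -> {fset 'cV[int]_d}).
Hypothesis uR : forall k, intmx R (Rs k) \in unitmx.
Hypothesis B0 : forall k, (0 < #|` B k|)%N.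
Variable r : R.
Hypothesis r0 : 0 <= r.
Hypothesis r1 : r < 1.
Hypothesis Rr : forall k (x : V), enorm (invmx (intmx R (Rs k)) *m x) <= r * enorm x.
Variables (mu : borel_prob R d) (nu : nat -> borel_prob R d).
Hypothesis mu_convol : is_infinite_convol Rs B mu.
Hypothesis nu_tail : is_tail_seq Rs B nu.
Variables (n : nat -> nat) (s : nat -> seq 'cV[int]_d) (eps delta : R).
Hypothesis eps0 : 0 < eps.
Hypothesis delta0 : 0 < delta.
Hypothesis nS : forall j, (n j < n j.+1)%N.
Hypothesis sS : forall j, {subset s j <= s j.+1}.
Hypothesis sP : forall j, partial_spectrum R Rs B (n j) (s j).
Hypothesis below : forall j l, l \in s j.+1 -> forall y : V, enorm y < delta ->
  eps <= cmod (fourier (nu (n j.+1)) ((invmx (prod_mx R Rs (n j.+1)))^T *m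
    intmx R l + y)).

Let pf m xi : R[i] := partial_fourier Rs B m xi.

Let n_ge j : (j <= n j)%N.
Proof. by elim: j => // j ih; exact: leq_ltn_trans (nS j). Qed.

Let s_sub i j : (i <= j)%N -> {subset s i <= s j}.
Proof.
move=> /subnKC <-; elim: (j - i)%N => [|k ih]; first by rewrite addn0.
by move=> l /ih; rewrite addnS; exact: sS.
Qed.

Let s_uniq j : uniq (s j).
Proof. by have [] := partial_spectrum_orthogonal B0 (sP j). Qed.

Let pf_cvg xi : (fun m => cmod2 (pf m xi)) @ \oo --> cmod2 (fourier mu xi).
Proof. exact: cmod2_partial_fourier_cvg. Qed.

Definition chain_limit : set V := [set l | exists j k, k \in s j /\ l = intmx R k].

(** The transform at the difference is a limit of values that vanish at the stages [n J] once both
    points have entered [s J]. *)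
Let chain_limit_orthogonal l l' : chain_limit l -> chain_limit l' ->
  fourier mu (l - l') = (l == l')%:R.
Proof.
move=> [i [k [ki ->]]] [j [k' [k'j ->]]].
have [->|kk'] := eqVneq k k'; first by rewrite subrr fourier0 eqxx.
rewrite (_ : (intmx R k == intmx R k') = false); last first.
  by apply/negP => /eqP/intmx_inj; exact/eqP.
apply/eqP; rewrite -cmod2_eq0 eq_le cmod2_ge0 andbT; apply/ler_addgt0Pr => e e0.
rewrite add0r; have /cvgrPdist_lt/(_ e e0)[N _ hN] := pf_cvg (xi := intmx R k -
  intmx R k').
pose J := maxn N (maxn i j).
have iJ : (i <= J)%N by rewrite /J !leq_max leqnn orbT.
have jJ : (j <= J)%N by rewrite /J !leq_max leqnn !orbT.
have [_ oJ] := partial_spectrum_orthogonal B0 (sP J).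
have := hN (n J) (leq_trans (leq_maxl _ _) (n_ge J)).
rewrite /= /pf oJ ?subr0//; [|exact: s_sub ki|exact: s_sub k'j].
by rewrite ger0_norm ?cmod2_ge0// => /ltW.
Qed.

Let S xi j : R := \sum_(l <- s j) cmod2 (fourier mu (xi + intmx R l)).

(** At a late stage the sum over [s j] is part of a sum of nonnegative terms equal to 1. *)
Let bessel xi j : S xi j <= 1.
Proof.
apply/ler_addgt0Pr => e e0.
have h : (fun m => \sum_(l <- s j) cmod2 (pf m (xi + intmx R l))) @ \oo --> S xi j.
  by apply: cvg_sumr => l; exact: pf_cvg.
have /cvgrPdist_lt/(_ e e0)[N _ hN] := h.
pose J := maxn N j; have jJ : (j <= J)%N by exact: leq_maxr.
have := hN (n J) (leq_trans (leq_maxl _ _) (n_ge J)).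
rewrite /= => /(le_lt_trans (ler_norm _)) /ltW; rewrite lerBlDr => h1.
rewrite (le_trans h1)// addrC lerD2r -(sP J xi) (sum_uniq_sub _ (s_uniq j) (s_uniq J)).
  by rewrite lerDl sumr_ge0// => l _; exact: cmod2_ge0.
exact: s_sub.
Qed.

(** The rescaled xi is eventually shorter than delta, so the tail factor of |mu^(xi + l)|^2 is at
    least eps^2, uniformly in l. *)
Let lower_bound xi : exists J, forall j, (J <= j)%N -> forall l, l \in s j ->
  eps ^+ 2 * cmod2 (pf (n j) (xi + intmx R l)) <= cmod2 (fourier mu (xi + intmx R l)).
Proof.
have [N hN] := vanishing_seq r0 r1 (enorm xi) delta0.
exists N.+1 => -[//|j] Nj l lj; have nj0 : (0 < n j.+1)%N by exact:
  leq_ltn_trans (nS j).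
rewrite (cmod2_fourier_tail (xi + intmx R l) uR B0 mu_convol (nu_tail nj0)).
rewrite mulrC ler_wpM2l ?cmod2_ge0// mulmxDr addrC cmod2E.
rewrite lerXn2r ?nnegrE ?(ltW eps0)//; first by rewrite cmodE sqrtr_ge0.
apply: below => //; rewrite (le_lt_trans (prod_mx_contraction uR r0 Rr _ _))//.
by apply: hN; rewrite (leq_trans (ltnW Nj))// n_ge.
Qed.

(** Let J be such that S_J is within eta of the limit of S. At a later stage j the exact sum 1
    splits in two: over [s J] it is below S_J + eta, and over the new points it is at most eps^-2
    (S_j - S_J) by [lower_bound], hence at most eps^-2 eta. No mass escapes through the new
    points. *)
Let parseval xi (e : R) : 0 < e -> exists j, 1 - e < S xi j.
Proof.
move=> e0; have ndS : nondecreasing_seq (S xi).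
  apply/nondecreasing_seqP => j; rewrite /S (sum_uniq_sub _ (s_uniq j) (s_uniq j.+1)).
    by rewrite lerDl sumr_ge0// => l _; exact: cmod2_ge0.
  exact: sS.
have cS : cvgn (S xi).
  by apply: nondecreasing_is_cvgn => //; exists 1 => _ [j _ <-]; exact: bessel.
have e20 : 0 < eps ^+ 2 by rewrite exprn_gt0.
(* Chosen so that eta + eps^-2 eta = e / 2. *)
pose eta := e / (2 * (1 + (eps ^+ 2)^-1)).
have c0 : 0 < 2 * (1 + (eps ^+ 2)^-1) by rewrite mulr_gt0// ltr_wpDr// invr_ge0 ltW.
have eta0 : 0 < eta by rewrite divr_gt0.
have etaE : eta + (eps ^+ 2)^-1 * eta = e / 2.
  have q0 : 1 + (eps ^+ 2)^-1 != 0 by rewrite gt_eqF// ltr_wpDr// invr_ge0 ltW.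
  by rewrite /eta; move: (eps ^+ 2)^-1 q0 => q q0; field.
have /cvgrPdist_lt/(_ eta eta0)[J1 _ hJ1] := cS.
have [J2 hJ2] := lower_bound xi.
pose J := maxn J1 J2.
have h : (fun m => \sum_(l <- s J) cmod2 (pf m (xi + intmx R l))) @ \oo --> S xi J.
  by apply: cvg_sumr => l; exact: pf_cvg.
have /cvgrPdist_lt/(_ eta eta0)[N _ hN] := h.
pose j := maxn N J; have Jj : (J <= j)%N by exact: leq_maxr.
have h1 : \sum_(l <- s J) cmod2 (pf (n j) (xi + intmx R l)) < S xi J + eta.
  have := hN (n j) (leq_trans (leq_maxl _ _) (n_ge j)).
  by rewrite /= distrC => /(le_lt_trans (ler_norm _)); rewrite ltrBlDl addrC.
have h2 : \sum_(l <- s j | l \notin s J) cmod2 (pf (n j) (xi + intmx R l)) <=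
    (eps ^+ 2)^-1 * (S xi j - S xi J).
  rewrite /S (sum_uniq_sub _ (s_uniq J) (s_uniq j) (s_sub Jj)).
  rewrite [X in _ * (X - _)]addrC addrK big_distrr/= big_seq_cond [leRHS]big_seq_cond.
  apply: ler_sum => l /andP[lj _]; rewrite ler_pdivlMl//.
  by apply: hJ2 => //; rewrite (leq_trans _ Jj)// leq_maxr.
have h3 : S xi j - S xi J < eta.
  have SJ := hJ1 J (leq_maxl _ _); rewrite /= in SJ.
  have Sj : S xi j <= limn (S xi) by exact: nondecreasing_cvgn_le.
  apply: (le_lt_trans _ SJ); rewrite (le_trans _ (ler_norm _))// lerD2r//.
exists J; have := sP j xi.
rewrite (sum_uniq_sub _ (s_uniq J) (s_uniq j) (s_sub Jj)) -/(pf _ _) => E.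
have h4 : (eps ^+ 2)^-1 * (S xi j - S xi J) <= (eps ^+ 2)^-1 * eta.
  by rewrite ler_wpM2l ?invr_ge0 ?(ltW e20)// ltW.
have h5 : 1 < S xi J + eta + (eps ^+ 2)^-1 * eta.
  by rewrite -E ltr_leD// (le_trans h2).
rewrite -addrA etaE in h5; rewrite ltrBlDr (lt_trans h5)// ltrD2l.
by rewrite ltr_pdivrMr// ltr_pMr// ltr1n.
Qed.

Lemma spectral_pair_chain_limit : spectral_pair mu chain_limit.
Proof.
apply: spectral_pairP.
- apply: (@sub_countable _ _ _ (range (@intmx R d 1))).
    by apply: subset_card_le => l [j [k [_ ->]]]; exists k.
  exact: sub_countable (card_image_le _ _) (countableP _).
- exact: chain_limit_orthogonal.
(* The chain is summed at xi + l and the criterion at xi - l; conjugate symmetry of the transform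
   exchanges them when xi is replaced by -xi. *)
- move=> xi e /(parseval (- xi))[j hj].
  exists [seq intmx R k | k <- s j]; split.
  + by rewrite map_inj_uniq//; exact: intmx_inj.
  + by move=> _ /mapP[k kj ->]; exists j, k.
  + rewrite big_map; apply: (lt_le_trans hj); rewrite le_eqVlt; apply/orP; left.
    apply/eqP; apply: eq_bigr => k _.
    by rewrite -cmod2_conjc -fourierN opprD opprK.
Qed.

End SpectrumFromChain.

Theorem theorem2p4 (R : realType) (d : nat) (hd : (0 < d)%N)
  (Rs : nat -> 'M[int]_d) (B B' : nat -> {fset 'cV[int]_d})
  (hB : forall k, admissible_pair R (Rs k) (B k))
  (hB' : forall k, admissible_pair R (Rs k) (B' k))
  (hR : (ereal_sup (range (fun k =>
           (spectral_norm (invmx (intmx R (Rs k))))%:E)) < 1)%E)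
  (heq : equivalent_seq R B B')
  (hmod : forall k, congruent_mod (Rs k) (B k) (B' k))
  (mu : borel_prob R d)
  (hmu : is_infinite_convol Rs B mu)
  (hpos : equi_positive_convol R Rs B) :
  exists mu' : borel_prob R d,
    [/\ is_infinite_convol Rs B' mu',
        equi_positive_convol R Rs B' &
        exists Lambda : set 'cV[R]_d,
          [/\ Lambda `<=` range (@intmx R d 1),
              spectral_pair mu Lambda &
              spectral_pair mu' Lambda]].
Proof.
have uR k : intmx R (Rs k) \in unitmx by exact: admissible_unitmx (hB k).
have B0 k : (0 < #|` B k|)%N by have [_ /ltnW] := hB k.
have BB' k : #|` B k| = #|` B' k| by rewrite (congruent_mod_card (hmod k)).
have B'0 k : (0 < #|` B' k|)%N by rewrite -BB'.
have sB := equivalent_seq_summable heq.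
have [r [r0 r1 Rr]] := contraction_ratio hR.
have [nu tnu [n [n0 ni [eps [delta [eps0 delta0 hnu]]]]]] := hpos.
have [mu' hmu'] := perturbed_infinite_convol B0 BB' uR sB tnu.
have [nu' tnu'] : exists nu' : nat -> borel_prob R d, is_tail_seq Rs B' nu'.
  have h k : exists p : borel_prob R d,
      is_infinite_convol (Defs.shift k Rs) (Defs.shift k B') p.
    exact: (@perturbed_infinite_convol R d (Defs.shift k Rs) (Defs.shift k B)
      (Defs.shift k B') (fun j => B0 _) (fun j => BB' _) (fun j => uR _)
      (summable_discrepancy_shift k sB) _ (tail_seq_shift (n := k) tnu)).
  by have [nu' hnu'] := choice h; exists nu' => k _; exact: hnu'.
(* Half of eps is given up to the distance between the transforms of the two tails. *)
have e20 : 0 < eps / 2 by rewrite divr_gt0.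
have [N hN] := fourier_tail_close uR B0 BB' sB tnu tnu' e20.
have n_ge j : (j <= n j)%N by elim: j => // j ih; exact: leq_ltn_trans (ni _ _
  (ltnSn j)).
(* The subsequence is entered at position N, from which on its indices are at least N and the two
   tails are comparable. *)
have nN_ge j : (N <= n (N + j))%N by exact: leq_trans (leq_addr _ _) (n_ge _).
have nN_gt0 j : (0 < n (N + j))%N.
  have [N0|N0] := posnP (N + j)%N; first by rewrite N0.
  exact: leq_trans N0 (n_ge _).
(* The translation provided for the first tail is reused for the second, whose transform differs by
   at most eps / 2 at every frequency. *)
have both j : equi_positive_at nu nu' (eps / 2) delta (n (N + j)%N).
  move=> x hx; have [k [kx hk]] := hnu x _ hx (ex_intro2 _ _ (N + j)%N I erefl).
  exists k; split => // y yd; have h := hk y yd; split.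
    by apply: le_trans h; rewrite ler_pdivrMr// ler_peMr ?(ltW eps0)// ler1n.
  have := hN _ (nN_ge j) (nN_gt0 j) (x + y + intmx R k).
  by move=> /(le_trans h); rewrite {1}(splitr eps) lerD2r.
exists mu'; split; first exact: hmu'.
  exists nu'; first exact: tnu'.
  exists (fun j => n (N + j)%N); split.
  - exact: (nN_gt0 0%N).
  - by move=> i j ij; apply: ni; rewrite ltn_add2l.
  - exists (eps / 2), delta; split; [exact: e20|exact: delta0|] => x _ hx [j _ <-].
    have [k [kx hk]] := both j x hx; exists k; split => // y yd.
    by have [] := hk y yd.
have [L hL] := choice (fun k => admissible_dual_digits (hB k)).
have dL' k := dual_digits_congruent (uR k) (hmod k) (hL k).2.
have good m : exists m', (m <= m')%N /\ equi_positive_at nu nu' (eps / 2) delta m'.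
  by exists (n (N + m)%N); split => //; exact: leq_trans (leq_addl _ _) (n_ge _).
have [m [s hs]] := common_spectrum_chain uR B0 B'0 (fun k => (hL k).1)
  (fun k => (hL k).2) dL' r0 r1 Rr delta0 good.
have d20 : 0 < delta / 2 by rewrite divr_gt0.
exists (chain_limit s); split.
- by move=> _ [j [k [_ ->]]]; exists k.
- apply: (spectral_pair_chain_limit uR B0 r0 r1 Rr hmu tnu (n := m) e20 d20).
  + by move=> j; have [] := hs j.
  + by move=> j; have [] := hs j.
  + by move=> j; have [] := hs j.
  + move=> j l lj y yd; have [_ _ _ _ hb] := hs j.
    exact: (hb l lj y yd).1.
- apply: (spectral_pair_chain_limit uR B'0 r0 r1 Rr hmu' tnu' (n := m) e20 d20).
  + by move=> j; have [] := hs j.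
  + by move=> j; have [] := hs j.
  + by move=> j; have [] := hs j.
  + move=> j l lj y yd; have [_ _ _ _ hb] := hs j.
    exact: (hb l lj y yd).2.
Qed.
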